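(* Let $k\in\mathbb N$, let $s\ge2$ be real, and suppose that $\Delta_s^*$ is an admissible exponent for minor arcs with $\Delta_s^*<0$. Let $\theta$ be a real number with $0<\theta\le k/2$. Then for every $\varepsilon>0$ there exists $\eta>0$ such that, for all sufficiently large $P$, all $R$ with $2\le R\le P^\eta$ and all $Q$ with $P^\theta\le Q\le P^{k/2}$, one has \[ \int_{\mathfrak m(Q)}|f(\alpha;P,R)|^s\,d\alpha\ll P^{s-k}Q^{\varepsilon-2|\Delta_s^*|/k}, \] where the implied constant depends only on $\varepsilon,\eta,k,s,\theta$.
   Context: For real $P,R\ge1$, $\mathscr A(P,R)$ is the set of integers $n\in[1,P]$ all of whose prime divisors are at most $R$; $e(z)=e^{2\pi iz}$; $f(\alpha;P,R)=\sum_{x\in\mathscr A(P,R)}e(\alpha x^k)$; $U_u(P,R)=\int_0^1|f(\alpha;P,R)|^u\,d\alpha$. A real $\Delta_u$ is an admissible exponent (for $k$) if for every $\varepsilon>0$ there is $\eta>0$ (depending on $\varepsilon,k,u$) such that for $P$ sufficiently large and $1\le R\le P^\eta$ one has $U_u(P,R)\le CP^{u-k+\Delta_u+\varepsilon}$ with $C=C(\varepsilon,\eta,k,u)$. With admissible exponents $\Delta_u$ fixed for each $u$ under consideration, $\tau(k)=\max_{w\in\mathbb N}(k-2\Delta_{2w})/(4w^2)$ (assumed attained), and $\Delta_s^*=\min_{0\le t\le s-2}(\Delta_{s-t}-t\tau(k))$ is called an admissible exponent for minor arcs. For $1\le Q\le P^{k/2}$, $\mathfrak M(Q,P)$ is the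 union over integers $1\le q\le Q$, $0\le a\le q$, $(a,q)=1$ of $\{\alpha\in[0,1):|q\alpha-a|\le QP^{-k}\}$, and $\mathfrak m(Q)=[0,1]\setminus\mathfrak M(Q,P)$. *)

(* Defs.v *)
From HB Require Import structures.
From mathcomp Require Import all_boot all_order all_algebra.
From mathcomp Require Import all_classical all_reals all_analysis.
Set Implicit Arguments. Unset Strict Implicit. Unset Printing Implicit Defensive.
Import Order.TTheory GRing.Theory Num.Theory.
Local Open Scope classical_set_scope.
Local Open Scope ring_scope.

Section Defs.
Variable R : realType.

Definition smooth (P Rb : R) : seq nat :=
  [seq n <- iota 1 (Num.truncn P) | all (fun p => (p%:R : R) <= Rb) (primes n)].

Definition fRe (k : nat) (P Rb alpha : R) : R :=
  \sum_(x <- smooth P Rb) cos (2 * pi * alpha * (x%:R) ^+ k).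
Definition fIm (k : nat) (P Rb alpha : R) : R :=
  \sum_(x <- smooth P Rb) sin (2 * pi * alpha * (x%:R) ^+ k).
Definition absf (k : nat) (P Rb alpha : R) : R :=
  Num.sqrt (fRe k P Rb alpha ^+ 2 + fIm k P Rb alpha ^+ 2).

Definition intf (k : nat) (u : R) (P Rb : R) (D : set R) : \bar R :=
  (\int[@lebesgue_measure R]_(a in D) ((absf k P Rb a) `^ u)%:E)%E.

Definition U (k : nat) (u P Rb : R) : \bar R := intf k u P Rb `[0, 1]%classic.

Definition admissible (k : nat) (u Delta : R) : Prop :=
  forall eps : R, 0 < eps -> exists eta : R, 0 < eta /\
    exists C : R, exists P0 : R, forall P Rb : R, P0 <= P ->
      1 <= Rb -> Rb <= P `^ eta ->
      (U k u P Rb <= (C * P `^ (u - k%:R + Delta + eps))%:E)%E.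

Definition major (k : nat) (Q P : R) : set R :=
  [set alpha | 0 <= alpha < 1 /\
     exists q a : nat, [/\ (1 <= q)%N, (q%:R : R) <= Q, (a <= q)%N, coprime a q &
       `|q%:R * alpha - a%:R| <= Q * P `^ (- k%:R)]].

Definition minor (k : nat) (Q P : R) : set R :=
  [set alpha | 0 <= alpha <= 1 /\ ~ major k Q P alpha].

End Defs.

(* Main.v *)
Require Import Defs.
From HB Require Import structures.
From mathcomp Require Import all_boot all_order all_algebra.
From mathcomp Require Import all_classical all_reals all_analysis.
From mathcomp Require Import measurable_realfun complex ring lra zify.
Set Implicit Arguments. Unset Strict Implicit. Unset Printing Implicit Defensive.
Import Order.TTheory GRing.Theory Num.Theory numFieldNormedType.Exports.
Local Open Scope ring_scope.

(** Write W = P^delta with delta tiny. Splitting [Q, P^(k/2)] into boundedly many layers [Q, Q W],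
    it suffices to integrate over the alpha with |q alpha - a| <= QW P^-k for some coprime pair
    q <= QW, a, that are not in M(Q); put X = Q^(2/k), V = P/X.

    An x in A(P,R) whose part prime to q exceeds V factors uniquely as x = v z, where v in (V, VR]
    is coprime to q and collects the largest such primes of x; the other x number at most V W. Hence
    f(alpha) is O(V W) plus the sum over v of G_v = sum_z e((v z)^k alpha). Since alpha lies outside
    M(Q), the multiples n v^k alpha are well spaced, and a bilinear large-sieve argument with the
    2w-th moment bounds G_v by W^O(1) X^(1-tau). On the other hand G_v is a short sum, over d
    supported on the primes of q, of smooth sums f((v d)^k alpha; P/(v d), pdiv v).

    So |f|^s is bounded by V^(s-1) X^(t(1-tau)) times the sum over v and d of the u-th powers of
    these smooth sums, s = t + u. Integrated over the arcs, each of them contributes V^(-k) times a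
    full u-th moment: averaging over the shifts alpha + j v^(-k) fixes v^k alpha modulo 1 and meets
    few arcs, because v is coprime to q. The layer thus costs W^O(1) P^(s-k) X^(Delta_u - t tau).

    The admissible exponents satisfy Delta_u >= k + 1 - u (compare the u-th with the second moment),
    which makes the terms with small arguments harmless; Dirichlet's theorem shows that the layers
    exhaust [0,1), and Q >= P^theta turns W^O(1) into Q^eps. *)

(** The length X = Q^(2/k) left for z is dictated by a balance. A second factorization z = z1 z2,
    with both factors about S = Q^(1/k), turns G_v into a bilinear form in k-th powers up to about
    Q. The multiples n v^k alpha are known to be spaced by about 1/Q just for n up to about Q, so
    the large sieve costs only about Q = S^k. Let E, about S^(2w - k + Delta_2w), bound the 2w-th
    moment for each factor. Up to powers of W, |G_v|^(2 w^2) is then at most S^(4w(w - 1)) E^2 S^k =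
    X^(2 w^2 - (k - 2 Delta_2w)/2), whose root is X^(1 - tau): this is where the formula for tau
    comes from.

    In a layer the powers V^s V^-k X^(t(1 - tau)) X^(u - k + Delta_u) combine through V X = P and s
    = t + u.

    The obstacle is that q varies with alpha, while the factorization x = v z depends on q. Hence
    the majorant of |f|^s runs over all v and d; q enters it only through the restriction, for each
    v, to arcs with denominator coprime to v. *)

(** Smooth numbers, integers built from the primes of q, and the cofactors in the factorizations
    below are all of this form. *)
Definition pnats (pi : nat_pred) (n : nat) : seq nat :=
  [seq d <- iota 1 n | pi.-nat d].

Lemma mem_pnats (pi : nat_pred) n d :
  (d \in pnats pi n) = pi.-nat d && (d <= n)%N.
Proof.
rewrite mem_filter mem_iota add1n ltnS.
by case: (boolP (pi.-nat d)) => //= /andP[-> _].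
Qed.

Lemma pnats_uniq (pi : nat_pred) n : uniq (pnats pi n).
Proof. by rewrite filter_uniq // iota_uniq. Qed.

Lemma smoothE (R : realType) (P Rb : R) :
  smooth P Rb = pnats [pred p : nat | (p%:R : R) <= Rb] (Num.truncn P).
Proof.
apply: eq_in_filter => n; rewrite mem_iota => /andP[n1 _].
by rewrite /pnat n1.
Qed.

Lemma subset_pnats (pi rho : nat_pred) n m : {subset pi <= rho} -> (n <= m)%N ->
  {subset pnats pi n <= pnats rho m}.
Proof.
move=> sub nm d; rewrite !mem_pnats => /andP[pd dn].
by rewrite (leq_trans dn nm) (sub_in_pnat _ pd) // => p _; apply: sub.
Qed.

Lemma size_pnats (pi : nat_pred) n : (size (pnats pi n) <= n)%N.
Proof. by rewrite -[leqRHS](size_iota 1) size_filter count_size. Qed.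

(** A d divisible by p is p times an element of the last set, which still admits p because p^2 may
    divide d. *)
Lemma size_pnats_cons (p : nat) (ps : seq nat) n : prime p ->
  (size (pnats [pred r | r \in p :: ps] n) <=
   size (pnats [pred r | r \in ps] n) + size (pnats [pred r | r \in p :: ps] (n %/ p)))%N.
Proof.
move=> pp; rewrite -[X in (_ + X)%N](size_map (muln p)) -size_cat.
apply: uniq_leq_size; first exact: pnats_uniq.
move=> d; rewrite mem_pnats => /andP[pd dn]; rewrite mem_cat.
have d0 : (0 < d)%N by case/andP: pd.
case: (boolP (p %| d)%N) => pdvd.
- apply/orP; right; apply/mapP; exists (d %/ p)%N; last by rewrite mulnC divnK.
  rewrite mem_pnats leq_div2r // andbT.
  by apply: pnat_dvd pd; apply: dvdn_div.
- apply/orP; left; rewrite mem_pnats dn andbT.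
  apply/pnatP => // r pr rd; have := pnatP _ d0 pd r pr rd.
  rewrite !inE => /orP[/eqP re|//].
  by rewrite -re rd in pdvd.
Qed.


(** * Integers with restricted prime factors *)

Section CountSupported.
Variable R : realType.
Implicit Types (sigma : R).

Lemma le_powRl (a b r : R) : 0 <= r -> 0 <= a -> a <= b -> a `^ r <= b `^ r.
Proof.
by move=> r0 a0 ab; apply: (ge0_ler_powR r0) => //; rewrite nnegrE ?(le_trans a0).
Qed.

Lemma lt_powRl (a b r : R) : 0 < r -> 0 <= a -> a < b -> a `^ r < b `^ r.
Proof.
by move=> r0 a0 ab; apply: (gt0_ltr_powR r0) => //;
  rewrite nnegrE ?(le_trans a0 (ltW ab)).
Qed.

Lemma powRn_ge1 sigma (n : nat) : 0 <= sigma -> (0 < n)%N ->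
  1 <= (n%:R : R) `^ sigma.
Proof.
by move=> s0 n0; rewrite -[leLHS](powRr0 (n%:R : R)); apply: ler_powR; rewrite ?ler1n.
Qed.

Lemma onem_powRN_gt0 sigma (p : nat) : 0 < sigma -> (1 < p)%N ->
  0 < 1 - (p%:R : R) `^ (- sigma).
Proof.
move=> s0 p1; have p0 : 0 < (p%:R : R) by rewrite ltr0n ltnW.
rewrite subr_gt0 powRN invf_lt1; last exact: powR_gt0.
have : (1 : R) `^ sigma < p%:R `^ sigma by apply: lt_powRl; rewrite ?ltr1n.
by rewrite powR1.
Qed.

(* Rankin's trick: a multiple of [p] up to [n] is [p] times a number up to [n / p]. *)
Lemma size_pnats_rankin sigma (ps : seq nat) n : 0 < sigma -> all prime ps ->
  ((size (pnats [pred r | r \in ps] n))%:R : R) <=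
  n%:R `^ sigma * \prod_(p <- ps) (1 - p%:R `^ (- sigma))^-1.
Proof.
move=> s0; elim: ps n => [|p ps IH] n.
  move=> _; rewrite big_nil mulr1; case: n => [|n].
    by rewrite /= powR_ge0.
  apply: le_trans (powRn_ge1 (ltW s0) (ltn0Sn n)).
  rewrite -[1]/(1%:R) ler_nat -[1%N]/(size [:: 1%N]); apply: uniq_leq_size.
    exact: pnats_uniq.
  move=> d; rewrite mem_pnats inE => /andP[/andP[d0 /allP pd] _].
  case: d d0 pd => [|[|d]] // _ /(_ (pdiv d.+2)).
  by rewrite mem_primes pdiv_prime ?pdiv_dvd // => /(_ isT).
move=> /= /andP[pp pps].
have p1 := prime_gt1 pp; have p0 : (0 < p)%N by lia.
set C := \prod_(p <- ps) _ in IH.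
have C0 : 0 <= C.
  rewrite /C big_seq prodr_ge0 // => r /(allP pps) pr.
  by rewrite invr_ge0 ltW // onem_powRN_gt0 // prime_gt1.
have op := onem_powRN_gt0 s0 p1.
rewrite big_cons -/C.
elim/ltn_ind: n => n IHn.
case: n IHn => [|n] IHn.
  by rewrite /= !mulr_ge0 ?powR_ge0 // invr_ge0 ltW.
have np : (n.+1 %/ p < n.+1)%N by rewrite ltn_Pdiv.
apply: (@le_trans _ _ ((size (pnats [pred r | r \in ps] n.+1))%:R +
   (size (pnats [pred r | r \in p :: ps] (n.+1 %/ p)))%:R)).
  by rewrite -natrD ler_nat; exact: size_pnats_cons.
apply: le_trans (lerD (IH n.+1 pps) (IHn _ np)) _.
have h : ((n.+1 %/ p)%:R : R) `^ sigma <= n.+1%:R `^ sigma * p%:R `^ (- sigma).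
  rewrite powRN -powR_inv1 ?powR_ge0 // powRAC -powRM ?ler0n ?powR_ge0 //.
  rewrite powR_inv1 ?ler0n //; apply: le_powRl; rewrite ?(ltW s0) ?ler0n //.
  by rewrite ler_pdivlMr ?ltr0n // -natrM ler_nat leq_trunc_div.
set x := p%:R `^ _ in h op *; set N := n.+1%:R `^ _ in h *.
(* Since 1 + x / (1 - x) = 1 / (1 - x), the induction reproduces its own constant. *)
apply: (@le_trans _ _ (N * C + N * x * ((1 - x)^-1 * C))).
  by rewrite lerD2l ler_wpM2r // mulr_ge0 // invr_ge0 ltW.
rewrite le_eqVlt; apply/orP; left; apply/eqP; field; exact: lt0r_neq0.
Qed.

Lemma prod_primes_le (n : nat) : (0 < n)%N -> (\prod_(p <- primes n) p <= n)%N.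
Proof.
move=> n0; rewrite [leqRHS](prod_prime_decomp n0) prime_decompE big_map.
rewrite !big_seq; apply: leq_prod => p; rewrite mem_primes => /and3P[pp _ pn].
rewrite /= -[leqLHS]expn1 leq_exp2l ?prime_gt1 //.
by rewrite logn_gt0 mem_primes pp n0 pn.
Qed.

(** In Rankin's product a prime p >= 2^(1/sigma) has p^sigma >= 2, so its factor is at most p^sigma;
    these multiply to at most q^sigma because the product of the primes of q is at most q. The
    boundedly many smaller primes contribute at most [B] each. *)
Lemma size_pnats_supported sigma : 0 < sigma -> exists C : R, 0 < C /\
  forall q n : nat, (0 < q)%N ->
  ((size (pnats \pi(q) n))%:R : R) <= C * (n%:R * q%:R) `^ sigma.
Proof.
move=> s0.
set B : R := (1 - 2%:R `^ (- sigma))^-1.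
have oB : 0 < 1 - (2%:R : R) `^ (- sigma) by exact: onem_powRN_gt0.
have B1 : 1 <= B.
  by rewrite invf_ge1 // gerBl powR_ge0.
set T := (Num.truncn ((2%:R : R) `^ (sigma^-1))).+1.
exists (B ^+ T); split; first by rewrite exprn_gt0 // (lt_le_trans ltr01).
move=> q n q0.
apply: (@le_trans _ _ (n%:R `^ sigma * \prod_(p <- primes q) (1 - p%:R `^ (- sigma))^-1)).
  apply: le_trans (size_pnats_rankin n s0 _).
    by rewrite ler_nat; apply: eq_leq; congr size; apply: eq_filter => d; apply: eq_pnat.
  by apply/allP => p; rewrite mem_primes => /and3P[].
rewrite powRM // mulrCA ler_wpM2l ?powR_ge0 //.
apply: (@le_trans _ _ (\prod_(p <- primes q) ((if (p < T)%N then B else 1) * p%:R `^ sigma))).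
  rewrite !big_seq; apply: ler_prod => p; rewrite mem_primes => /and3P[pp _ _].
  have p1 := prime_gt1 pp.
  have op := onem_powRN_gt0 s0 p1.
  rewrite invr_ge0 (ltW op) /=.
  have x1 : 1 <= (p%:R : R) `^ sigma by rewrite powRn_ge1 ?(ltW s0) // prime_gt0.
  case: ltnP => pT.
    rewrite -[leLHS]mulr1; apply: ler_pM; rewrite ?invr_ge0 ?(ltW op) ?ler01 //.
    rewrite lef_pV2 ?posrE // lerD2l lerN2 !powRN lef_pV2 ?posrE ?powR_gt0 ?ltr0n //; last by lia.
    by apply: le_powRl; rewrite ?ler0n ?ler_nat ?(ltW s0).
  have x2 : 2 <= (p%:R : R) `^ sigma.
    have : (2%:R : R) `^ (sigma^-1) <= p%:R.
      apply: le_trans (ltW (truncnS_gt _)) _; by rewrite ler_nat.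
    move=> h; have := le_powRl (ltW s0) (powR_ge0 _ _) h.
    by rewrite -powRrM mulVf ?gt_eqF // powRr1.
  rewrite mul1r powRN.
  set x := _ `^ _ in x1 x2 *.
  have y0 : 0 < 1 - x^-1 by rewrite subr_gt0 invf_lt1; lra.
  rewrite invf_ple ?posrE //; last by lra.
  have : x^-1 <= 2^-1 by rewrite lef_pV2 ?posrE; lra.
  by lra.
rewrite big_split /= ler_pM ?prodr_ge0 //.
- by move=> p _; case: ifP => _ //; apply: le_trans B1.
- rewrite -big_mkcond /= big_const_seq iter_mulr_1.
  rewrite ler_weXn2l // -size_filter -[leqRHS](size_iota 0 T) uniq_leq_size //.
    by rewrite filter_uniq // primes_uniq.
  by move=> p; rewrite mem_filter mem_iota /= add0n => /andP[].
- have -> : \prod_(p <- primes q) (p%:R : R) `^ sigma = (\prod_(p <- primes q) p)%:R `^ sigma.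
    elim: (primes q) => [|p s IH]; first by rewrite !big_nil powR1.
    by rewrite !big_cons IH natrM powRM.
  by apply: le_powRl; rewrite ?ler0n ?ler_nat ?(ltW s0) // prod_primes_le.
Qed.

End CountSupported.

(** * Splitting off the largest prime factors *)

Section Strip.
Variable V : nat.

(** Dividing by the smallest prime as long as more than [V] remains leaves a product of the largest
    primes of u; [fuel] makes the recursion structural. *)
Fixpoint strip_rec (fuel u : nat) : nat :=
  if fuel is f.+1 then
    if (V < u %/ pdiv u)%N then strip_rec f (u %/ pdiv u)%N else u
  else u.

Definition strip (u : nat) : nat := strip_rec u u.

(** The possible values of [strip]: they exceed [V], but by at most a factor equal to their smallest
    prime. *)
Definition core (v : nat) : bool := (V < v)%N && (v %/ pdiv v <= V)%N.

Lemma pdiv_mull (v w : nat) : (0 < v)%N -> (1 < w)%N ->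
  (forall p, prime p -> (p %| w)%N -> (p <= pdiv v)%N) -> (1 < v)%N ->
  pdiv (v * w) = pdiv w.
Proof.
move=> v0 w1 H v1; apply/eqP; rewrite eqn_leq; apply/andP; split.
  apply: pdiv_min_dvd; first exact: prime_gt1 (pdiv_prime w1).
  by rewrite dvdn_mull // pdiv_dvd.
have vw1 : (1 < v * w)%N by nia.
have pp := pdiv_prime vw1; have := pdiv_dvd (v * w).
rewrite Euclid_dvdM // => /orP[pv|pw].
  apply: (leq_trans (H _ (pdiv_prime w1) (pdiv_dvd w))).
  by apply: pdiv_min_dvd (prime_gt1 pp) pv.
by apply: pdiv_min_dvd (prime_gt1 pp) pw.
Qed.

Lemma strip_recP (f u : nat) : (0 < V)%N -> (V < u)%N -> (u <= f)%N ->
  [/\ core (strip_rec f u), (strip_rec f u %| u)%N &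
      forall p, prime p -> (p %| u %/ strip_rec f u)%N ->
        (p <= pdiv (strip_rec f u))%N].
Proof.
move=> V0; elim: f u => [|f IH] u Vu uf; first by lia.
have u1 : (1 < u)%N by lia.
have pu := pdiv_dvd u; have pp := pdiv_prime u1; have p1 := prime_gt1 pp.
rewrite /=; case: ifP => [h|/negbT]; last first.
  rewrite -leqNgt => h; split; rewrite ?/core ?Vu ?h //.
  by move=> p pr; rewrite divnn (ltnW u1) dvdn1 => /eqP p1'; rewrite p1' in pr.
have ltu : (u %/ pdiv u < u)%N by rewrite ltn_Pdiv // ltnW.
have uf' : (u %/ pdiv u <= f)%N by rewrite -ltnS (leq_trans ltu).
have [c d H] := IH _ h uf'.
set v := strip_rec f _ in c d H *.
have e : u = ((u %/ pdiv u) * pdiv u)%N by rewrite divnK.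
split=> //; first by rewrite [X in (_ %| X)%N]e dvdn_mulr.
move=> p pr; rewrite {1}e -divn_mulAC //.
rewrite Euclid_dvdM // => /orP[/(H p pr)//|].
rewrite dvdn_prime2 // => /eqP ->.
apply: pdiv_min_dvd; first by apply: prime_gt1; apply: pdiv_prime; case/andP: c; lia.
by apply: dvdn_trans (pdiv_dvd v) _; rewrite e dvdn_mulr.
Qed.

Lemma stripP (u : nat) : (0 < V)%N -> (V < u)%N ->
  [/\ core (strip u), (strip u %| u)%N &
      forall p, prime p -> (p %| u %/ strip u)%N -> (p <= pdiv (strip u))%N].
Proof. by move=> V0 Vu; apply: strip_recP. Qed.

(** The primes of w, none above those of v, are all removed before v is touched, and [core] then
    stops the recursion at v. This gives uniqueness of the factorization. *)
Lemma strip_rec_mul (f v w : nat) : (0 < V)%N -> core v -> (0 < w)%N ->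
  (forall p, prime p -> (p %| w)%N -> (p <= pdiv v)%N) -> (v * w <= f)%N ->
  strip_rec f (v * w) = v.
Proof.
move=> V0 cv; have /andP[Vv vV] := cv; have v0 : (0 < v)%N by lia.
elim: f w => [|f IH] w w0 H vwf.
  by move: vwf; rewrite leqNgt muln_gt0 v0 w0.
have v1 : (1 < v)%N by lia.
case: (ltngtP w 1%N) => [|w1|w1]; [by lia| | ]; last first.
  by rewrite w1 muln1 /= ltnNge vV.
rewrite /= pdiv_mull //.
have wp := pdiv_dvd w.
have p1 := prime_gt1 (pdiv_prime w1).
have w'0 : (0 < w %/ pdiv w)%N by rewrite divn_gt0 ?pdiv_gt0 // dvdn_leq.
have ltw : (w %/ pdiv w < w)%N by rewrite ltn_Pdiv // ltnW.
rewrite -muln_divA // ifT; last by rewrite (leq_trans Vv) // leq_pmulr.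
apply: IH => //; last first.
  by rewrite -ltnS (leq_trans _ vwf) // ltn_pmul2l // ltnW.
by move=> p pr pw; apply: H => //; apply: dvdn_trans pw (dvdn_div _).
Qed.

Lemma strip_mul (v w : nat) : (0 < V)%N -> core v -> (0 < w)%N ->
  (forall p, prime p -> (p %| w)%N -> (p <= pdiv v)%N) -> strip (v * w) = v.
Proof. by move=> V0 cv w0 H; apply: strip_rec_mul. Qed.

End Strip.

(** Common frame of the two factorizations below: h selects a divisor of x, and its fiber over c
    consists of the multiples c z with z in [ts c]. *)
Lemma big_fibers (M : nmodType) (s cs : seq nat) (h : nat -> nat)
    (ts : nat -> seq nat) (phi : nat -> M) :
  uniq s -> uniq cs -> {in s, forall x, h x \in cs} ->
  {in cs, forall c, [/\ uniq (ts c), (0 < c)%N &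
     forall x, (x \in s) && (h x == c) = (c %| x)%N && ((x %/ c)%N \in ts c)]} ->
  \sum_(x <- s) phi x = \sum_(c <- cs) \sum_(z <- ts c) phi (c * z)%N.
Proof.
move=> us ucs hs H.
transitivity (\sum_(x <- s) \sum_(c <- cs | h x == c) phi x).
  rewrite !big_seq; apply: eq_bigr => x xs.
  rewrite big_mkcond (bigD1_seq (h x)) ?hs //= eqxx big1 ?addr0 // => c.
  by rewrite eq_sym => /negbTE ->.
rewrite (exchange_big_dep predT) //= !big_seq; apply: eq_bigr => c ccs.
have [ut c0 Hc] := H c ccs.
rewrite -big_filter -[RHS](big_map (muln c) xpredT phi); apply: perm_big.
apply: uniq_perm; first exact: filter_uniq.
  by rewrite map_inj_uniq // => x y /eqP; rewrite eqn_pmul2l // => /eqP.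
move=> x; rewrite mem_filter andbC Hc; apply/idP/mapP.
  by case/andP=> cx xt; exists (x %/ c)%N; rewrite // mulnC divnK.
by case=> z zt ->; rewrite dvdn_mulr // mulKn.
Qed.

Definition cores (V : nat) (pi : nat_pred) (N : nat) : seq nat :=
  [seq v <- pnats pi N | core V v].

(** Primes allowed in the cofactor of v when b is the smallest prime of v: a [rho]-prime above b
    would have gone into v. *)
Definition below (pi rho : nat_pred) (b : nat) : nat_pred :=
  [pred p | (p \in pi) && ((p \notin rho) || (p <= b)%N)].

(* Each [x] whose [rho]-part exceeds [V] is uniquely [v * z], where [v > V] collects the largest
   [rho]-primes of [x], so that the [rho]-primes of [z] do not exceed [pdiv v]. *)
Lemma big_cores (M : nmodType) (V N : nat) (pi rho : nat_pred) (phi : nat -> M) :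
  (0 < V)%N ->
  \sum_(x <- pnats pi N | (V < (x`_rho)%N)%N) phi x =
  \sum_(v <- cores V [predI pi & rho] N)
    \sum_(z <- pnats (below pi rho (pdiv v)) (N %/ v)) phi (v * z)%N.
Proof.
move=> V0; rewrite -big_filter.
apply: (big_fibers (h := fun x => strip V (x`_rho)%N)).
- by rewrite filter_uniq // pnats_uniq.
- by rewrite filter_uniq // pnats_uniq.
- move=> x; rewrite mem_filter mem_pnats => /and3P[Vx px xN].
  have x0 : (0 < x)%N by case/andP: px.
  have [c d H] := stripP V0 Vx.
  rewrite mem_filter c mem_pnats /=.
  have dx : (strip V (x`_rho)%N %| x)%N by apply: dvdn_trans d (dvdn_part _ _).
  rewrite (leq_trans (dvdn_leq x0 dx)) // andbT.
  rewrite pnatI (pnat_dvd dx) //=.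
  by rewrite (pnat_dvd d) // part_pnat.
move=> v; rewrite mem_filter mem_pnats pnatI => /and3P[cv /andP[pv rv] vN].
have v0 : (0 < v)%N by case/andP: pv.
split=> //; first exact: pnats_uniq.
move=> x; rewrite mem_filter mem_pnats; apply/idP/idP.
  case/andP => /and3P[Vx px xN] /eqP hv.
  have x0 : (0 < x)%N by case/andP: px.
  have [c d H] := stripP V0 Vx; rewrite hv in c d H.
  have dx : (v %| x)%N by apply: dvdn_trans d (dvdn_part _ _).
  rewrite dx mem_pnats leq_div2r // andbT /=.
  have z0 : (0 < x %/ v)%N by rewrite divn_gt0 // dvdn_leq.
  apply/pnatP => // p pp pz; rewrite inE /= .
  have ppi : p \in pi.
    by apply: (pnatP _ x0 px) => //; apply: dvdn_trans pz (dvdn_div _).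
  rewrite ppi /=; case: (boolP (p \in rho)) => //= pr.
  apply: H => //.
  move: pz; rewrite -{1}(partnC rho x0) -divn_mulAC // Euclid_dvdM // => /orP[//|].
  move=> pr'; have := pnatP _ (part_gt0 _ _) (part_pnat rho^' x) p pp pr'.
  by rewrite inE /= pr.
case/andP => vx; rewrite mem_pnats => /andP[pz zN].
set z := (x %/ v)%N in pz zN.
have ex : x = (v * z)%N by rewrite mulnC divnK.
have z0 : (0 < z)%N by case/andP: pz.
have xr : (x`_rho)%N = (v * (z`_rho)%N)%N by rewrite ex partnM // part_pnat_id.
have /andP[Vv _] := cv.
rewrite xr strip_mul ?part_gt0 ?eqxx ?andbT //; last first.
  move=> p pp pz'; have pz2 := dvdn_trans pz' (dvdn_part _ _).
  have := pnatP _ z0 pz p pp pz2; rewrite inE /= => /andP[_].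
  by rewrite (pnatP _ (part_gt0 _ _) (part_pnat rho z) p pp pz').
have zr0 : (0 < (z`_rho)%N)%N by rewrite part_gt0.
rewrite (leq_trans Vv) ?leq_pmulr //= ex pnatM pv /=.
have -> : pi.-nat z.
  by apply: sub_in_pnat pz => p _; rewrite inE => /andP[].
rewrite /= -(leq_pmul2l v0) in zN *.
by apply: leq_trans zN _; rewrite mulnC leq_trunc_div.
Qed.

Lemma big_parts (M : nmodType) (N : nat) (pi rho : nat_pred) (phi : nat -> M) :
  \sum_(x <- pnats pi N) phi x =
  \sum_(d <- pnats [predI pi & rho] N)
    \sum_(y <- pnats [predI pi & rho^'] (N %/ d)) phi (d * y)%N.
Proof.
apply: (big_fibers (h := fun x => (x`_rho)%N)); rewrite ?pnats_uniq //.
  move=> x; rewrite !mem_pnats pnatI part_pnat andbT => /andP[px xN].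
  have x0 : (0 < x)%N by case/andP: px.
  by rewrite (pnat_dvd (dvdn_part _ _)) //= (leq_trans _ xN) // dvdn_leq // dvdn_part.
move=> d; rewrite mem_pnats pnatI => /andP[/andP[pd rd] dN].
have d0 : (0 < d)%N by case/andP: pd.
rewrite pnats_uniq; split=> // x; rewrite !mem_pnats pnatI.
apply/idP/idP.
  case/andP=> /andP[px xN] /eqP xd.
  have x0 : (0 < x)%N by case/andP: px.
  have dx : (d %| x)%N by rewrite -xd dvdn_part.
  rewrite dx (pnat_dvd _ px) ?dvdn_div //= leq_div2r // andbT.
  by rewrite -xd -{1}(partnC rho x0) mulKn ?part_gt0 // part_pnat.
case/and3P => dx /andP[py ry] yN.
have ex : x = (d * (x %/ d))%N by rewrite mulnC divnK.
rewrite {1 3}ex pnatM pd py /= partnM //; last by case/andP: py.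
rewrite part_pnat_id // part_p'nat // muln1 eqxx andbT.
by rewrite ex; apply: leq_trans (leq_trunc_div N d); rewrite mulnC leq_mul2r yN orbT.
Qed.

(** * Density of smooth numbers and counting of rational approximations *)

Section SmoothCount.
Variable R : realType.

Lemma size_dvd_le (n N : nat) : (0 < n)%N ->
  (count (fun b => b %| n)%N (iota 1 N) <= size (pnats \pi(n) n))%N.
Proof.
move=> n0; rewrite -size_filter; apply: uniq_leq_size; first by rewrite filter_uniq ?iota_uniq.
move=> b; rewrite mem_filter mem_iota mem_pnats => /and3P[bn b0 _].
rewrite dvdn_leq // andbT; apply: pnat_dvd bn _.
by rewrite pnat_pi.
Qed.

(** Double counting of the products a b with a from the first set and b <= N: all are N-smooth and
    at most N^(j+1), and each arises at most once per divisor b. *)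
Lemma smooth_mul_le (N j D : nat) :
  (forall n, (0 < n <= N ^ j.+1)%N -> (size (pnats \pi(n) n) <= D)%N) ->
  (size (pnats [pred p | (p <= N)%N] (N ^ j)) * N <=
   size (pnats [pred p | (p <= N)%N] (N ^ j.+1)) * D)%N.
Proof.
move=> HD; set s := pnats _ (N ^ j); set s' := pnats _ (N ^ j.+1).
have us' : uniq s' by exact: pnats_uniq.
have -> : (size s * N = \sum_(a <- s) \sum_(b <- iota 1 N) 1)%N.
  under eq_bigr do rewrite sum1_size size_iota.
  by rewrite big_const_seq count_predT iter_addn_0 mulnC.
have -> : (size s' * D = \sum_(n <- s') D)%N.
  by rewrite big_const_seq count_predT iter_addn_0 mulnC.
have Hab a b : a \in s -> b \in iota 1 N -> (a * b)%N \in s'.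
  rewrite !mem_pnats mem_iota => /andP[pa aN] /andP[b0 bN].
  have abN : (a * b <= N ^ j.+1)%N by rewrite expnSr leq_mul // -ltnS -add1n.
  rewrite pnatM pa abN /= andbT; apply/pnatP => // p pp pb; rewrite inE /=.
  by apply: leq_trans (dvdn_leq b0 pb) _; lia.
apply: (@leq_trans (\sum_(a <- s) \sum_(b <- iota 1 N) \sum_(n <- s' | a * b == n) 1)%N).
  rewrite big_seq [leqRHS]big_seq; apply: leq_sum => a sa.
  rewrite big_seq [leqRHS]big_seq; apply: leq_sum => b sb.
  have h := Hab _ _ sa sb.
  by rewrite big_mkcond (bigD1_seq (a * b)%N) //= eqxx.
apply: (@leq_trans (\sum_(n <- s') \sum_(b <- iota 1 N) \sum_(a <- s | a * b == n) 1)%N).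
  under eq_bigr => a _ do rewrite (exchange_big_dep predT) //=.
  rewrite (exchange_big_dep predT) //=; apply: leq_sum => n _.
  by rewrite (exchange_big_dep predT) //=.
rewrite big_seq [leqRHS]big_seq; apply: leq_sum => n; rewrite mem_pnats => /andP[pn nN].
have n0 : (0 < n)%N by case/andP: pn.
apply: leq_trans (HD n _); last by rewrite n0.
apply: leq_trans (size_dvd_le N n0).
rewrite -sum1_count [leqRHS]big_mkcond /=.
rewrite big_seq [leqRHS]big_seq; apply: leq_sum => b; rewrite mem_iota => /andP[b0 _].
case: ifP => bn.
  rewrite (eq_bigl (fun a => a == n %/ b)%N); last first.
    by move=> a /=; rewrite -eqn_div // eq_sym.
  rewrite sum1_count -[leqRHS]/(nat_of_bool true).
  by rewrite count_uniq_mem ?pnats_uniq //; case: (_ \in _).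
rewrite big1 // => a /eqP e; by rewrite -e dvdn_mull in bn.
Qed.

Lemma smooth_pow_ge (sigma : R) (m : nat) : 0 < sigma ->
  exists C : R, 0 < C /\ forall N j : nat, (0 < N)%N -> (j <= m)%N ->
  (N%:R : R) ^+ j <=
  (size (pnats [pred p | (p <= N)%N] (N ^ j)))%:R * (C * (N%:R ^+ m) `^ (2 * sigma)) ^+ j.
Proof.
move=> s0; have [C [C0 HC]] := size_pnats_supported s0.
exists (C + 1); split; first by rewrite addr_gt0.
move=> N j N0; elim: j => [|j IH] jm.
  rewrite !expr0 mulr1 -[1]/(1%:R) ler_nat.
  rewrite lt0n; apply/negP => /eqP/size0nil h.
  by have : 1%N \in pnats [pred p | (p <= N)%N] (N ^ 0); [rewrite mem_pnats | rewrite h].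
have jm' : (j <= m)%N by lia.
set X : R := (C + 1) * _ in IH *.
have N1 : 1 <= (N%:R : R) by rewrite ler1n.
have X0 : 0 <= X by rewrite mulr_ge0 ?powR_ge0 // addr_ge0 ?ler01 ?ltW.
have HD : forall n, (0 < n <= N ^ j.+1)%N -> (size (pnats \pi(n) n) <= Num.truncn X)%N.
  move=> n /andP[n0 nN]; rewrite truncn_ge_nat //.
  apply: le_trans (HC n n n0) _.
  apply: ler_pM; rewrite ?(ltW C0) ?powR_ge0 ?lerDl //.
  rewrite powRrM; apply: le_powRl; rewrite ?(ltW s0) ?mulr_ge0 //.
  rewrite powR_mulrn ?exprn_ge0 // -expr2; apply: lerXn2r; rewrite ?nnegrE ?exprn_ge0 //.
  apply: (@le_trans _ _ ((N ^ j.+1)%:R)); first by rewrite ler_nat.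
  by rewrite natrX ler_weXn2l.
have h := smooth_mul_le HD; rewrite -(ler_nat R) !natrM in h.
rewrite !exprSr [leRHS]mulrA.
set A := (size (pnats _ (N ^ j)))%:R in IH h *.
set A' := (size (pnats _ (N ^ j.+1)))%:R in h *.
apply: (@le_trans _ _ (A * X ^+ j * N%:R)).
  by rewrite ler_wpM2r ?IH.
rewrite -[leRHS]mulrA [leLHS]mulrAC [X ^+ j * X]mulrC mulrA.
rewrite ler_wpM2r ?exprn_ge0 //; apply: le_trans h _.
by rewrite ler_wpM2l // truncn_le.
Qed.

(** Needed for the lower bound on admissible exponents. With P = N^m and smoothness bound N, smooth
    numbers arise as products of m integers up to N, and the divisor bound limits the repetitions; m
    > 1/eta makes N <= P^eta. *)
Lemma smooth_dense (eta eps P0 : R) : 0 < eta -> 0 < eps ->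
  exists P Rb : R, [/\ P0 <= P, 1 <= P, 1 <= Rb, Rb <= P `^ eta &
    P `^ (1 - eps) <= (size (smooth P Rb))%:R].
Proof.
move=> e0 ep0.
set m := (Num.truncn (eta^-1)).+1.
have m0 : 0 < (m%:R : R) by [].
(* The m divisor bounds together lose (P^(2 sigma))^m = P^(eps/2). *)
set sigma := eps / (4 * m%:R).
have s0 : 0 < sigma by rewrite divr_gt0 // mulr_gt0.
have [C [C0 HC]] := smooth_pow_ge m s0.
(* Any N >= B makes P at least [P0] and makes the constant C^m at most P^(eps/2), the other half of
   the loss. *)
set B := (C ^+ m) `^ (2 / eps) + `|P0| + 1.
set N := (Num.truncn B).+1.
have B0 : 0 <= (C ^+ m) `^ (2 / eps) by rewrite powR_ge0.
have BN : B <= N%:R by apply/ltW/truncnS_gt.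
have B1 : 1 <= B by rewrite /B lerDr addr_ge0 //.
have N1 : 1 <= (N%:R : R) by rewrite ler1n.
have P1 : N%:R <= (N%:R : R) ^+ m by rewrite -[leLHS]expr1 ler_weXn2l.
have P1' : 1 <= (N%:R : R) ^+ m by apply: le_trans P1.
exists (N%:R ^+ m), N%:R; split=> //.
- apply: le_trans P1; apply: le_trans BN; rewrite /B.
  by have := ler_norm P0; lra.
- rewrite -powR_mulrn // -powRrM -[leLHS]powRr1 //; apply: ler_powR => //.
  rewrite -ler_pdivrMr // div1r; exact/ltW/truncnS_gt.
have h := HC N m isT (leqnn m).
have -> : smooth (N%:R ^+ m : R) N%:R = pnats [pred p | (p <= N)%N] (N ^ m).
  rewrite smoothE -natrX natrK; apply: eq_filter => d; apply: eq_pnat => p.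
  by rewrite !inE ler_nat.
set P := N%:R ^+ m in h P1 P1' *.
have P0' : 0 < P by apply: lt_le_trans P1'.
have E : (C * P `^ (2 * sigma)) ^+ m = C ^+ m * P `^ (eps / 2).
  rewrite exprMn; congr (_ * _); rewrite -powR_mulrn ?powR_ge0 // -powRrM.
  by congr (_ `^ _); rewrite /sigma; field; exact: lt0r_neq0.
rewrite E in h.
have CP : C ^+ m <= P `^ (eps / 2).
  have : (C ^+ m) `^ (2 / eps) <= P.
    by apply: le_trans P1; apply: le_trans BN; rewrite /B -addrA lerDl addr_ge0.
  move=> h'; have := le_powRl (ltW (divr_gt0 ep0 (ltr0n R 2))) (powR_ge0 _ _) h'.
  rewrite -powRrM (_ : 2 / eps * (eps / 2) = 1); last by field; exact: lt0r_neq0.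
  by rewrite powRr1 // exprn_ge0 ?ltW.
rewrite -(ler_pM2r (powR_gt0 eps P0')) -powRD ?(gt_eqF P0') ?implybT //.
rewrite subrK (powRr1 (ltW P0')); apply: le_trans h _.
rewrite ler_wpM2l // (_ : eps = eps / 2 + eps / 2); last by field.
rewrite [in leRHS]powRD ?(gt_eqF P0') ?implybT //.
rewrite (_ : (eps / 2 + eps / 2) / 2 = eps / 2); last by field.
by rewrite ler_wpM2r ?powR_ge0.
Qed.

(** As c is invertible modulo q, the equality forces q to divide q1 - q2, and both lie in (0, q]. *)
Lemma det_inj (q q1 q2 : nat) (c c1 c2 : int) : coprimez q c ->
  q%:Z * c1 - q1%:Z * c = q%:Z * c2 - q2%:Z * c ->
  (0 < q1)%N -> (0 < q2)%N -> (q1 <= q)%N -> (q2 <= q)%N ->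
  (q1, c1) = (q2, c2).
Proof.
move=> cz e q1p q2p l1 l2.
have e1 : q%:Z * (c1 - c2) = (q1%:Z - q2%:Z) * c.
  by rewrite mulrBr mulrBl; move: (q%:Z * c1) (q%:Z * c2) (q1%:Z * c) (q2%:Z * c) e; lia.
have dv : (q%:Z %| (q1%:Z - q2%:Z))%Z.
  by rewrite -(Gauss_dvdzl _ cz) -e1 dvdz_mulr.
have e2 : q1 = q2.
  case/dvdzP: dv => a aE.
  have a0 : a = 0 by nia.
  by rewrite a0 mul0r in aE; lia.
rewrite e2 subrr mul0r in e1; move/eqP: e1; rewrite mulf_eq0 subr_eq0.
by case/orP => [/eqP|/eqP ->]; [lia | rewrite e2].
Qed.

(* Two approximations with the same determinant against one of maximal denominator coincide. *)
Lemma size_approx (beta kappa : R) (Q : nat) (S : seq (nat * int)) : uniq S ->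
  0 <= kappa ->
  (forall x, x \in S -> [/\ (0 < x.1)%N, (x.1 <= Q)%N, coprimez x.1 x.2 &
     `|x.1%:R * beta - x.2%:~R| <= kappa]) ->
  (size S)%:R <= 4 * Q%:R * kappa + 1.
Proof.
move=> uS k0 HS; case: S uS HS => [|x0 S] uS HS.
  by rewrite addr_ge0 // !mulr_ge0.
set T := x0 :: S in uS HS *.
have [z zT zmax] : exists2 z, z \in T & forall x, x \in T -> (x.1 <= z.1)%N.
  have : exists n, [exists i : 'I_(size T), (nth x0 T i).1 == n].
    by exists x0.1; apply/existsP; exists ord0.
  have ub n : [exists i : 'I_(size T), (nth x0 T i).1 == n] -> (n <= Q)%N.
    by case/existsP => i /eqP <-; have [] := HS _ (mem_nth x0 (ltn_ord i)).
  move=> ex; case: (ex_maxnP ex ub) => n /existsP[i /eqP ni] nmax.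
  exists (nth x0 T i); first exact: mem_nth.
  move=> x xT; rewrite ni; apply: nmax; apply/existsP.
  by move: (xT); rewrite -index_mem => ix; exists (Ordinal ix); rewrite /= nth_index.
have [z0 zQ cz zk] := HS z zT.
pose D (x : nat * int) : int := z.1%:Z * x.2 - x.1%:Z * z.2.
set M := Num.truncn (2 * Q%:R * kappa).
have DM x : x \in T -> (`|D x| <= M)%N.
  move=> xT; have [q0 qQ cq qk] := HS x xT.
  have Qk0 : 0 <= 2 * Q%:R * kappa by rewrite !mulr_ge0.
  rewrite truncn_ge_nat // natr_absz intr_norm.
  have -> : (D x)%:~R = x.1%:R * (z.1%:R * beta - z.2%:~R) - z.1%:R * (x.1%:R * beta - x.2%:~R) :> R.
    by rewrite /D intrB !intrM !pmulrn; ring.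
  apply: le_trans (ler_normB _ _) _.
  rewrite !normrM !normr_nat.
  have -> : 2 * Q%:R * kappa = Q%:R * kappa + Q%:R * kappa by ring.
  by apply: lerD; apply: ler_pM; rewrite ?ler_nat.
have Dinj : {in T &, injective D}.
  move=> x y xT yT; rewrite /D => e.
  have [qx0 _ _ _] := HS x xT; have [qy0 _ _ _] := HS y yT.
  have lx := zmax _ xT; have ly := zmax _ yT.
  by case: x y {xT yT} e qx0 qy0 lx ly => [qx cx] [qy cy] /=; apply: det_inj.
have : (size T <= (2 * M).+1)%N.
  rewrite -(size_map D) -(size_iota 0 (2 * M).+1) -(size_map (fun i : nat => i%:Z - M%:Z)).
  apply: uniq_leq_size; first by rewrite map_inj_in_uniq.
  move=> _ /mapP[x xT ->]; have := DM _ xT; set d := D x => dM.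
  apply/mapP; exists (absz (d + M%:Z)); last by lia.
  by rewrite mem_iota; lia.
rewrite -(ler_nat R) => /le_trans; apply.
rewrite -natr1 lerD2r natrM.
have : (M%:R : R) <= 2 * Q%:R * kappa by rewrite truncn_le !mulr_ge0.
by lra.
Qed.

End SmoothCount.

(** * Means and spaced points *)

Section RealBounds.
Variable R : realType.

Lemma le_sum_seq (I : eqType) (s : seq I) (P : pred I) (F G : I -> R) :
  {in s, forall i, P i -> F i <= G i} ->
  \sum_(i <- s | P i) F i <= \sum_(i <- s | P i) G i.
Proof.
move=> FG; rewrite big_seq_cond [leRHS]big_seq_cond.
by apply: ler_sum => i /andP[si Pi]; apply: FG.
Qed.

(** Young's inequality with exponents r and r / (r - 1). In this form it says that the graph of a^r
    lies above its tangent at mu. *)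
Lemma powR_tangent (a mu r : R) : 1 <= r -> 0 <= a -> 0 <= mu ->
  mu `^ (r - 1) * a <= a `^ r / r + mu `^ r * (1 - r^-1).
Proof.
move=> r1 a0 m0; have r0 : 0 < r by lra.
have [->|rn1] := eqVneq r 1.
  by rewrite subrr powRr0 invr1 subrr mulr0 addr0 mul1r mulr1 powRr1.
have r1' : 0 < r - 1 by rewrite subr_gt0 lt_neqAle eq_sym rn1.
have q0 : 0 < r / (r - 1) by rewrite divr_gt0.
have := @conjugate_powR R a (mu `^ (r - 1)) r (r / (r - 1)) a0 (powR_ge0 _ _) r0 q0.
have hc : r^-1 + (r / (r - 1))^-1 = 1 by field; rewrite !lt0r_neq0.
move=> /(_ hc); rewrite mulrC -powRrM invf_div.
have -> : (r - 1) * (r / (r - 1)) = r by field; exact: lt0r_neq0.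
have -> : (r - 1) / r = 1 - r^-1 by field; exact: lt0r_neq0.
by apply; ring.
Qed.

Lemma powR_mean (I : Type) (s : seq I) (p a : I -> R) (r : R) : 1 <= r ->
  (forall i, 0 <= p i) -> (forall i, 0 <= a i) ->
  (\sum_(i <- s) p i * a i) `^ r <=
  (\sum_(i <- s) p i) `^ (r - 1) * \sum_(i <- s) p i * a i `^ r.
Proof.
move=> r1 p0 a0; have r0 : 0 < r by lra.
set M := \sum_(i <- s) p i; set A := \sum_(i <- s) p i * a i.
set B := \sum_(i <- s) _ * _ `^ _.
have M0 : 0 <= M by rewrite sumr_ge0.
have A0 : 0 <= A by rewrite sumr_ge0 // => i _; rewrite mulr_ge0.
have B0 : 0 <= B by rewrite sumr_ge0 // => i _; rewrite mulr_ge0 ?powR_ge0.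
move: M0; rewrite le_eqVlt => /orP[/eqP M0|M0].
  suff -> : A = 0 by rewrite powR0 ?gt_eqF // mulr_ge0 ?powR_ge0.
  have : forall s', \sum_(i <- s') p i = 0 -> \sum_(i <- s') p i * a i = 0.
    elim=> [|i s' IH]; first by rewrite !big_nil.
    rewrite !big_cons => /eqP; rewrite paddr_eq0 ?sumr_ge0 // => /andP[/eqP -> /eqP/IH ->].
    by rewrite mul0r addr0.
  by apply.
(* Jensen's inequality: the tangent is taken at the weighted mean. *)
set mu := A / M; have mu0 : 0 <= mu by rewrite divr_ge0 // ltW.
have AE : A = M * mu by rewrite /mu mulrC divfK // gt_eqF.
have : mu `^ (r - 1) * A <= B / r + M * (mu `^ r * (1 - r^-1)).
  rewrite /A /B /M mulr_sumr !mulr_suml -big_split /=; apply: ler_sum => i _.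
  have := ler_wpM2l (p0 i) (powR_tangent r1 (a0 i) mu0).
  by rewrite mulrDr !mulrA [_ * p i]mulrC.
have muE : mu `^ (r - 1) * mu = mu `^ r by rewrite mulrC mulr_powRB1.
rewrite AE mulrCA muE => h.
have h2 : M * mu `^ r <= B.
  rewrite -(ler_pM2r (_ : 0 < r^-1)) ?invr_gt0 //.
  by move: h; rewrite !mulrA mulrBr mulr1; lra.
rewrite (powRM _ (ltW M0) mu0) -(mulr_powRB1 (ltW M0) r0).
by rewrite [M * _]mulrC -mulrA ler_wpM2l ?powR_ge0.
Qed.

Lemma powR_mean1 (I : Type) (s : seq I) (a : I -> R) (r : R) : 1 <= r ->
  (forall i, 0 <= a i) ->
  (\sum_(i <- s) a i) `^ r <= (size s)%:R `^ (r - 1) * \sum_(i <- s) a i `^ r.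
Proof.
move=> r1 a0; have := powR_mean s r1 (fun=> ler01) a0.
under eq_bigr do rewrite mul1r.
under [X in _ * X]eq_bigr do rewrite mul1r.
by rewrite big_const_seq count_predT iter_addr addr0.
Qed.

Lemma powRD_le (a b r : R) : 0 <= r -> 0 <= a -> 0 <= b ->
  (a + b) `^ r <= 2 `^ r * (a `^ r + b `^ r).
Proof.
move=> r0 a0 b0.
wlog ab : a b a0 b0 / a <= b => [H|].
  have [ab|/ltW ba] := leP a b; first exact: H.
  by rewrite addrC [a `^ r + _]addrC; exact: H.
apply: (@le_trans _ _ ((2 * b) `^ r)).
  by apply: le_powRl; lra.
by rewrite powRM // ler_wpM2l ?powR_ge0 // lerDr powR_ge0.
Qed.

Lemma inv_le_ln (n : nat) : (0 < n)%N ->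
  (n.+1%:R : R)^-1 <= ln (n.+1%:R) - ln (n%:R).
Proof.
move=> n0; have n0' : 0 < (n%:R : R) by rewrite ltr0n.
have n1' : 0 < (n.+1%:R : R) by [].
rewrite -ln_div ?posrE // -[leLHS]opprK -[leRHS]opprK lerN2 -lnV ?posrE ?divr_gt0 //.
rewrite invf_div (_ : n%:R / n.+1%:R = 1 + - (n.+1%:R)^-1); last first.
  by rewrite -[X in X / _](addrK 1) natr1 mulrBl mulfV ?mul1r // lt0r_neq0.
apply: le_ln1Dx; rewrite ltrN2 invf_lt1 // ltr1n //.
Qed.

Lemma harmonic_le (n : nat) : (0 < n)%N ->
  \sum_(j <- iota 1 n) (j%:R : R)^-1 <= 1 + ln (n%:R).
Proof.
case: n => // n _; elim: n => [|n IH]; first by rewrite big_seq1 ln1 addr0 invr1.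
rewrite -[n.+2]addn1 iotaD big_cat big_seq1 add1n addn1.
apply: le_trans (lerD IH (inv_le_ln (ltn0Sn n))) _; lra.
Qed.

(** This is min(H, 1/y); the case y = 0 is set apart because 0^-1 = 0 would make the minimum vanish
    there. *)
Definition cap (H y : R) : R := if y == 0 then H else Num.min H y^-1.

Lemma cap_ge0 (H y : R) : 0 <= H -> 0 <= y -> 0 <= cap H y.
Proof. by move=> H0 y0; rewrite /cap; case: ifP => // _; rewrite le_min H0 invr_ge0. Qed.

(* Points of spacing [lambda] lie in distinct cells [j lambda, (j + 1) lambda). *)
Lemma sum_spaced_half (I : eqType) (s : seq I) (y : I -> R) (H lambda : R) (J : nat) :
  uniq s -> 0 <= H -> 0 < lambda -> 1 <= J%:R * lambda ->
  {in s, forall i, 0 <= y i < 1} ->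
  {in s &, forall i j, i != j -> lambda <= `|y i - y j|} ->
  \sum_(i <- s) cap H (y i) <= H + lambda^-1 * (1 + ln (J%:R)).
Proof.
move=> us H0 l0 Jl ys sp.
have J0 : (0 < J)%N by case: J Jl => //; rewrite mul0r ler10.
pose c i := Num.truncn (y i / lambda).
have cP i : i \in s -> (c i)%:R * lambda <= y i < (c i).+1%:R * lambda.
  move=> si; have /andP[y0 y1] := ys i si.
  have /truncn_itv : 0 <= y i / lambda by rewrite divr_ge0 // ltW.
  by rewrite ler_pdivlMr // ltr_pdivrMr.
have cJ i : i \in s -> (c i < J)%N.
  move=> si; have /andP[y0 y1] := ys i si; have /andP[h _] := cP i si.
  rewrite -(ltr_nat R) -(ltr_pM2r l0); apply: le_lt_trans h _.
  exact: lt_le_trans y1 Jl.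
have cinj : {in s &, injective c}.
  move=> i j si sj e; apply/eqP/negPn/negP => /(sp i j si sj).
  have := cP i si; have := cP j sj; rewrite e -natr1.
  by rewrite ler_normr; lra.
pose F (j : nat) : R := if j == 0%N then H else (j%:R * lambda)^-1.
have F0 j : 0 <= F j.
  by rewrite /F; case: ifP => // _; rewrite invr_ge0 mulr_ge0 // ltW.
apply: (@le_trans _ _ (\sum_(j <- map c s) F j)).
  rewrite big_map; apply: le_sum_seq => i si _.
  have /andP[h _] := cP i si.
  rewrite /cap /F; case: (eqVneq (y i) 0) => [yi0|_].
    by rewrite /c yi0 mul0r truncn0.
  case: ifP => [_|/negbT c0]; first by rewrite ge_min lexx.
  have cl0 : 0 < (c i)%:R * lambda by rewrite mulr_gt0 // ltr0n lt0n.
  by rewrite ge_min lef_pV2 ?posrE ?h ?orbT // (lt_le_trans cl0).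
apply: (@le_trans _ _ (\sum_(j <- iota 0 J) F j)).
  have ps : perm_eq (iota 0 J) (map c s ++ [seq j <- iota 0 J | j \notin map c s]).
    apply: uniq_perm; first exact: iota_uniq.
      rewrite cat_uniq map_inj_in_uniq // us filter_uniq ?iota_uniq //= andbT.
      by apply/hasPn => j; rewrite mem_filter => /andP[].
    move=> j; rewrite mem_cat mem_filter mem_iota /= add0n.
    case: (boolP (j \in map c s)) => //= /mapP[i si ->]; exact: cJ.
  by rewrite (perm_big _ ps) big_cat /= lerDl sumr_ge0.
case: J J0 {Jl cJ} => // J _.
rewrite /= big_cons {1}/F /= lerD2l.
case: J => [|J]; first by rewrite big_nil ln1 addr0 mulr1 invr_ge0 ltW.
apply: (@le_trans _ _ (lambda^-1 * \sum_(j <- iota 1 J.+1) (j%:R)^-1)).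
  rewrite mulr_sumr; apply: le_sum_seq => j.
  rewrite mem_iota /F => /andP[j0 _] _; rewrite gtn_eqF //.
  by rewrite invfM mulrC.
rewrite ler_wpM2l ?invr_ge0 ?(ltW l0) //.
apply: le_trans (harmonic_le (ltn0Sn J)) _; rewrite lerD2l.
by rewrite ler_ln ?posrE // ler_nat.
Qed.

Definition frac (x : R) : R := x - (Num.floor x)%:~R.

Lemma frac_itv x : 0 <= frac x < 1.
Proof.
rewrite /frac; have /andP[h1 h2] := floor_itv x.
by rewrite intrD in h2; lra.
Qed.

(* Dominates a geometric sum of length [H] and ratio [e(x)] (up to a constant, [min(H, 1/||x||)]). *)
Definition gap (H x : R) : R := cap H (frac x) + cap H (frac (- x)).

Lemma sum_gap (I : eqType) (s : seq I) (x : I -> R) (H lambda : R) (J : nat) :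
  uniq s -> 0 <= H -> 0 < lambda -> 1 <= J%:R * lambda ->
  {in s &, forall i j, i != j -> forall c : int, lambda <= `|x i - x j - c%:~R|} ->
  \sum_(i <- s) gap H (x i) <= 2 * (H + lambda^-1 * (1 + ln (J%:R))).
Proof.
move=> us H0 l0 Jl sp; rewrite big_split /=.
have hm : forall y : I -> R,
  {in s &, forall i j, i != j -> forall c : int, lambda <= `|y i - y j - c%:~R|} ->
  \sum_(i <- s) cap H (frac (y i)) <= H + lambda^-1 * (1 + ln (J%:R)).
  move=> y hy; apply: sum_spaced_half => //.
    by move=> i _; exact: frac_itv.
  move=> i j si sj ij; have := hy i j si sj ij (Num.floor (y i) - Num.floor (y j)).
  rewrite intrB /frac; congr (_ <= `|_|); ring.
have h1 := hm _ sp.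
have h2 : {in s &, forall i j, i != j -> forall c : int, lambda <= `|- x i - - x j - c%:~R|}.
  move=> i j si sj ij c; have := sp i j si sj ij (- c).
  rewrite -normrN; congr (_ <= `|_|); rewrite intrN; ring.
by have := hm _ h2; lra.
Qed.

End RealBounds.

(** * Exponential sums and bilinear forms *)

Section Exponentials.
Variable R : realType.
Local Open Scope complex_scope.
Local Notation C := R[i].

(** The norm of [R[i]] takes complex values; its real part can be compared and raised to real powers
    in [R]. *)
Definition cabs (z : C) : R := complex.Re `|z|.

Lemma cabsE z : (cabs z)%:C = `|z|.
Proof. by rewrite /cabs normc_def. Qed.

Lemma cabs_def z : cabs z = Num.sqrt (complex.Re z ^+ 2 + complex.Im z ^+ 2).
Proof. by rewrite /cabs normc_def. Qed.

Lemma cabs_ge0 z : 0 <= cabs z.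
Proof. by rewrite cabs_def sqrtr_ge0. Qed.

Lemma cabsM z w : cabs (z * w) = cabs z * cabs w.
Proof. by apply: complexI; rewrite rmorphM /= !cabsE normrM. Qed.

Lemma cabsD z w : cabs (z + w) <= cabs z + cabs w.
Proof. by rewrite -lecR rmorphD /= !cabsE ler_normD. Qed.

Lemma cabsB z w : cabs (z - w) <= cabs z + cabs w.
Proof. by rewrite -lecR rmorphD /= !cabsE ler_normB. Qed.

Lemma cabs0 : cabs 0 = 0.
Proof. by apply: complexI; rewrite cabsE normr0. Qed.

Lemma cabs1 : cabs 1 = 1.
Proof. by apply: complexI; rewrite cabsE normr1. Qed.

Lemma cabsX z n : cabs (z ^+ n) = cabs z ^+ n.
Proof. by apply: complexI; rewrite rmorphXn /= !cabsE normrX. Qed.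

Lemma cabs_sum (I : Type) (s : seq I) (P : pred I) (F : I -> C) :
  cabs (\sum_(i <- s | P i) F i) <= \sum_(i <- s | P i) cabs (F i).
Proof.
elim/big_rec2: _ => [|i y z _ h]; first by rewrite cabs0.
by apply: le_trans (cabsD _ _) _; rewrite lerD2l.
Qed.

Lemma cabs_real (x : R) : cabs x%:C = `|x|.
Proof. by rewrite cabs_def /= expr0n addr0 sqrtr_sqr. Qed.

Lemma cabs_conj z : cabs (conjc z) = cabs z.
Proof. by case: z => a b; rewrite !cabs_def /= sqrrN. Qed.

Lemma cabs_sqr z : (cabs z ^+ 2)%:C = z * conjc z.
Proof. by rewrite rmorphXn /= cabsE sqr_normc. Qed.

Definition expi (x : R) : C := cos (2 * pi * x) +i* sin (2 * pi * x).

Lemma expiD x y : expi (x + y) = expi x * expi y.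
Proof.
by rewrite /expi mulrDr cosD sinD; apply/eqP; rewrite eq_complex /= eqxx addrC eqxx.
Qed.

Lemma expi0 : expi 0 = 1.
Proof. by rewrite /expi mulr0 cos0 sin0. Qed.

Lemma cabs_expi x : cabs (expi x) = 1.
Proof. by rewrite cabs_def /= cos2Dsin2 sqrtr1. Qed.

Lemma expi1 : expi 1 = 1.
Proof. by rewrite /expi mulr1 mulr2n mulrDl !mul1r -mulr2n cos2pi sin2pi. Qed.

Lemma expiM x n : expi (x * n%:R) = expi x ^+ n.
Proof.
elim: n => [|n IH]; first by rewrite mulr0 expi0 expr0.
by rewrite -natr1 mulrDr mulr1 expiD IH exprSr.
Qed.

Lemma expiN x : expi (- x) = conjc (expi x).
Proof. by rewrite /expi mulrN cosN sinN. Qed.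

Lemma expi_nat n : expi n%:R = 1.
Proof. by rewrite -[n%:R]mul1r expiM expi1 expr1n. Qed.

Lemma expi_int (n : int) : expi n%:~R = 1.
Proof.
case: n => n; first by rewrite -pmulrn expi_nat.
by rewrite NegzE mulrNz expiN -pmulrn expi_nat conjc1.
Qed.

Lemma expi_frac x : expi (frac x) = expi x.
Proof. by rewrite /frac -{1}mulrNz expiD expi_int mulr1. Qed.

(** The slope 1/pi, weaker than the sharp 2/pi, suffices. Up to pi/4 the mean value theorem gives
    slope at least cos(pi/4); beyond, x/pi <= 1/2 <= sin(pi/4) and monotonicity is enough. *)
Lemma sin_ge_linear (x : R) : 0 <= x <= pi / 2 -> x / pi <= sin x.
Proof.
move=> /andP[x0 x1].
have pi0 := pi_gt0 R; have pi2 := pi_ge2 R.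
have c4 : cos (pi / 4) = sin (pi / 4) :> R.
  by rewrite -cosBpihalf -cosN; congr (cos _); field.
have s4 : 2^-1 <= sin (pi / 4) :> R.
  have h : 0 <= sin (pi / 4 : R) by apply: sin_ge0_pi; apply/andP; split; lra.
  have := cos2Dsin2 (pi / 4 : R); rewrite c4; nra.
have [xl|xl] := leP x (pi / 4).
  have [->|xn] := eqVneq x 0; first by rewrite mul0r sin0.
  have x0' : 0 < x by rewrite lt_neqAle eq_sym xn.
  have [c cx] : exists2 c, c \in `]0, x[ & sin x - sin 0 = cos c * (x - 0).
    apply: (@MVT _ sin cos 0 x x0').
    by apply: continuous_subspaceT; exact: continuous_sin.
  rewrite sin0 !subr0 => ->; rewrite mulrC ler_wpM2r //.
  have /andP[c0 cx'] : 0 < c < x by move: cx; rewrite in_itv.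
  apply: (@le_trans _ _ (cos (pi / 4))).
    rewrite c4; apply: le_trans s4; rewrite lef_pV2 ?posrE //; lra.
  rewrite le_eqVlt; apply/orP; right; rewrite ltr_cos ?in_itv /=; lra.
apply: (@le_trans _ _ 2^-1); first by rewrite ler_pdivrMr; lra.
apply: le_trans s4 _.
by apply/ltW; rewrite ltr_sin ?in_itv /=; [|apply/andP; split|apply/andP; split]; lra.
Qed.

Lemma cabs_expiB1 (y : R) : 0 <= y <= 2^-1 -> 2 * y <= cabs (expi y - 1).
Proof.
move=> /andP[y0 y1]; have pi0 := pi_gt0 R.
have h : y <= sin (pi * y).
  have := @sin_ge_linear (pi * y); rewrite mulrAC divff ?mul1r ?gt_eqF //; apply.
  by apply/andP; split; nra.
have E : cabs (expi y - 1) ^+ 2 = (2 * sin (pi * y)) ^+ 2.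
  rewrite cabs_def sqr_sqrtr ?addr_ge0 ?sqr_ge0 //= subr0.
  rewrite (_ : 2 * pi * y = (pi * y) *+ 2); last by rewrite mulr2n; ring.
  rewrite cos_mulr2n sin_mulr2n.
  have := cos2Dsin2 (pi * y); set c := cos _; set s := sin _ => cs.
  have c2 : c ^+ 2 = 1 - s ^+ 2 by rewrite -cs addrK.
  rewrite c2 !mulr2n; transitivity (4 * (s ^+ 2) ^+ 2 + 4 * (c ^+ 2) * s ^+ 2); first by ring.
  by rewrite c2; ring.
rewrite -(@ler_pXn2r _ 2) ?nnegrE ?cabs_ge0 ?mulr_ge0 // E.
by apply: lerXn2r; rewrite ?nnegrE ?mulr_ge0 // ?ler_wpM2l //; lra.
Qed.

(** The sum is at most 2 / |e(x) - 1|, and |e(y) - 1| >= 2 y for y the distance from x to the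
    nearest integer, which is [frac x] or [frac (- x)] according to the side. *)
Lemma geom_le (x : R) (H : nat) :
  cabs (\sum_(h < H) expi x ^+ h) <= gap H%:R x.
Proof.
set S := \sum_(h < H) _.
have SH : cabs S <= H%:R.
  apply: le_trans (cabs_sum _ _ _) _.
  under eq_bigr do rewrite cabsX cabs_expi expr1n.
  by rewrite sumr_const card_ord.
have key (y : R) : expi y = expi x \/ expi y = conjc (expi x) -> 0 < y <= 2^-1 -> cabs S <= y^-1.
  move=> ey /andP[y0 y1]; have := cabs_expiB1 (_ : 0 <= y <= 2^-1).
  rewrite y1 (ltW y0) => /(_ isT) h.
  have h' : 2 * y <= cabs (expi x - 1).
    case: ey h => -> //; rewrite !cabs_def.
    by case: (expi x) => a b /=; rewrite !subr0 sqrrN.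
  have := subrX1 (expi x) H => /(congr1 cabs); rewrite cabsM -/S => E.
  have : cabs (expi x - 1) * cabs S <= 2.
    by rewrite -E; apply: le_trans (cabsB _ _) _; rewrite cabsX cabs_expi cabs1 expr1n.
  have S0 := cabs_ge0 S => h2.
  rewrite -[leRHS]mul1r ler_pdivlMr //; nra.
have /andP[f0 f1] := frac_itv x; have /andP[g0 g1] := frac_itv (- x).
have c1 := cap_ge0 (ler0n R H) f0; have c2 := cap_ge0 (ler0n R H) g0.
have [fx0|fx0] := eqVneq (frac x) 0.
  by rewrite /gap {1}/cap fx0 eqxx (le_trans SH) // lerDl.
have fx : 0 < frac x by rewrite lt_neqAle eq_sym fx0.
have [fl|fl] := leP (frac x) 2^-1.
  rewrite /gap (le_trans (_ : _ <= cap H%:R (frac x))) ?lerDl //.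
  rewrite /cap (negbTE fx0) le_min SH /=; apply: key; rewrite ?fx //.
  by left; rewrite expi_frac.
have gx : frac (- x) = 1 - frac x.
  have : Num.floor (- x) = - Num.floor x - 1.
    apply: floor_def; rewrite !intrD !mulrNz; move: fx f1; rewrite /frac.
    by move=> ? ?; apply/andP; split; lra.
  by rewrite /frac => ->; rewrite intrB mulrNz; ring.
have gx0 : frac (- x) != 0 by rewrite gx; lra.
rewrite /gap (le_trans (_ : _ <= cap H%:R (frac (- x)))) ?lerDr //.
rewrite /cap (negbTE gx0) le_min SH /=; apply: key.
  by right; rewrite expi_frac expiN.
by rewrite gx; apply/andP; split; lra.
Qed.

Lemma absfE k (P Rb alpha : R) :
  absf k P Rb alpha = cabs (\sum_(x <- smooth P Rb) expi (alpha * x%:R ^+ k)).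
Proof.
rewrite /absf cabs_def; congr (Num.sqrt (_ ^+ 2 + _ ^+ 2)).
  rewrite /fRe; elim: (smooth P Rb) => [|x s IH]; first by rewrite !big_nil.
  by rewrite !big_cons IH; case: (\sum_(_ <- _) _) => a b /=; rewrite mulrA.
rewrite /fIm; elim: (smooth P Rb) => [|x s IH]; first by rewrite !big_nil.
by rewrite !big_cons IH; case: (\sum_(_ <- _) _) => a b /=; rewrite mulrA.
Qed.

End Exponentials.

Section Bilinear.
Variable R : realType.
Local Open Scope complex_scope.
Local Notation C := R[i].
Implicit Types (p q : {poly R}) (g h : {poly C}) (s t : seq nat).

Lemma expr_mean (I : Type) (s : seq I) (p a : I -> R) (w : nat) : (0 < w)%N ->
  (forall i, 0 <= p i) -> (forall i, 0 <= a i) ->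
  (\sum_(i <- s) p i * a i) ^+ w <=
  (\sum_(i <- s) p i) ^+ w.-1 * \sum_(i <- s) p i * a i ^+ w.
Proof.
move=> w0 p0 a0; have w1 : 1 <= (w%:R : R) by rewrite ler1n.
have := powR_mean s w1 p0 a0.
have -> : (w%:R : R) - 1 = w.-1%:R by rewrite -[w in LHS]prednK // -natr1 addrK.
rewrite !powR_mulrn ?sumr_ge0 //; last by move=> i _; rewrite mulr_ge0.
by under [X in _ <= _ * X]eq_bigr => i _ do rewrite powR_mulrn //.
Qed.

Lemma cauchy_schwarz (I : Type) (s : seq I) (a b : I -> R) :
  (\sum_(i <- s) a i * b i) ^+ 2 <=
  (\sum_(i <- s) a i ^+ 2) * (\sum_(i <- s) b i ^+ 2).
Proof.
have : 0 <= \sum_(i <- s) \sum_(j <- s) (a i * b j - a j * b i) ^+ 2.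
  by apply: sumr_ge0 => i _; apply: sumr_ge0 => j _; apply: sqr_ge0.
have -> : \sum_(i <- s) \sum_(j <- s) (a i * b j - a j * b i) ^+ 2 =
  2 * ((\sum_(i <- s) a i ^+ 2) * (\sum_(i <- s) b i ^+ 2)
     - (\sum_(i <- s) a i * b i) ^+ 2); last by rewrite pmulr_rge0 // subr_ge0.
transitivity (\sum_(i <- s) (a i ^+ 2 * (\sum_(j <- s) b j ^+ 2)
   + b i ^+ 2 * (\sum_(j <- s) a j ^+ 2) - 2 * (a i * b i) * \sum_(j <- s) a j * b j)).
  apply: eq_bigr => i _; rewrite !mulr_sumr -big_split -sumrB /=.
  by apply: eq_bigr => j _; ring.
by rewrite sumrB big_split /= -!mulr_suml -mulr_sumr; ring.
Qed.

(** Coefficientwise majorant: weights of modulus at most 1 disappear when a weighted sum is raised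
    to the w-th power. *)
Definition dominated g p := forall m, cabs g`_m <= p`_m.

Lemma dominated_ge0 g p : dominated g p -> forall m, 0 <= p`_m.
Proof. by move=> gp m; apply: le_trans (gp m); apply: cabs_ge0. Qed.

Lemma dominatedM g h p q : dominated g p -> dominated h q ->
  dominated (g * h) (p * q).
Proof.
move=> gp hq m; rewrite !coefM; apply: le_trans (cabs_sum _ _ _) _.
by apply: ler_sum => i _; rewrite cabsM ler_pM ?cabs_ge0.
Qed.

Lemma dominatedX g p w : dominated g p -> dominated (g ^+ w) (p ^+ w).
Proof.
move=> gp; elim: w => [|w IH]; last by rewrite !exprS; exact: dominatedM.
by move=> m; rewrite !expr0 !coef1; case: eqP => _; rewrite ?cabs1 ?cabs0.
Qed.

Variable k : nat.

(** Generating polynomial of k-th powers: the m-th coefficient of its w-th power counts the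
    representations of m as a sum of w k-th powers of entries of s. *)
Definition powpoly s : {poly R} := \sum_(x <- s) 'X^(x ^ k).

Definition wpoly (c : nat -> C) s : {poly C} := \sum_(x <- s) c x *: 'X^(x ^ k).

Lemma wpoly_dominated (c : nat -> C) s : (forall x, cabs (c x) <= 1) ->
  dominated (wpoly c s) (powpoly s).
Proof.
move=> c1 m; rewrite !coef_sum; apply: le_trans (cabs_sum _ _ _) _.
apply: ler_sum => x _; rewrite coefZ !coefXn cabsM.
by case: eqP => _; rewrite ?cabs1 ?cabs0 ?mulr1 ?mulr0.
Qed.

Lemma powpoly_ge0 s w m : 0 <= (powpoly s ^+ w)`_m.
Proof.
have h : dominated (wpoly (fun=> 1) s) (powpoly s).
  by apply: wpoly_dominated => x; rewrite cabs1.
exact: dominated_ge0 (dominatedX w h) m.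
Qed.

Lemma size_powpoly s A w : {in s, forall x, (x <= A)%N} ->
  (size (powpoly s ^+ w) <= (w * A ^ k).+1)%N.
Proof.
move=> sA.
suff h : (size (powpoly s) <= (A ^ k).+1)%N.
  apply: leq_trans (size_poly_exp_leq _ _) _; rewrite ltnS mulnC leq_mul2l.
  by case: (size _) h => [|n] h; rewrite ?leq0n ?orbT // -ltnS h orbT.
rewrite /powpoly; elim: s sA => [|x s IH] sA; first by rewrite big_nil size_poly0.
rewrite big_cons; apply: leq_trans (size_polyD _ _) _.
rewrite geq_max size_polyXn ltnS IH ?andbT; last first.
  by move=> y ys; apply: sA; rewrite inE ys orbT.
by case: k => // k'; rewrite leq_exp2r // sA // inE eqxx.
Qed.

Lemma size_wpoly c s A w : (forall x, cabs (c x) <= 1) ->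
  {in s, forall x, (x <= A)%N} -> (size (wpoly c s ^+ w) <= (w * A ^ k).+1)%N.
Proof.
move=> c1 sA; apply/leq_sizeP => m hm.
have := dominatedX w (wpoly_dominated s c1) m.
have -> : (powpoly s ^+ w)`_m = 0.
  by apply/leq_sizeP : m hm; apply: size_powpoly.
move=> h; apply/eqP; rewrite -normr_eq0 -cabsE.
by have -> : cabs (wpoly c s ^+ w)`_m = 0 by apply/eqP; rewrite eq_le h cabs_ge0.
Qed.

(** Number of solutions of x1^k + ... + xw^k = y1^k + ... + yw^k in entries of s, that is, the 2w-th
    moment of the exponential sum (see [parseval]). *)
Definition energy w s : R :=
  \sum_(m < size (powpoly s ^+ w)) (powpoly s ^+ w)`_m ^+ 2.

Lemma energy_wide w s n : (size (powpoly s ^+ w) <= n)%N ->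
  energy w s = \sum_(m < n) (powpoly s ^+ w)`_m ^+ 2.
Proof.
move=> h; rewrite /energy -!(big_mkord xpredT (fun m => (powpoly s ^+ w)`_m ^+ 2)).
rewrite [RHS](big_cat_nat _ h) //= [X in _ = _ + X]big_nat_cond [X in _ = _ + X]big1 ?addr0 // => m.
by case/andP => /andP[hm _] _; rewrite nth_default ?expr0n.
Qed.

Lemma sum_powpoly w s n : (size (powpoly s ^+ w) <= n)%N ->
  \sum_(m < n) (powpoly s ^+ w)`_m = (size s)%:R ^+ w.
Proof.
move=> h; have := horner_coef_wide 1 h; under eq_bigr do rewrite expr1n mulr1.
move=> <-; rewrite horner_exp horner_sum; congr (_ ^+ _).
under eq_bigr do rewrite hornerXn expr1n.
by rewrite big_const_seq count_predT iter_addr addr0.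
Qed.

Definition phase (z : C) : C := if z == 0 then 0 else (cabs z)%:C / z.

Lemma phaseE z : phase z * z = (cabs z)%:C.
Proof.
rewrite /phase; case: eqP => [->|/eqP z0]; first by rewrite mul0r cabs0.
by rewrite divfK.
Qed.

Lemma cabs_phase z : cabs (phase z) <= 1.
Proof.
rewrite /phase; case: eqP => [_|/eqP z0]; first by rewrite cabs0.
have c0 : cabs z != 0 by apply: contra z0 => /eqP h; rewrite -normr_eq0 -cabsE h.
by rewrite cabsM cabs_real ger0_norm ?cabs_ge0 // -cabsM divff // cabs1.
Qed.

Lemma gapN (H x : R) : gap H (- x) = gap H x.
Proof. by rewrite /gap opprK addrC. Qed.

Lemma gap_ge0 (H x : R) : 0 <= H -> 0 <= gap H x.
Proof.
by move=> H0; have /andP[a _] := frac_itv x; have /andP[b _] := frac_itv (- x);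
  rewrite addr_ge0 ?cap_ge0.
Qed.

Lemma conjcM (z v : C) : conjc (z * v) = conjc z * conjc v.
Proof. by case: z v => a b [c d]; apply/eqP; rewrite eq_complex /=; apply/andP; split; apply/eqP; ring. Qed.

Lemma conjc_sum (I : Type) (r : seq I) (F : I -> C) :
  conjc (\sum_(i <- r) F i) = \sum_(i <- r) conjc (F i).
Proof. exact: (rmorph_sum (@conjc R)). Qed.

(** Large sieve by duality: once the square is opened the sum over m is geometric, and 2 r_n r_n' <=
    r_n^2 + r_n'^2 with the symmetry of [gap] reduces everything to the row sums bounded by K. *)
Lemma dual_sieve (g : nat -> C) (r : nat -> R) (beta K : R) (H1 H2 : nat) :
  (forall n, cabs (g n) <= r n) ->
  (forall n : 'I_H1, \sum_(n' < H1) gap H2%:R (beta * (n%:R - n'%:R)) <= K) ->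
  \sum_(m < H2) cabs (\sum_(n < H1) g n * expi (beta * m%:R * n%:R)) ^+ 2 <=
  K * \sum_(n < H1) r n ^+ 2.
Proof.
move=> gr HK.
have r0 n : 0 <= r n by apply: le_trans (gr n); apply: cabs_ge0.
set L := \sum_(m < H2) _.
have L0 : 0 <= L by apply: sumr_ge0 => m _; apply: sqr_ge0.
have E : L%:C = \sum_(n < H1) \sum_(n' < H1) g n * conjc (g n') *
    \sum_(m < H2) expi (beta * (n%:R - n'%:R)) ^+ m.
  rewrite rmorph_sum /=.
  under eq_bigr => m _ do rewrite cabs_sqr conjc_sum big_distrlr /=.
  rewrite exchange_big; apply: eq_bigr => n _ /=.
  rewrite exchange_big; apply: eq_bigr => n' _ /=.
  rewrite mulr_sumr; apply: eq_bigr => m _.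
  rewrite conjcM -expiN -expiM mulrACA -expiD; congr (_ * expi _); ring.
rewrite -[leLHS]ger0_norm // -cabs_real E.
apply: le_trans (cabs_sum _ _ _) _.
apply: (@le_trans _ _ (\sum_(n < H1) \sum_(n' < H1)
   2^-1 * (r n ^+ 2 + r n' ^+ 2) * gap H2%:R (beta * (n%:R - n'%:R)))).
  apply: ler_sum => n _; apply: le_trans (cabs_sum _ _ _) _.
  apply: ler_sum => n' _; rewrite !cabsM cabs_conj ler_pM ?mulr_ge0 ?cabs_ge0 ?geom_le //.
  apply: (@le_trans _ _ (r n * r n')); first by rewrite ler_pM ?cabs_ge0.
  by have := sqr_ge0 (r n - r n'); nra.
have -> : \sum_(n < H1) \sum_(n' < H1)
   2^-1 * (r n ^+ 2 + r n' ^+ 2) * gap H2%:R (beta * (n%:R - n'%:R)) =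
   \sum_(n < H1) r n ^+ 2 * \sum_(n' < H1) gap H2%:R (beta * (n%:R - n'%:R)).
  pose F (n n' : nat) := 2^-1 * r n ^+ 2 * gap H2%:R (beta * (n%:R - n'%:R)).
  transitivity (\sum_(n < H1) \sum_(n' < H1) F n n' + \sum_(n < H1) \sum_(n' < H1) F n' n).
    rewrite -big_split; apply: eq_bigr => n _; rewrite -big_split; apply: eq_bigr => n' _ /=.
    by rewrite /F -(opprB n'%:R) mulrN gapN; ring.
  rewrite [X in _ + X]exchange_big -big_split; apply: eq_bigr => n _ /=.
  rewrite -big_split mulr_sumr; apply: eq_bigr => n' _ /=.
  by rewrite /F; field.
rewrite mulr_sumr; apply: ler_sum => n _; rewrite mulrC.
by rewrite ler_wpM2r ?sqr_ge0.
Qed.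

Lemma horner_wpoly c s (x : R) (n : nat) :
  (wpoly c s).[expi (x * n%:R)] = \sum_(y <- s) c y * expi (x * n%:R * (y ^ k)%:R).
Proof.
rewrite horner_sum; apply: eq_bigr => y _.
by rewrite hornerZ hornerXn -expiM.
Qed.

Lemma horner_wpolyX c s w A (x : R) (n : nat) : (forall y, cabs (c y) <= 1) ->
  {in s, forall y, (y <= A)%N} ->
  (wpoly c s ^+ w).[expi (x * n%:R)] =
  \sum_(m < (w * A ^ k).+1) (wpoly c s ^+ w)`_m * expi (x * n%:R * m%:R).
Proof.
move=> c1 sA; rewrite (horner_coef_wide _ (size_wpoly w c1 sA)).
by apply: eq_bigr => m _; rewrite -expiM.
Qed.

(** Two applications of Hölder's inequality replace first y and then x by sums of w k-th powers.
    These new variables range over intervals of integers, where the large sieve applies, and their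
    multiplicities are paid for by the two energies. *)
Lemma bilinear_bound (w A B : nat) s t (c d : nat -> C) (beta K : R) : (0 < w)%N ->
  (forall x, cabs (c x) <= 1) -> (forall y, cabs (d y) <= 1) ->
  {in s, forall x, (x <= A)%N} -> {in t, forall y, (y <= B)%N} ->
  (forall n : 'I_(w * A ^ k).+1, \sum_(n' < (w * A ^ k).+1)
     gap (w * B ^ k).+1%:R (beta * (n%:R - n'%:R)) <= K) ->
  cabs (\sum_(x <- s) \sum_(y <- t) c x * d y * expi (beta * (x ^ k)%:R * (y ^ k)%:R))
    ^+ (2 * (w * w)) <=
  ((size s)%:R * (size t)%:R) ^+ (2 * (w * w.-1)) * energy w s * energy w t * K.
Proof.
move=> w0 c1 d1 sA tB HK; set S := \sum_(x <- s) _.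
set H1 := (w * A ^ k).+1 in HK; set H2 := (w * B ^ k).+1 in HK.
pose T x := (wpoly d t).[expi (beta * (x ^ k)%:R)].
have S1 : cabs S <= \sum_(x <- s) 1 * cabs (T x).
  apply: le_trans (cabs_sum _ _ _) _; apply: ler_sum => x _.
  rewrite /T horner_wpoly.
  under eq_bigr do rewrite -mulrA.
  by rewrite -mulr_sumr cabsM ler_wpM2r ?cabs_ge0.
pose E1 := \sum_(x <- s) cabs (T x) ^+ w.
have S2 : cabs S ^+ w <= (size s)%:R ^+ w.-1 * E1.
  have := expr_mean s w0 (fun=> ler01) (fun x => cabs_ge0 (T x)).
  rewrite big_const_seq count_predT iter_addr addr0.
  under [X in _ <= _ * X]eq_bigr do rewrite mul1r.
  apply: le_trans; apply: lerXn2r => //; rewrite nnegrE ?cabs_ge0 //.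
  by apply: sumr_ge0 => x _; rewrite mul1r cabs_ge0.
have E10 : 0 <= E1 by apply: sumr_ge0 => x _; rewrite exprn_ge0 ?cabs_ge0.
(* The phases make |T x|^w linear in T x ^ w, whose expansion over m can then be exchanged with the
   sum over x. *)
pose u x := phase (T x ^+ w).
have u1 x : cabs (u x) <= 1 by apply: cabs_phase.
pose rt m := (powpoly t ^+ w)`_m; pose rs m := (powpoly s ^+ w)`_m.
pose G (m : nat) := (wpoly u s).[expi (beta * m%:R)].
have E1E : E1 <= \sum_(m < H2) rt m * cabs (G m).
  have E : E1%:C = \sum_(m < H2) (wpoly d t ^+ w)`_m * G m.
    rewrite rmorph_sum /=.
    transitivity (\sum_(x <- s) \sum_(m < H2) u x * ((wpoly d t ^+ w)`_m *
        expi (beta * (x ^ k)%:R * m%:R))).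
      apply: eq_bigr => x _; rewrite -cabsX -phaseE -/(u x) -mulr_sumr.
      by rewrite -(horner_wpolyX w beta (x ^ k)%N d1 tB) horner_exp.
    rewrite exchange_big; apply: eq_bigr => m _ /=.
    rewrite /G horner_wpoly mulr_sumr; apply: eq_bigr => x _.
    by rewrite mulrCA -[_ * m%:R]mulrAC.
  rewrite -[leLHS]ger0_norm // -cabs_real E.
  apply: le_trans (cabs_sum _ _ _) _; apply: ler_sum => m _.
  by rewrite cabsM ler_wpM2r ?cabs_ge0 //; apply: dominatedX; apply: wpoly_dominated.
pose E2 := \sum_(m < H2) rt m * cabs (G m) ^+ w.
have rt0 m : 0 <= rt m by apply: powpoly_ge0.
have E20 : 0 <= E2 by apply: sumr_ge0 => m _; rewrite mulr_ge0 // exprn_ge0 ?cabs_ge0.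
(* Hölder over m with the weights [rt], of total mass (size t)^w. *)
have S3 : E1 ^+ w <= (size t)%:R ^+ (w * w.-1) * E2.
  have := @expr_mean _ (index_enum 'I_H2) (fun m => rt m) (fun m => cabs (G m)) w w0
    (fun m => rt0 m) (fun m => cabs_ge0 _).
  rewrite (sum_powpoly (size_powpoly w tB)) -exprM; apply: le_trans.
  apply: lerXn2r => //; rewrite nnegrE ?sumr_ge0 // => m _.
  by rewrite mulr_ge0 ?cabs_ge0.
(* Cauchy-Schwarz separates the multiplicities [rt], whose squares add up to the energy of t, from
   the values of G m ^ w, which are left to the dual sieve. *)
have S4 : E2 ^+ 2 <= energy w t * (K * energy w s).
  apply: le_trans (cauchy_schwarz _ _ _) _.
  rewrite (energy_wide (size_powpoly w tB)) (energy_wide (size_powpoly w sA)).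
  rewrite ler_wpM2l //; first by apply: sumr_ge0 => m _; apply: sqr_ge0.
  apply: le_trans (dual_sieve (g := fun n => (wpoly u s ^+ w)`_n) _ HK).
    apply: ler_sum => m _; rewrite -cabsX /G -horner_exp.
    by rewrite (horner_wpolyX w beta m u1 sA).
  by move=> n; apply: dominatedX; apply: wpoly_dominated.
have e0 : 0 <= energy w t * (K * energy w s) by apply: le_trans S4; apply: sqr_ge0.
apply: (@le_trans _ _ (((size s)%:R ^+ w.-1 * E1) ^+ (2 * w))).
  rewrite (_ : 2 * (w * w) = w * (2 * w))%N; last by lia.
  rewrite exprM; apply: lerXn2r; rewrite ?nnegrE ?exprn_ge0 ?cabs_ge0 //.
  by rewrite mulr_ge0 ?exprn_ge0.
rewrite !exprMn -!mulrA -exprM (_ : w.-1 * (2 * w) = 2 * (w * w.-1))%N; last by lia.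
rewrite ler_wpM2l ?exprn_ge0 //.
rewrite [(2 * w)%N]mulnC exprM.
apply: (@le_trans _ _ (((size t)%:R ^+ (w * w.-1) * E2) ^+ 2)).
  by apply: lerXn2r; rewrite ?nnegrE ?exprn_ge0 // mulr_ge0 ?exprn_ge0.
rewrite exprMn -exprM [(_ * 2)%N]mulnC ler_wpM2l ?exprn_ge0 //.
by apply: le_trans S4 _; rewrite [energy w s * _]mulrCA [energy w s * K]mulrC.
Qed.

End Bilinear.

(** * Integrals over the unit interval *)

Section Integrals.
Variable R : realType.
Local Open Scope classical_set_scope.
Implicit Types (f g F : R -> R).
Local Notation mu := (@lebesgue_measure R).

Lemma continuous_sum_seq (I : Type) (s : seq I) (P : pred I) (f : I -> R -> R) :
  (forall i, continuous (f i)) -> continuous (fun x => \sum_(i <- s | P i) f i x).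
Proof.
move=> cf; elim: s => [|i s IH] x.
  by under eq_fun do rewrite big_nil; exact: cst_continuous.
under eq_fun do rewrite big_cons; case: (P i); last exact: IH.
by apply: cvgD; [exact: cf | exact: IH].
Qed.

Lemma continuous_powR_comp g (u : R) : 0 < u -> (forall x, 0 <= g x) ->
  continuous g -> continuous (fun x => g x `^ u).
Proof.
move=> u0 g0 cg x; have := g0 x; rewrite le_eqVlt => /orP[/eqP gx|gx].
  apply/cvgrPdist_lt => e e0; rewrite -gx powR0 ?gt_eqF //.
  have /cvgrPdist_lt/(_ (e `^ u^-1)) := cg x.
  rewrite powR_gt0 // => /(_ isT); rewrite -gx; apply: filterS => y.
  rewrite !sub0r !normrN !ger0_norm ?powR_ge0 // => h.
  have := lt_powRl u0 (g0 y) h.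
  by rewrite -powRrM mulVf ?gt_eqF // powRr1 // ltW.
apply: (@continuous_comp _ _ _ g (fun y => y `^ u) x); first exact: cg.
apply: differentiable_continuous; apply/derivable1_diffP.
by have [] := is_derive1_powR u gx.
Qed.

Lemma continuous_integrable f (a b : R) : continuous f ->
  mu.-integrable `[a, b] (EFin \o f).
Proof.
move=> cf; apply: continuous_compact_integrable; first exact: segment_compact.
exact: continuous_subspaceT.
Qed.

Definition I01 f : R := \int[mu]_(x in `[0, 1]) f x.

Lemma I01E f : continuous f -> (\int[mu]_(x in `[0%R, 1%R]) (f x)%:E)%E = (I01 f)%:E.
Proof.
move=> cf; rewrite /I01 /Rintegral fineK //.
by apply: integrable_fin_num => //; exact: continuous_integrable.
Qed.

Lemma I01_ge0 f : (forall x, 0 <= f x) -> 0 <= I01 f.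
Proof. by move=> f0; apply: Rintegral_ge0. Qed.

Lemma le_I01 f g : continuous f -> continuous g ->
  (forall x, f x <= g x) -> I01 f <= I01 g.
Proof.
by move=> cf cg fg; apply: le_Rintegral => //; exact: continuous_integrable.
Qed.

Lemma I01D f g : continuous f -> continuous g ->
  I01 (fun x => f x + g x) = I01 f + I01 g.
Proof. by move=> cf cg; apply: RintegralD => //; exact: continuous_integrable. Qed.

Lemma I01Z (c : R) f : continuous f -> I01 (fun x => c * f x) = c * I01 f.
Proof. by move=> cf; apply: RintegralZl => //; exact: continuous_integrable. Qed.

Lemma I01_cst (c : R) : I01 (fun=> c) = c.
Proof.
rewrite /I01 Rintegral_cst //.
have := lebesgue_measure_itv (Interval (BLeft 0) (BRight (1 : R))).
rewrite /= lte_fin ltr01 oppr0 adde0 => h.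
transitivity (c * fine (1 : \bar R)); last by rewrite mulr1.
by congr (c * fine _).
Qed.

Lemma I01_sum (I : Type) (s : seq I) (P : pred I) (f : I -> R -> R) :
  (forall i, continuous (f i)) ->
  I01 (fun x => \sum_(i <- s | P i) f i x) = \sum_(i <- s | P i) I01 (f i).
Proof.
move=> cf; elim: s => [|i s IH].
  rewrite big_nil -[RHS](I01_cst 0); congr I01.
  by apply/funext => x; rewrite big_nil.
rewrite big_cons -IH; case: (boolP (P i)) => Pi.
  rewrite -I01D //; last exact: continuous_sum_seq.
  by congr I01; apply/funext => x; rewrite big_cons Pi.
by congr I01; apply/funext => x; rewrite big_cons (negbTE Pi).
Qed.

(** Differentiability on a neighbourhood of [0, 1] supplies the continuity of F at both end
    points. *)
Lemma I01_FTC f F : continuous f ->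
  (forall x : R, -1 < x < 2 -> is_derive x 1 F (f x)) -> I01 f = F 1 - F 0.
Proof.
move=> cf dF.
have cF x : -1 < x < 2 -> {for x, continuous F}.
  move=> /dF [d _]; apply: differentiable_continuous; exact/derivable1_diffP.
have sub (x : R) : x \in `]0, 1[%R -> -1 < x < 2.
  by rewrite in_itv /= => /andP[h1 h2]; apply/andP; split; lra.
apply: EFin_inj; rewrite -I01E // EFinB; apply: continuous_FTC2 => //.
- exact: continuous_subspaceT.
- split.
  + by move=> x /sub /dF [].
  + by apply: cvg_at_right_filter; apply: cF; apply/andP; split; lra.
  + by apply: cvg_at_left_filter; apply: cF; apply/andP; split; lra.
- by move=> x /sub /dF [_ <-]; rewrite derive1E.
Qed.

Lemma primitive f : continuous f ->
  exists F, forall x : R, -1 < x < 2 -> is_derive x 1 F (f x).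
Proof.
move=> cf; exists (fun x => \int[mu]_(t in `[(-1)%R, x]) f t) => x /andP[x1 x2].
have := @continuous_FTC1 R f (BLeft (-1)) x 2 x2 (continuous_integrable _ _ cf).
rewrite /= lte_fin => /(_ x1 (cf x)) [d e].
by apply: DeriveDef; [exact: d | rewrite -derive1E; exact: e].
Qed.

Lemma continuous_affine_comp f (a b : R) : continuous f ->
  continuous (fun x => f (a * x + b)).
Proof.
move=> cf x; apply: (@continuous_comp _ _ _ (fun y => a * y + b) f); last exact: cf.
by apply: cvgD; [apply: cvgM; [exact: cvg_cst|exact: cvg_id]|exact: cvg_cst].
Qed.

Lemma is_derive_affine (a b x : R) : is_derive x 1 (fun y => a * y + b) a.
Proof.
have h : is_derive x 1 ((a \*: (@idfun R)) + cst b) (a *: 1 + 0).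
  by apply: is_deriveD.
by apply: is_derive_eq h _; rewrite addr0 [_ *: _]mulr1.
Qed.

(** The interval is cut into m equal pieces, each rescaled to [0, 1]. In terms of a primitive every
    piece is a difference of two values, and the sum telescopes. *)
Lemma I01_split f (m : nat) : continuous f -> (0 < m)%N ->
  I01 f = m%:R^-1 * \sum_(j <- iota 0 m) I01 (fun b => f (m%:R^-1 * b + j%:R / m%:R)).
Proof.
move=> cf m0; have [F dF] := primitive cf.
have m0' : 0 < (m%:R : R) by rewrite ltr0n.
have mn := lt0r_neq0 m0'.
have m1 : 1 <= (m%:R : R) by rewrite ler1n.
have mv : 0 < (m%:R : R)^-1 <= 1 by rewrite invr_gt0 m0' invf_le1.
have E j : (j < m)%N -> m%:R^-1 * I01 (fun b => f (m%:R^-1 * b + j%:R / m%:R)) =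
    F (j.+1%:R / m%:R) - F (j%:R / m%:R).
  move=> jm; rewrite -I01Z; last exact: continuous_affine_comp.
  have c1 : continuous (fun x : R => m%:R^-1 * f (m%:R^-1 * x + j%:R / m%:R)).
    by move=> x; apply: cvgM; [exact: cvg_cst|exact: continuous_affine_comp].
  have d1 : forall x : R, -1 < x < 2 -> is_derive x 1 (fun b => F (m%:R^-1 * b + j%:R / m%:R))
      (m%:R^-1 * f (m%:R^-1 * x + j%:R / m%:R)); last first.
    rewrite (I01_FTC c1 d1).
    congr (F _ - F _); last by rewrite mulr0 add0r.
    by rewrite mulr1 -[j.+1%:R]natr1 mulrDl mul1r addrC.
  move=> x /andP[x1 x2].
  suff h : is_derive x 1 (F \o (fun b => m%:R^-1 * b + j%:R / m%:R))
      (f (m%:R^-1 * x + j%:R / m%:R) * m%:R^-1) by apply: is_derive_eq h _; rewrite mulrC.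
  apply: is_derive1_comp.
    apply: dF.
    have jm1 : j%:R / m%:R <= 1 - (m%:R : R)^-1.
      by rewrite ler_pdivrMr // mulrBl mulVf // mul1r lerBrDr natr1 ler_nat.
    have j0 : 0 <= (j%:R : R) / m%:R by rewrite divr_ge0.
    by case/andP: mv => mv0 mv1; apply/andP; split; nra.
  exact: is_derive_affine.
rewrite mulr_sumr (I01_FTC cf dF).
rewrite (eq_big_seq (fun j => F (j.+1%:R / m%:R) - F (j%:R / m%:R))); last first.
  by move=> j; rewrite mem_iota add0n => /andP[_ jm]; apply: E.
rewrite -[iota 0 m]/(iota 0 m) -(subn0 m) -/(index_iota 0 m) telescope_sumr //.
by rewrite subn0 divff // mul0r.
Qed.

Lemma I01_periodic f (d : nat) : continuous f -> (0 < d)%N ->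
  (forall x (n : nat), f (x + n%:R) = f x) -> I01 (fun x => f (d%:R * x)) = I01 f.
Proof.
move=> cf d0 pf; have dn : (d%:R : R) != 0 by rewrite pnatr_eq0 -lt0n.
have cg : continuous (fun x : R => f (d%:R * x)).
  have := @continuous_affine_comp f d%:R 0 cf.
  by under eq_fun do rewrite addr0.
rewrite (I01_split cg d0).
under eq_bigr => j _.
  have -> : (fun b => f (d%:R * (d%:R^-1 * b + j%:R / d%:R))) = f.
    by apply/funext => b; rewrite mulrDr mulVKf // mulrCA divff // mulr1 pf.
  over.
by rewrite big_const_seq count_predT size_iota iter_addr addr0 -[I01 f *+ d]mulr_natl mulKf.
Qed.

Lemma continuous_cos_mul (c : R) : continuous (fun x : R => cos (c * x)).
Proof.
have := @continuous_affine_comp (@cos R) c 0 (@continuous_cos R).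
by under eq_fun do rewrite addr0.
Qed.

Lemma continuous_sin_mul (c : R) : continuous (fun x : R => sin (c * x)).
Proof.
have := @continuous_affine_comp (@sin R) c 0 (@continuous_sin R).
by under eq_fun do rewrite addr0.
Qed.

Lemma I01_cos (j : int) : I01 (fun x => cos (2 * pi * (x * j%:~R))) = (j == 0)%:R.
Proof.
have [->|j0] := eqVneq j 0.
  under [X in I01 X]eq_fun do rewrite mulr0 mulr0 cos0.
  by rewrite I01_cst.
have cn : 2 * pi * j%:~R != 0 :> R.
  by rewrite !mulf_neq0 ?intr_eq0 // gt_eqF // pi_gt0.
set c := 2 * pi * j%:~R in cn.
have -> : (fun x => cos (2 * pi * (x * j%:~R))) = (fun x => cos (c * x)).
  by apply/funext => x; congr cos; rewrite /c; ring.
have d1 : forall x : R, -1 < x < 2 -> is_derive x 1 (fun x => c^-1 * sin (c * x + 0)) (cos (c * x)).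
  move=> x _.
  have h : is_derive x 1 (@sin R \o (fun y => c * y + 0)) (cos (c * x + 0) * c).
    by apply: is_derive1_comp; exact: is_derive_affine.
  have := is_deriveZ c^-1 h; rewrite addr0 => h2.
  by apply: is_derive_eq h2 _; rewrite [_ *: _]mulrCA mulVf // mulr1.
rewrite (I01_FTC (@continuous_cos_mul c) d1).
have := @expi_int R j; rewrite /expi -/c => /(congr1 (@complex.Im R)) /= s0.
by rewrite mulr1 mulr0 !addr0 sin0 s0 mulr0 subrr.
Qed.

Lemma continuous_absf k (P Rb : R) : continuous (absf k P Rb).
Proof.
move=> x; apply: (@continuous_comp _ _ _ (fun a => fRe k P Rb a ^+ 2 + fIm k P Rb a ^+ 2)
  (@Num.sqrt R)); last exact: sqrt_continuous.
have sq (g : R -> R) : continuous g -> {for x, continuous (fun a => g a ^+ 2)}.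
  move=> cg; rewrite (_ : (fun a => g a ^+ 2) = (fun a => g a * g a)) //.
    by apply: cvgM; exact: cg.
apply: cvgD; apply: sq; apply: continuous_sum_seq => n.
  have := @continuous_cos_mul (2 * pi * n%:R ^+ k).
  by under eq_fun do rewrite mulrAC.
have := @continuous_sin_mul (2 * pi * n%:R ^+ k).
by under eq_fun do rewrite mulrAC.
Qed.

Lemma absf_ge0 k (P Rb a : R) : 0 <= absf k P Rb a.
Proof. exact: sqrtr_ge0. Qed.

Lemma continuous_absf_powR k (P Rb u : R) : 0 < u ->
  continuous (fun a => absf k P Rb a `^ u).
Proof.
move=> u0; apply: continuous_powR_comp => //; last exact: continuous_absf.
by move=> x; exact: absf_ge0.
Qed.

Lemma UE k (u P Rb : R) : 0 < u ->
  U k u P Rb = (I01 (fun a => absf k P Rb a `^ u))%:E.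
Proof. by move=> u0; rewrite /U /intf I01E //; exact: continuous_absf_powR. Qed.

Lemma parseval k w (P Rb : R) : (0 < w)%N ->
  I01 (fun a => absf k P Rb a ^+ (2 * w)) = energy R k w (smooth P Rb).
Proof.
move=> w0; set s := smooth P Rb; set N := size (powpoly R k s ^+ w).
pose r (m : nat) := (powpoly R k s ^+ w)`_m.
have E a : absf k P Rb a ^+ (2 * w) =
    \sum_(m < N) \sum_(n < N) r m * r n * cos (2 * pi * (a * (m%:Z - n%:Z)%:~R)).
  rewrite absfE -/s mulnC exprM -cabsX.
  set z := _ ^+ w.
  have zE : z = \sum_(m < N) (r m)%:C%C * expi (a * m%:R).
    have -> : z = (map_poly (real_complex R) (powpoly R k s ^+ w)).[expi a].
      rewrite rmorphXn /= horner_exp /z; congr (_ ^+ _).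
      rewrite /powpoly rmorph_sum horner_sum; apply: eq_bigr => x _.
      by rewrite /= map_polyXn hornerXn -expiM natrX.
    rewrite (horner_coef_wide _ (leq_trans (size_poly _ _) (leqnn N))).
    by apply: eq_bigr => m _; rewrite coef_map -expiM.
  have : complex.Re (cabs z ^+ 2)%:C%C = cabs z ^+ 2 by [].
  move=> <-; rewrite cabs_sqr zE conjc_sum big_distrlr.
  transitivity (complex.Re (\sum_(m < N) \sum_(n < N)
     (r m * r n)%:C%C * expi (a * (m%:Z - n%:Z)%:~R))).
    congr complex.Re; apply: eq_bigr => m _; apply: eq_bigr => n _.
    have h (u v x y : R) : u%:C%C * expi x * conjc (v%:C%C * expi y) = (u * v)%:C%C * expi (x - y).
      by rewrite conjcM conjc_real -expiN mulrACA -expiD rmorphM.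
    apply: etrans (h _ _ _ _) _; congr (_ * expi _).
    by rewrite intrB; ring.
  have ReS (I : Type) (t : seq I) (G : I -> R[i]) :
     complex.Re (\sum_(i <- t) G i) = \sum_(i <- t) complex.Re (G i).
    elim: t => [|i t IH]; first by rewrite !big_nil.
    by rewrite !big_cons -IH; case: (G i) (\sum_(_ <- _) _) => [? ?] [? ?].
  rewrite ReS; apply: eq_bigr => m _; rewrite ReS; apply: eq_bigr => n _.
  by rewrite /= mul0r subr0.
have cc (c d : R) : continuous (fun a : R => c * cos (2 * pi * (a * d))).
  move=> x; apply: cvgM; first exact: cvg_cst.
  have := @continuous_cos_mul (2 * pi * d) x.
  by rewrite (_ : (fun x : R => cos (2 * pi * d * x)) = (fun a => cos (2 * pi * (a * d))));
    [|apply/funext => y; congr cos; ring].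
under [X in I01 X]eq_fun do rewrite E.
rewrite I01_sum; last by move=> m; apply: continuous_sum_seq => n; exact: cc.
apply: eq_bigr => m _; rewrite I01_sum; last by move=> n; exact: cc.
rewrite (bigD1 m) //= big1 ?addr0 => [|n nm]; rewrite I01Z ?I01_cos.
- by rewrite subrr eqxx mulr1 expr2.
- by have := cc 1 (m%:Z - m%:Z)%:~R; under eq_fun do rewrite mul1r.
- by rewrite subr_eq0 eqz_nat eq_sym (negbTE (nm : nat_of_ord n != m)) mulr0.
by have := cc 1 (m%:Z - n%:Z)%:~R; under eq_fun do rewrite mul1r.
Qed.

Lemma U_energy k w (P Rb : R) : (0 < w)%N ->
  U k (2 * w%:R) P Rb = (energy R k w (smooth P Rb))%:E.
Proof.
move=> w0; rewrite UE ?mulr_gt0 ?ltr0n // -parseval //; congr (I01 _)%:E.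
by apply/funext => a; rewrite -natrM powR_mulrn ?absf_ge0.
Qed.

End Integrals.

(** * Pointwise bound on the minor arcs *)

Section Weyl.
Variable R : realType.
Local Open Scope complex_scope.
Local Notation C := R[i].

Lemma fracN (x : R) : frac x != 0 -> frac (- x) = 1 - frac x.
Proof.
move=> fx0; have /andP[f0 f1] := frac_itv x.
have fx : 0 < frac x by rewrite lt_neqAle eq_sym fx0.
have : Num.floor (- x) = - Num.floor x - 1.
  apply: floor_def; rewrite !intrD !mulrNz; move: fx f1; rewrite /frac.
  by move=> ? ?; apply/andP; split; lra.
by rewrite /frac => ->; rewrite intrB mulrNz; ring.
Qed.

Lemma expi_eq1 (x : R) : expi x = 1 -> frac x = 0.
Proof.
move=> ex; apply/eqP/negPn/negP => fx0.
have /andP[f0 f1] := frac_itv x.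
have fx : 0 < frac x by rewrite lt_neqAle eq_sym fx0.
have [fl|fl] := leP (frac x) 2^-1.
  have := @cabs_expiB1 R (frac x); rewrite f0 fl expi_frac ex subrr cabs0.
  by move=> /(_ isT); lra.
have := @cabs_expiB1 R (frac (- x)); rewrite expi_frac expiN ex conjc1 subrr cabs0.
have h : 0 <= 1 - frac x <= 2^-1 by apply/andP; split; lra.
by rewrite (fracN fx0) => /(_ h); lra.
Qed.

Lemma sum_expi_eq (N y u : nat) : (y < N)%N -> (u < N)%N ->
  \sum_(h < N) expi (h%:R * (y%:R - u%:R) / N%:R : R) = (if y == u then N%:R else 0).
Proof.
move=> yN uN; have N0 : 0 < (N%:R : R) by rewrite ltr0n (leq_ltn_trans _ yN).
have Nn := lt0r_neq0 N0.
set x := (y%:R - u%:R) / N%:R : R.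
have E h : expi (h%:R * (y%:R - u%:R) / N%:R) = expi x ^+ h.
  by rewrite -expiM /x; congr expi; rewrite [RHS]mulrAC [_ * h%:R]mulrC.
under eq_bigr do rewrite E.
case: eqP => yu.
  by rewrite /x yu subrr mul0r expi0; under eq_bigr do rewrite expr1n; rewrite sumr_const card_ord.
have := subrX1 (expi x) N.
rewrite -expiM /x divfK // -[y%:R]/(y%:~R) -[u%:R]/(u%:~R) -intrB expi_int subrr.
move=> /esym/eqP; rewrite mulf_eq0 => /orP[|/eqP //].
rewrite subr_eq0 => /eqP/expi_eq1 /eqP; rewrite /frac subr_eq0 => /eqP h.
exfalso; apply: yu.
have : (y%:Z - u%:Z)%:~R = (Num.floor ((y%:Z - u%:Z)%:~R / N%:R : R) * N%:Z)%:~R :> R.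
  by rewrite [RHS]intrM -h divfK.
move/intr_inj; move: (Num.floor _) => c hc.
have c0 : c = 0 by nia.
by rewrite c0 mul0r in hc; lia.
Qed.

Lemma cap_mono (H H' y : R) : H <= H' -> cap H y <= cap H' y.
Proof. by rewrite /cap => h; case: ifP => // _; rewrite le_min !ge_min h lexx !orbT. Qed.

Lemma gap_mono (H H' x : R) : H <= H' -> gap H x <= gap H' x.
Proof. by move=> h; rewrite /gap lerD ?cap_mono. Qed.

Lemma cap_gt0 (H y : R) : 0 < H -> 0 <= y -> 0 < cap H y.
Proof.
move=> H0 y0; rewrite /cap; case: eqP => // /eqP yn.
by rewrite lt_min H0 invr_gt0 lt_neqAle eq_sym yn.
Qed.

Lemma gap_gt0 (H x : R) : 0 < H -> 0 < gap H x.
Proof.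
by move=> H0; have /andP[a _] := frac_itv x; have /andP[b _] := frac_itv (- x);
  rewrite addr_gt0 ?cap_gt0.
Qed.

(* The condition [y <= z x] is detected by additive characters modulo [N]. *)
Lemma decouple (s t : seq nat) (z : nat -> nat) (N : nat) (E : nat -> nat -> C) (M : R) :
  (0 < N)%N -> {in s, forall x, (z x < N)%N} -> {in t, forall y, (y < N)%N} ->
  (forall c d : nat -> C, (forall x, cabs (c x) <= 1) -> (forall y, cabs (d y) <= 1) ->
     cabs (\sum_(x <- s) \sum_(y <- t) c x * d y * E x y) <= M) ->
  cabs (\sum_(x <- s) \sum_(y <- t | (y <= z x)%N) E x y) <= 2 * (2 + ln (N%:R)) * M.
Proof.
move=> N0 zN tN HM.
have N0' : 0 < (N%:R : R) by rewrite ltr0n.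
have Nn := lt0r_neq0 N0'.
have NnC : (N%:R : C) != 0 by rewrite pnatr_eq0 -lt0n.
(* By orthogonality modulo N, averaging [a h v * b h y] over h gives the number of u <= v equal to
   y, the indicator of y <= v. *)
pose a (h v : nat) : C := \sum_(u < v.+1) expi (- (h%:R / N%:R) : R) ^+ u.
pose b (h y : nat) : C := expi (h%:R * y%:R / N%:R : R).
have ind v y : (v < N)%N -> (y < N)%N ->
    (if (y <= v)%N then 1 else 0) = N%:R^-1 * \sum_(h < N) a h v * b h y.
  move=> vN yN; apply: (mulfI NnC); rewrite mulVKf //.
  transitivity (\sum_(u < v.+1) \sum_(h < N) expi (h%:R * (y%:R - u%:R) / N%:R : R)); last first.
    rewrite exchange_big; apply: eq_bigr => h _ /=; rewrite mulr_suml.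
    apply: eq_bigr => u _; rewrite -expiM -expiD; congr expi; ring.
  under eq_bigr => u _ do rewrite sum_expi_eq ?(leq_trans (ltn_ord u)) //.
  case: ifP => yv.
    rewrite (bigD1 (Ordinal (yv : y < v.+1)%N)) //= eqxx big1 ?addr0 ?mulr1 // => u.
    by rewrite eq_sym -val_eqE /= => /negbTE ->.
  rewrite big1 ?mulr0 // => u _; case: eqP => // yu.
  by move: (ltn_ord u); rewrite -yu ltnS yv.
have EE : \sum_(x <- s) \sum_(y <- t | (y <= z x)%N) E x y =
    N%:R^-1 * \sum_(h < N) \sum_(x <- s) \sum_(y <- t) a h (z x) * b h y * E x y.
  rewrite mulr_sumr.
  transitivity (\sum_(x <- s) \sum_(y <- t) \sum_(h < N) N%:R^-1 * (a h (z x) * b h y * E x y)).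
    apply: eq_big_seq => x xs; rewrite big_mkcond; apply: eq_big_seq => y yt.
    rewrite -mulr_sumr -mulr_suml mulrA -ind ?zN ?tN //.
    by case: ifP; rewrite ?mul1r ?mul0r.
  under eq_bigr => x _ do rewrite exchange_big.
  rewrite exchange_big; apply: eq_bigr => h _ /=.
  by rewrite mulr_sumr; apply: eq_bigr => x _; rewrite mulr_sumr.
rewrite EE cabsM.
have M0 : 0 <= M.
  apply: le_trans (HM (fun=> 0) (fun=> 0) _ _); rewrite ?cabs_ge0 // => x;
  by rewrite cabs0 ler01.
have cN : cabs (N%:R^-1 : C) = N%:R^-1.
  by rewrite (_ : N%:R^-1 = (N%:R^-1)%:C) ?cabs_real ?ger0_norm ?invr_ge0 // fmorphV rmorph_nat.
rewrite cN mulrC ler_pdivrMr //.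
apply: (@le_trans _ _ (\sum_(h <- iota 0 N) gap N%:R (h%:R / N%:R) * M)).
  apply: le_trans (cabs_sum _ _ _) _.
  rewrite -(big_mkord xpredT (fun h => cabs (\sum_(x <- s) \sum_(y <- t) a h (z x) * b h y * E x y))).
  rewrite /index_iota subn0; apply: ler_sum => h _.
  have G0 : 0 < gap N%:R (h%:R / N%:R : R) by apply: gap_gt0.
  set G := gap _ _ in G0 *.
  have GnC : G%:C != 0 by rewrite -(rmorph0 (real_complex R)) (inj_eq (@complexI R)) gt_eqF.
  (* Dividing by G, which dominates the geometric sum [a h (z x)], gives weights of modulus at most
     1. The values of G add up to 2 N (2 + ln N) at most, because the points h / N are spaced by 1 /
     N. *)
  pose c x := if (z x < N)%N then G%:C^-1 * a h (z x) else 0.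
  have c1 x : cabs (c x) <= 1.
    rewrite /c; case: ifP => zx; last by rewrite cabs0 ler01.
    rewrite cabsM -fmorphV cabs_real ger0_norm ?invr_ge0 ?(ltW G0) // ler_pdivrMl // mulr1.
    apply: le_trans (geom_le _ _) _; rewrite gapN; apply: gap_mono.
    by rewrite ler_nat.
  have b1 y : cabs (b h y) <= 1 by rewrite cabs_expi.
  have h1 := HM c (b h) c1 b1.
  apply: le_trans (ler_wpM2l (ltW G0) h1).
  rewrite -[X in X * _](ger0_norm (ltW G0)) -cabs_real -cabsM.
  rewrite le_eqVlt; apply/orP; left; apply/eqP; congr cabs.
  rewrite mulr_sumr; apply: eq_big_seq => x xs.
  rewrite mulr_sumr; apply: eq_bigr => y _.
  by rewrite /c zN // !mulrA mulfV // mul1r.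
rewrite -mulr_suml mulrAC ler_wpM2r //.
have sp : {in iota 0 N &, forall i j : nat, i != j -> forall c : int,
    (N%:R : R)^-1 <= `|i%:R / N%:R - j%:R / N%:R - c%:~R|}.
  move=> i j; rewrite !mem_iota !add0n => /andP[_ iN] /andP[_ jN] ij c.
  rewrite -mulrBl -[c%:~R](mulfK Nn) -mulrBl normrM [X in _ * X]ger0_norm ?invr_ge0 //.
  rewrite -[leLHS]mul1r ler_wpM2r ?invr_ge0 //.
  have -> : i%:R - j%:R - c%:~R * N%:R = (i%:Z - j%:Z - c * N%:Z)%:~R :> R.
    by rewrite !intrB intrM.
  rewrite -intr_norm -[1]/(1%:~R) ler_int.
  have : i%:Z - j%:Z - c * N%:Z != 0.
    apply/eqP => e; have c0 : c = 0 by nia.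
    by rewrite c0 mul0r subr0 in e; lia.
  by lia.
have := sum_gap (H := N%:R) (J := N) (iota_uniq 0 N) (ltW N0') _ _ sp.
rewrite invr_gt0 mulfV // => /(_ N0' (lexx _)); rewrite invrK => h.
apply: le_trans h _; rewrite le_eqVlt; apply/orP; left; apply/eqP; ring.
Qed.

Lemma le_coefX (p q : {poly R}) (w : nat) : (forall m, 0 <= p`_m <= q`_m) ->
  forall m, 0 <= (p ^+ w)`_m <= (q ^+ w)`_m.
Proof.
move=> pq; elim: w => [|w IH] m.
  by rewrite !expr0 !coef1 lexx andbT; case: eqP.
rewrite !exprS !coefM; apply/andP; split.
  by apply: sumr_ge0 => i _; case/andP: (pq i) (IH (m - i)%N) => ? ? /andP[? ?]; rewrite mulr_ge0.
by apply: ler_sum => i _; case/andP: (pq i) (IH (m - i)%N) => ? ? /andP[? ?]; rewrite ler_pM.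
Qed.

Lemma energy_subset k w (s s' : seq nat) : uniq s -> {subset s <= s'} ->
  energy R k w s <= energy R k w s'.
Proof.
move=> us ss'.
have co m : 0 <= (powpoly R k s)`_m <= (powpoly R k s')`_m.
  rewrite /powpoly !coef_sum; apply/andP; split.
    by apply: sumr_ge0 => x _; rewrite coefXn.
  pose P x := x \in s.
  have ps : perm_eq s (undup [seq x <- s' | P x]).
    apply: uniq_perm => //; first exact: undup_uniq.
    by move=> x; rewrite mem_undup mem_filter /P; case: (boolP (x \in s)) => //= /ss' ->.
  rewrite (perm_big _ ps) /=.
  have sub : subseq (undup [seq x <- s' | P x]) s'.
    by apply: subseq_trans (undup_subseq _) (filter_subseq _ _).
  have := sub; move: (undup _) => r; elim: s' {ss' ps sub} r => [|x s' IH] r.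
    by rewrite subseq0 => /eqP ->.
  case: r => [|y r] /=; first by rewrite big_nil sumr_ge0 // => i _; rewrite coefXn.
  case: eqP => [-> /IH h|_ /IH h]; rewrite [leRHS]big_cons.
    by rewrite big_cons lerD2l.
  by apply: le_trans h _; rewrite lerDr coefXn.
set n := maxn (size (powpoly R k s ^+ w)) (size (powpoly R k s' ^+ w)).
rewrite (energy_wide (n := n)) ?leq_maxl // [leRHS](energy_wide (n := n)) ?leq_maxr //.
apply: ler_sum => m _; have /andP[a b] := le_coefX w co m.
by apply: lerXn2r => //; rewrite nnegrE (le_trans a).
Qed.

(** Inside a block of L consecutive n' all differences are at most L, so the points are
    [lambda]-spaced modulo 1 and [sum_gap] applies; H1 / L + 1 blocks cover the range. *)
Lemma sum_gap_blocks (beta lambda : R) (H1 H2 L J n : nat) : (0 < L)%N ->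
  0 < lambda -> 1 <= J%:R * lambda ->
  (forall m : nat, (0 < m <= L)%N -> forall c : int, lambda <= `|m%:R * beta - c%:~R|) ->
  \sum_(n' < H1) gap H2%:R (beta * (n%:R - n'%:R)) <=
  (H1 %/ L).+1%:R * (2 * (H2%:R + lambda^-1 * (1 + ln J%:R))).
Proof.
move=> L0 l0 Jl sp; set Q := 2 * _.
pose F (n' : nat) := gap H2%:R (beta * (n%:R - n'%:R)).
have F0 n' : 0 <= F n' by apply: gap_ge0.
have block (r : nat) : \sum_(i <- iota (r * L) L) F i <= Q.
  apply: sum_gap => //; first exact: iota_uniq.
  move=> i j; rewrite !mem_iota => /andP[i1 i2] /andP[j1 j2] ij c.
  wlog lij : i j c i1 i2 j1 j2 ij / (i < j)%N.
    move=> h; case: (ltngtP i j) => lij; [exact: h | | by rewrite lij eqxx in ij].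
    have := h j i (- c) j1 j2 i1 i2; rewrite eq_sym => /(_ ij lij).
    by rewrite -normrN mulrNz; congr (_ <= `|_|); ring.
  have := sp (j - i)%N _ c.
  have -> : (j - i)%:R * beta = beta * (n%:R - i%:R) - beta * (n%:R - j%:R).
    by rewrite natrB ?(ltnW lij) //; ring.
  by apply; lia.
rewrite -(big_mkord xpredT F) /index_iota subn0.
apply: (@le_trans _ _ (\sum_(i <- iota 0 ((H1 %/ L).+1 * L)) F i)).
  have e : ((H1 %/ L).+1 * L = H1 + ((H1 %/ L).+1 * L - H1))%N.
    by rewrite subnKC // ltnW // ltn_ceil.
  by rewrite e iotaD big_cat /= lerDl sumr_ge0.
elim: (H1 %/ L).+1 => [|r IH]; first by rewrite mul0n big_nil mul0r.
rewrite mulSn addnC iotaD big_cat /= add0n -natr1 mulrDl mul1r.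
by apply: lerD.
Qed.

End Weyl.

Section WeylSmooth.
Variable R : realType.
Local Open Scope complex_scope.
Local Notation C := R[i].

(** Makes the range of y independent of v at the price of the condition y <= N, which [decouple]
    removes. *)
Lemma big_pnats_widen (M : nmodType) (pi : nat_pred) (N A : nat) (F : nat -> M) :
  (N <= A)%N ->
  \sum_(y <- pnats pi N) F y = \sum_(y <- pnats pi A | (y <= N)%N) F y.
Proof.
move=> NA; rewrite -[RHS]big_filter; apply: perm_big; apply: uniq_perm.
- exact: pnats_uniq.
- by rewrite filter_uniq // pnats_uniq.
move=> y; rewrite mem_pnats [RHS]mem_filter mem_pnats.
by case: (leqP y N) => yN; rewrite ?andbF ?andbT //= (leq_trans yN NA) andbT.
Qed.

(** The z <= Y1 are counted trivially. Every other z is split by [big_cores], with all primes in the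
    role of [rho], into v y with v in (Y1, Y1 R0]. Fixing b = [pdiv v], for which there are R0 + 1
    values, and decoupling y <= Z / v leaves bilinear forms with both variables at most A. *)
Lemma smooth_weyl (k w Z Y1 A R0 L J : nat) (pi : nat_pred) (beta lambda M : R) :
  (0 < w)%N -> (0 < Y1)%N -> (0 < L)%N -> 0 < lambda -> 1 <= J%:R * lambda ->
  (forall m : nat, (0 < m <= L)%N -> forall c : int, lambda <= `|m%:R * beta - c%:~R|) ->
  (forall p, p \in pi -> (p <= R0)%N) ->
  (Y1 * R0 <= A)%N -> (Z %/ Y1.+1 <= A)%N -> 0 <= M ->
  (A%:R * A%:R) ^+ (2 * (w * w.-1)) * energy R k w (pnats [pred p | (p <= R0)%N] A)
    * energy R k w (pnats [pred p | (p <= R0)%N] A)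
    * (((w * A ^ k).+1 %/ L).+1%:R *
        (2 * ((w * A ^ k).+1%:R + lambda^-1 * (1 + ln J%:R)))) <= M ^+ (2 * (w * w)) ->
  cabs (\sum_(z <- pnats pi Z) expi (beta * (z ^ k)%:R)) <=
  Y1%:R + R0.+1%:R * (2 * (2 + ln A.+1%:R) * M).
Proof.
move=> w0 Y10 L0 l0 Jl sp piR YA ZA M0 HM.
set E := energy _ _ _ _ in HM; set K := _.+1%:R * (2 * _) in HM.
rewrite (bigID (fun z => (Y1 < z`_predT)%N)) /= addrC.
apply: le_trans (cabsD _ _) _; apply: lerD.
  apply: le_trans (cabs_sum _ _ _) _.
  under eq_bigr do rewrite cabs_expi.
  rewrite big_const_seq iter_addr addr0 ler_nat -size_filter.
  rewrite -[leqRHS](size_iota 1) uniq_leq_size //.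
    by rewrite filter_uniq // pnats_uniq.
  move=> z; rewrite mem_filter mem_pnats mem_iota -leqNgt => /and3P[zY pz _].
  have z0 : (0 < z)%N by case/andP: pz.
  by rewrite z0 add1n ltnS -[X in (X <= _)%N](partnT z0).
rewrite big_cores //.
pose pi' : nat_pred := [predI pi & predT].
pose s := cores Y1 pi' Z; pose t b := pnats (below pi predT b) A.
have sP v : v \in s -> [/\ (Y1 < v)%N, (v <= A)%N, pi.-nat v, (v <= Z)%N & (pdiv v <= R0)%N].
  rewrite mem_filter mem_pnats pnatI => /andP[/andP[Yv vY] /andP[/andP[pv _] vZ]].
  have v1 : (1 < v)%N by lia.
  have v0 : (0 < v)%N by lia.
  have pR : (pdiv v <= R0)%N.
    by apply: piR; apply: (pnatP _ v0 pv) (pdiv_prime v1) (pdiv_dvd v).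
  split => //; apply: leq_trans YA.
  by rewrite -(divnK (pdiv_dvd v)) leq_mul.
have us : uniq s by rewrite filter_uniq // pnats_uniq.
have EE : \sum_(v <- s) \sum_(z <- pnats (below pi predT (pdiv v)) (Z %/ v))
      expi (beta * ((v * z) ^ k)%:R) =
   \sum_(b <- iota 0 R0.+1) \sum_(v <- s | pdiv v == b)
     \sum_(y <- t b | (y <= Z %/ v)%N) expi (beta * (v ^ k)%:R * (y ^ k)%:R) :> C.
  transitivity (\sum_(v <- s) \sum_(b <- iota 0 R0.+1 | pdiv v == b)
     \sum_(y <- t b | (y <= Z %/ v)%N) expi (beta * (v ^ k)%:R * (y ^ k)%:R) : C).
    apply: eq_big_seq => v vs; have [Yv vA pv vZ pR] := sP v vs.
    rewrite [RHS]big_mkcond [RHS](bigD1_seq (pdiv v)) ?iota_uniq //=; last first.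
      by rewrite -[_ :: _]/(iota 0 R0.+1) mem_iota add0n ltnS pR.
    rewrite eqxx [X in _ = _ + X]big1 ?addr0; last by move=> b; rewrite eq_sym => /negbTE ->.
    rewrite (@big_pnats_widen _ _ _ A); last first.
      by apply: leq_trans ZA; apply: leq_div2l.
    by apply: eq_bigr => y _; rewrite expnMn natrM mulrA.
  by rewrite (exchange_big_dep predT).
rewrite EE; apply: le_trans (cabs_sum _ _ _) _.
apply: (@le_trans _ _ (\sum_(b <- iota 0 R0.+1) (2 * (2 + ln A.+1%:R) * M))); last first.
  rewrite big_const_seq count_predT size_iota iter_addr addr0.
  by rewrite -[leLHS]mulr_natl.
apply: ler_sum => b _; rewrite -big_filter.
set sb := [seq v <- s | pdiv v == b].
have sbs : {subset sb <= s} by move=> v; rewrite mem_filter => /andP[].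
have tb : {subset t b <= pnats [pred p | (p <= R0)%N] A}.
  by apply: subset_pnats => // p /andP[/piR].
have sA : {subset sb <= pnats [pred p | (p <= R0)%N] A}.
  move=> v /sbs /sP [_ vA pv _ _]; rewrite mem_pnats vA andbT.
  by apply: sub_in_pnat pv => p _; exact: piR.
have usb : uniq sb by rewrite filter_uniq.
have utb : uniq (t b) by exact: pnats_uniq.
have sz (r : seq nat) : uniq r -> {subset r <= pnats [pred p | (p <= R0)%N] A} ->
    (size r)%:R <= (A%:R : R).
  by move=> ur rA; rewrite ler_nat (leq_trans (uniq_leq_size ur rA)) ?size_pnats.
have en0 (r : seq nat) : 0 <= energy R k w r by apply: sumr_ge0 => m _; exact: sqr_ge0.
have leA (r : seq nat) : {subset r <= pnats [pred p | (p <= R0)%N] A} ->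
   {in r, forall x, (x <= A)%N}.
  by move=> rA x /rA; rewrite mem_pnats => /andP[].
apply: (@decouple _ sb (t b) (fun v => Z %/ v)%N A.+1
  (fun v y => expi (beta * (v ^ k)%:R * (y ^ k)%:R))) => //.
- move=> v /sbs /sP [Yv _ _ _ _]; rewrite ltnS; apply: leq_trans ZA.
  exact: leq_div2l.
- by move=> y /(leA _ tb); rewrite ltnS.
move=> c d c1 d1.
have := @bilinear_bound R k w A A sb (t b) c d beta K w0 c1 d1 (leA _ sA) (leA _ tb).
have HK : forall n : 'I_(w * A ^ k).+1, \sum_(n' < (w * A ^ k).+1)
     gap (w * A ^ k).+1%:R (beta * (n%:R - n'%:R)) <= K.
  by move=> n; apply: sum_gap_blocks.
have K0 : 0 <= K.
  apply: le_trans (HK ord0); apply: sumr_ge0 => n _; exact: gap_ge0.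
move=> /(_ HK) h.
rewrite -(@ler_pXn2r _ (2 * (w * w))) ?nnegrE ?cabs_ge0 //; last by rewrite !muln_gt0 w0.
apply: le_trans h _; apply: le_trans HM.
rewrite ler_wpM2r // ler_pM ?mulr_ge0 ?exprn_ge0 ?mulr_ge0 //; last exact: energy_subset.
rewrite ler_pM ?mulr_ge0 ?exprn_ge0 ?mulr_ge0 //; last exact: energy_subset.
by apply: lerXn2r; rewrite ?nnegrE ?mulr_ge0 // ler_pM ?sz.
Qed.

(* A good approximation [c / n] of [m alpha] with [n] small must be [m a / q] itself. *)
Lemma minor_spacing (q a m L : nat) (alpha kappa delta lambda Q : R) :
  (0 < q)%N -> coprime a q -> coprime m q ->
  `|q%:R * alpha - a%:R| <= kappa ->
  (q%:R <= Q -> delta < `|q%:R * alpha - a%:R|) ->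
  L%:R <= Q -> L%:R * (m%:R * kappa) <= 2^-1 -> q%:R * lambda <= 2^-1 ->
  (0 < m)%N -> lambda <= m%:R * delta ->
  forall n : nat, (0 < n <= L)%N -> forall c : int,
    lambda <= `|n%:R * (m%:R * alpha) - c%:~R|.
Proof.
move=> q0 aq mq qk qQ LQ Lk ql m0 lm n /andP[n0 nL] c.
rewrite leNgt; apply/negP => hc.
have q0' : 0 < (q%:R : R) by rewrite ltr0n.
have nL' : (n%:R : R) <= L%:R by rewrite ler_nat.
have m0' : 0 < (m%:R : R) by rewrite ltr0n.
have e : (n * m * a)%:Z = q%:Z * c.
  apply/eqP; rewrite -subr_eq0 -absz_eq0 -leqn0 -ltnS -(ltr_nat R) natr_absz.
  rewrite intr_norm.
  have -> : ((n * m * a)%:Z - q%:Z * c)%:~R =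
     q%:R * (n%:R * (m%:R * alpha) - c%:~R) - n%:R * (m%:R * (q%:R * alpha - a%:R)) :> R.
    by rewrite intrB intrM !PoszM !intrM; rewrite -!pmulrn; ring.
  apply: le_lt_trans (ler_normB _ _) _.
  rewrite !normrM !normr_nat.
  have h1 : q%:R * `|n%:R * (m%:R * alpha) - c%:~R| < q%:R * lambda by rewrite ltr_pM2l.
  have h2 : n%:R * (m%:R * `|q%:R * alpha - a%:R|) <= L%:R * (m%:R * kappa).
    by rewrite ler_pM ?mulr_ge0 // ler_pM.
  lra.
have qn : (q %| n)%N.
  have : (q %| n * m * a)%N.
    by rewrite -[(q %| _)%N]/((q%:Z %| (n * m * a)%:Z)%Z) e dvdz_mulr.
  by rewrite -mulnA mulnC Gauss_dvdr // coprimeMr ![coprime q _]coprime_sym mq aq.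
have [l nE] := dvdnP qn.
have l0 : (0 < l)%N by move: n0; rewrite nE muln_gt0 => /andP[].
have cE : c = (l * m * a)%:Z.
  have qn0 : q%:Z != 0 by rewrite eqz_nat -lt0n.
  apply/esym/(mulfI qn0); rewrite -e -PoszM nE; congr Posz.
  by rewrite -!mulnA mulnCA.
(* As n <= L is a multiple of q, the denominator q is at most Q and |q alpha - a| exceeds [delta];
   then |n m alpha - c| = l m |q alpha - a| is more than [lambda]. *)
have qle : q%:R <= Q.
  by apply: le_trans LQ; apply: le_trans nL'; rewrite ler_nat dvdn_leq.
have := qQ qle; apply/negP; rewrite -leNgt.
rewrite -(ler_pM2l m0'); apply: le_trans lm; apply: le_trans (ltW hc).
have -> : n%:R * (m%:R * alpha) - c%:~R = l%:R * (m%:R * (q%:R * alpha - a%:R)) :> R.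
  by rewrite cE nE -pmulrn !natrM; ring.
rewrite !normrM !normr_nat -[leLHS]mul1r ler_wpM2r ?mulr_ge0 //.
by rewrite ler1n.
Qed.

(** Pigeonhole with N + 1 points, i = 0, ..., N, and N + 1 cells: either two points share a cell, or
    the last cell contains a point with i > 0, within 1 / (N + 1) of an integer. So denominators up
    to N achieve the error 1 / (N + 1) <= 1 / Q, and the fraction is then reduced. *)
Lemma dirichlet (alpha Q : R) : 0 <= alpha < 1 -> 1 <= Q ->
  exists q a : nat, [/\ (1 <= q)%N, q%:R <= Q, (a <= q)%N, coprime a q &
    `|q%:R * alpha - a%:R| <= Q^-1].
Proof.
move=> /andP[a0 a1] Q1; have Q0 : 0 < Q by lra.
set N := Num.truncn Q.
have N0 : (0 < N)%N by rewrite truncn_gt0.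
have QN : Q < N.+1%:R by apply: truncnS_gt.
have NQ : N%:R <= Q by rewrite truncn_le ltW.
have NQV : (N.+1%:R : R)^-1 <= Q^-1 by rewrite lef_pV2 ?posrE // ltW.
have N1p : 0 < (N.+1%:R : R) by [].
suff [q0 [c [q1 qN cq h]]] : exists q0 c : nat, [/\ (0 < q0)%N, (q0 <= N)%N, (c <= q0)%N &
    `|q0%:R * alpha - c%:R| <= Q^-1].
  have g0 : (0 < gcdn c q0)%N by rewrite gcdn_gt0 q1 orbT.
  exists (q0 %/ gcdn c q0)%N, (c %/ gcdn c q0)%N.
  have qg := dvdn_gcdr c q0; have cg := dvdn_gcdl c q0.
  split.
  - by rewrite divn_gt0 // dvdn_leq.
  - by apply: le_trans NQ; rewrite ler_nat (leq_trans _ qN) // leq_div.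
  - by rewrite leq_div2r.
  - by rewrite /coprime -(eqn_pmul2r g0) muln_gcdl !divnK // mul1n.
  have g1 : 1 <= ((gcdn c q0)%:R : R) by rewrite ler1n.
  move: qg cg g1 h; set g := gcdn c q0 => qg cg g1 h.
  apply: le_trans h; rewrite -[in leRHS](divnK qg) -[in leRHS](divnK cg) !natrM mulrAC -mulrBl normrM.
  by rewrite normr_nat -[leLHS]mulr1 ler_wpM2l.
pose fl (i : nat) : nat := Num.truncn (i%:R * alpha).
have flP i : (fl i)%:R <= i%:R * alpha < (fl i).+1%:R.
  by apply: truncn_itv; rewrite mulr_ge0.
pose cell (i : nat) : nat := Num.truncn ((i%:R * alpha - (fl i)%:R) * N.+1%:R).
have cellP i : (cell i)%:R <= (i%:R * alpha - (fl i)%:R) * N.+1%:R < (cell i).+1%:R.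
  by apply: truncn_itv; rewrite mulr_ge0 // subr_ge0; case/andP: (flP i).
have cellN i : (cell i < N.+1)%N.
  rewrite -(ltr_nat R); case/andP: (cellP i) => h _; apply: le_lt_trans h _.
  case/andP: (flP i) => _; rewrite -natr1 => h.
  by rewrite -[ltRHS]mul1r ltr_pM2r // ltrBlDl.
pose f (i : 'I_N.+1) : 'I_N.+1 := Ordinal (cellN i).
case: (boolP (injectiveb f)) => [/injectiveP finj|].
  have [i fi] : exists i, f i = ord_max.
    by have [g _ gf] := injF_bij finj; exists (g ord_max); rewrite gf.
  have iN : cell i = N by rewrite -[LHS]/(val (f i)) fi.
  have i0 : (0 < i)%N.
    rewrite lt0n; apply/negP => /eqP i0; move: iN N0.
    by rewrite /cell /fl i0 mul0r truncn0 subrr mul0r truncn0 => <-.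
  exists i, (fl i).+1; split => //; first by rewrite -ltnS ltn_ord.
    rewrite -(ltr_nat R); case/andP: (flP i) => h _; apply: le_lt_trans h _.
    by rewrite -[ltRHS]mulr1 ltr_pM2l ?ltr0n.
  apply: le_trans NQV.
  case/andP: (flP i) => h1 h2; case/andP: (cellP i); rewrite iN => h3 _.
  rewrite ler0_norm ?subr_le0 ?(ltW h2) // opprB -(ler_pM2r N1p) mulVf ?lt0r_neq0 //.
  rewrite -natr1 mulrBl mulrDl mul1r -[X in _ + X - _]natr1.
  by rewrite mulrBl in h3; lra.
move=> /injectivePn [i [j ij fij]].
wlog lij : i j ij fij / (i < j)%N.
  move=> h; case: (ltngtP i j) => lij; first exact: (h i j).
    by apply: (h j i) => //; rewrite eq_sym.
  by move/val_inj: lij ij => ->; rewrite eqxx.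
have cij : cell i = cell j by rewrite -[LHS]/(val (f i)) fij.
have flm : (fl i <= fl j)%N by apply: le_truncn; rewrite ler_wpM2r // ler_nat ltnW.
have hlt : `|(j%:R - i%:R) * alpha - ((fl j)%:R - (fl i)%:R)| < N.+1%:R^-1.
  case/andP: (cellP i) => h1 h2; case/andP: (cellP j); rewrite -cij => h3 h4.
  rewrite -(ltr_pM2r N1p) mulVf ?lt0r_neq0 // -[X in _ * X < _](ger0_norm (ltW N1p)) -normrM.
  rewrite -natr1 in h2 h4.
  rewrite !mulrBl in h1 h2 h3 h4 *; rewrite ltr_norml; apply/andP; split; lra.
exists (j - i)%N, (fl j - fl i)%N; split.
- by rewrite subn_gt0.
- by rewrite (leq_trans (leq_subr _ _)) // -ltnS ltn_ord.
- have h : ((fl j - fl i)%:R : R) < (j - i).+1%:R.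
    rewrite -natr1 !natrB ?(ltnW lij) //.
    have : (N.+1%:R : R)^-1 <= 1 by rewrite invf_le1 // ler1n.
    have ji : (0 : R) <= j%:R - i%:R by rewrite subr_ge0 ler_nat ltnW.
    move: hlt; rewrite ltr_norml => /andP[hl _]; move: hl.
    have : (j%:R - i%:R) * alpha <= j%:R - i%:R by rewrite -[leRHS]mulr1 ler_wpM2l // ltW.
    move: (N.+1%:R^-1) ((j%:R - i%:R) * alpha) => x y; lra.
  by rewrite ltr_nat ltnS in h.
- by rewrite !natrB ?(ltnW lij) //; apply: ltW; apply: lt_le_trans NQV.
Qed.

End WeylSmooth.

Lemma le_expn (R : realType) (n : nat) (x y : R) : 0 <= x -> x <= y -> x ^+ n <= y ^+ n.
Proof. by move=> x0 xy; apply: lerXn2r; rewrite // nnegrE // (le_trans x0). Qed.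

(* [Q = S ^ k] and [V = P / Q ^ (2 / k)]; [W] stands
   for a small power of [P] absorbing constants, logarithms and smoothness bounds. *)
Section MinorPointwise.
Variable R : realType.
Variables (k w : nat) (P Rb W S Q' : R) (c1 e tau : R).
Local Notation Q := (S ^+ k).
Local Notation V := (P / S ^+ 2).
Hypotheses (k0 : (0 < k)%N) (w0 : (0 < w)%N).
Hypotheses (P1 : 1 <= P) (W4 : 4 <= W) (wW : w%:R <= W) (S1 : 1 <= S) (SP : S ^+ 2 <= P).
Hypotheses (Rb1 : 1 <= Rb) (RbW : Rb <= W).
Hypotheses (QW : 2 * W ^+ k.+1 <= Q) (QQ' : Q <= Q') (Q'W : Q' <= Q * W).
Hypothesis HE : energy R k w (smooth (S * W) Rb) <= W `^ c1 * (S * W) `^ e.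
Hypothesis Hln : forall n : nat, n%:R <= W ^+ 2 * P ^+ k.+1 -> 2 + ln n%:R <= W.
Hypotheses (c10 : 0 <= c1) (e0 : 0 <= e) (tau2 : tau <= 2^-1).
Hypothesis tauE : 4 * w%:R ^+ 2 * (1 - tau) = 4 * w%:R ^+ 2 - 4 * w%:R + 2 * e + k%:R.

Let W0 : 0 < W. Proof. exact: lt_le_trans W4. Qed.
Let W1 : 1 <= W. Proof. by apply: le_trans W4; rewrite ler1n. Qed.
Let S0 : 0 < S. Proof. exact: lt_le_trans S1. Qed.
Let P0 : 0 < P. Proof. exact: lt_le_trans P1. Qed.
Ltac basic := have ? := W4; have ? := S1; have ? := P1; have ? := Rb1; have ? := RbW;
  have ? := tau2.
Let Q0 : 0 < Q. Proof. exact: exprn_gt0. Qed.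
Let Q1 : 1 <= Q. Proof. exact: exprn_ege1. Qed.
Let V1 : 1 <= V. Proof. by rewrite ler_pdivlMr ?exprn_gt0 // mul1r. Qed.

Let SleP : S <= P.
Proof. by apply: le_trans SP; rewrite -[leLHS]expr1 ler_weXn2l. Qed.

Let QP : Q <= P ^+ k.
Proof. by apply: le_expn SleP; exact: ltW. Qed.

Lemma expPk : P ^+ k = V ^+ k * Q ^+ 2.
Proof. by rewrite exprAC -exprMn divfK // expf_neq0 // gt_eqF. Qed.

(** The parameters for [minor_spacing]: L keeps L v^k Q' / P^k below 1/2 for all v <= V W, and
    [lambda] keeps q [lambda] below 1/2 for q <= Q W. Up to powers of W, the numbers L, 1 / [lambda]
    and H are all of size Q, and so is the large-sieve constant in [K_le]. *)
Let L := Num.truncn (Q / (2 * W ^+ k.+1)).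
Let lambda := (2 * Q * W)^-1.
Let J := (Num.truncn (2 * Q * W)).+1.
Let A := Num.truncn (S * W).
Let H := (w * A ^ k).+1.

Let SW0 : 0 < S * W. Proof. exact: mulr_gt0. Qed.
Let AE : (A%:R : R) <= S * W. Proof. by rewrite truncn_le ltW. Qed.

Let L0 : (0 < L)%N.
Proof. by rewrite truncn_gt0 ler_pdivlMr ?mul1r // mulr_gt0 ?exprn_gt0. Qed.

Let LQ : L%:R <= Q / (2 * W ^+ k.+1).
Proof. by rewrite truncn_le divr_ge0 ?mulr_ge0 ?exprn_ge0 // ltW. Qed.

Let L2 : Q <= L%:R * (4 * W ^+ k.+1).
Proof.
basic.
have h : Q / (2 * W ^+ k.+1) < L.+1%:R by apply: truncnS_gt.
rewrite ltr_pdivrMr ?mulr_gt0 ?exprn_gt0 // in h.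
have l1 : 1 <= (L%:R : R) by rewrite ler1n.
have w1 : 0 < W ^+ k.+1 by rewrite exprn_gt0.
rewrite -natr1 in h; apply: le_trans (ltW h) _; nra.
Qed.

Let lambda0 : 0 < lambda.
Proof. by rewrite invr_gt0 !mulr_gt0. Qed.

Let QW0 : 0 <= 2 * Q * W. Proof. by rewrite !mulr_ge0 // ltW. Qed.

Let Jl : 1 <= J%:R * lambda.
Proof.
by rewrite /lambda ler_pdivlMr ?mul1r ?mulr_gt0 // ltW // truncnS_gt.
Qed.

Let lnJ : 1 + ln J%:R <= W.
Proof.
basic.
suff : J%:R <= W ^+ 2 * P ^+ k.+1 by move/Hln; lra.
rewrite /J -natr1.
have h : (Num.truncn (2 * Q * W))%:R <= 2 * Q * W by rewrite truncn_le.
have p1 : 1 <= P ^+ k by exact: exprn_ege1.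
have p2 : P ^+ k <= P ^+ k.+1 by rewrite exprS ler_peMl // exprn_ge0 // ltW.
have h2 : 2 * Q * W + 1 <= 3 * (Q * W).
  have : 1 <= Q * W by rewrite mulr_ege1.
  by lra.
have h3 : Q * W <= P ^+ k.+1 * W by rewrite ler_pM2r // (le_trans QP).
have : 3 * (P ^+ k.+1 * W) <= W ^+ 2 * P ^+ k.+1.
  rewrite expr2 -mulrA [P ^+ _ * W]mulrC ler_wpM2r //; last by lra.
  by rewrite mulr_ge0 ?exprn_ge0 // ltW.
by lra.
Qed.

Let lnA : 2 + ln A.+1%:R <= W.
Proof.
basic.
apply: Hln; rewrite -natr1.
have p2 : P <= P ^+ k.+1 by rewrite -[leLHS]expr1 ler_weXn2l.
have h3 : S * W <= P ^+ k.+1 * W by rewrite ler_pM2r // (le_trans SleP).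
have h2 : S * W + 1 <= 2 * (S * W).
  have : 1 <= S * W by rewrite mulr_ege1.
  by lra.
have : 2 * (P ^+ k.+1 * W) <= W ^+ 2 * P ^+ k.+1.
  rewrite expr2 -mulrA [P ^+ _ * W]mulrC ler_wpM2r //; last by lra.
  by rewrite mulr_ge0 ?exprn_ge0 // ltW.
by have := AE; lra.
Qed.

Let HH : (H%:R : R) <= 2 * W ^+ k.+1 * Q.
Proof.
basic.
rewrite /H -natr1 natrM natrX.
have h : (A%:R : R) ^+ k <= (S * W) ^+ k by apply: le_expn.
have h2 : w%:R * (A%:R : R) ^+ k <= W * (S * W) ^+ k by rewrite ler_pM ?exprn_ge0.
have h3 : 1 <= W * (S * W) ^+ k by rewrite mulr_ege1 // exprn_ege1 // mulr_ege1.
have -> : 2 * W ^+ k.+1 * Q = 2 * (W * (S * W) ^+ k) by rewrite exprMn exprS; ring.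
lra.
Qed.

Let K_le : (H %/ L).+1%:R * (2 * (H%:R + lambda^-1 * (1 + ln J%:R))) <= W ^+ (3 * k + 8) * Q.
Proof.
basic.
have w1 : 0 < W ^+ k.+1 by rewrite exprn_gt0.
have w1' : 1 <= W ^+ k.+1 by rewrite exprn_ege1.
have W16 : 16 <= W ^+ 2 by rewrite expr2; nra.
have L0' : 0 < (L%:R : R) by rewrite ltr0n.
have h1 : ((H %/ L)%:R : R) <= 8 * (W ^+ k.+1) ^+ 2.
  apply: (@le_trans _ _ (H%:R / L%:R)).
    by rewrite ler_pdivlMr // -natrM ler_nat leq_trunc_div.
  rewrite ler_pdivrMr //; apply: le_trans HH _.
  apply: le_trans (ler_wpM2l _ L2) _; first by rewrite mulr_ge0 // ltW.
  by rewrite le_eqVlt; apply/orP; left; apply/eqP; ring.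
have h2 : (H %/ L).+1%:R <= W ^+ (2 * k + 4).
  rewrite -natr1 (_ : (2 * k + 4 = k.+1 * 2 + 2)%N); last by clear; lia.
  rewrite exprD exprM.
  have : 1 <= (W ^+ k.+1) ^+ 2 by rewrite exprn_ege1.
  nra.
have h3 : 2 * (H%:R + lambda^-1 * (1 + ln J%:R)) <= W ^+ (k + 4) * Q.
  rewrite /lambda invrK.
  have i1 : 2 * Q * W * (1 + ln J%:R) <= 2 * Q * W * W by rewrite ler_wpM2l.
  have i2 : 2 * Q * W * W <= 2 * W ^+ k.+1 * Q * W.
    have : W <= W ^+ k.+1 by rewrite -[leLHS]expr1 ler_weXn2l.
    by move=> h; rewrite ler_pM2r // [2 * Q * W]mulrAC ler_pM2r // ler_pM2l.
  have i3 : 2 * W ^+ k.+1 * Q <= 2 * W ^+ k.+1 * Q * W.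
    by rewrite ler_peMr // !mulr_ge0 // ltW.
  apply: (@le_trans _ _ (8 * (W ^+ k.+1 * Q * W))); first by have := HH; lra.
  rewrite (_ : (k + 4 = k.+1 + 3)%N); last by clear; lia.
  rewrite exprD -mulrA [leRHS]mulrAC -mulrA [8 * _]mulrC.
  have -> : W ^+ k.+1 * (Q * W) * 8 = W ^+ k.+1 * Q * (W * 8) by ring.
  rewrite [leRHS]mulrA ler_wpM2l ?mulr_ge0 ?(ltW w1) ?(ltW Q0) //.
  by rewrite exprS ler_wpM2l ?(ltW W0) //; lra.
rewrite (_ : (3 * k + 8 = 2 * k + 4 + (k + 4))%N); last by clear; lia.
rewrite exprD -mulrA; apply: ler_pM => //.
have lnJ0 : 0 <= ln (J%:R : R) by rewrite ln_ge0 // ler1n.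
by rewrite mulr_ge0 // addr_ge0 // mulr_ge0 ?invr_ge0 ?(ltW lambda0) // addr_ge0.
Qed.

(** Large enough to collect the powers of W on the left of [HM] without dividing by 2 w^2; all that
    matters is that it depends on neither P nor Q. *)
Let n1 : R := 4 * w%:R ^+ 2 + 2 * c1 + 2 * e + 3 * k%:R + 8.

Let w1 : 1 <= (w%:R : R). Proof. by rewrite ler1n. Qed.

Let HM : (A%:R * A%:R) ^+ (2 * (w * w.-1)) *
    energy R k w (pnats [pred p | (p <= Num.truncn Rb)%N] A) *
    energy R k w (pnats [pred p | (p <= Num.truncn Rb)%N] A) *
    (((w * A ^ k).+1 %/ L).+1%:R *
      (2 * ((w * A ^ k).+1%:R + lambda^-1 * (1 + ln J%:R)))) <=
    (W `^ n1 * (S ^+ 2) `^ (1 - tau)) ^+ (2 * (w * w)).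
Proof.
basic.
have -> : pnats [pred p | (p <= Num.truncn Rb)%N] A = smooth (S * W) Rb.
  rewrite smoothE; apply: eq_filter => d; apply: eq_pnat => p.
  by rewrite !inE truncn_ge_nat //; lra.
have en0 : 0 <= energy R k w (smooth (S * W) Rb) by apply: sumr_ge0 => m _; exact: sqr_ge0.
have B0 : 0 <= W `^ c1 * (S * W) `^ e by rewrite mulr_ge0 ?powR_ge0.
set E := energy _ _ _ _ in en0 *.
have K0 : 0 <= 2 * ((w * A ^ k).+1%:R + lambda^-1 * (1 + ln J%:R)).
  have lnJ0 : 0 <= ln (J%:R : R) by rewrite ln_ge0 // ler1n.
  by rewrite mulr_ge0 // addr_ge0 // mulr_ge0 ?invr_ge0 ?(ltW lambda0) // addr_ge0.
apply: (@le_trans _ _ ((S * W * (S * W)) ^+ (2 * (w * w.-1)) *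
   (W `^ c1 * (S * W) `^ e) * (W `^ c1 * (S * W) `^ e) * (W ^+ (3 * k + 8) * Q))).
  apply: ler_pM; [ | by rewrite mulr_ge0 | | exact: K_le].
    by rewrite !mulr_ge0 // exprn_ge0 // mulr_ge0.
  apply: ler_pM => //; first by rewrite mulr_ge0 // exprn_ge0 // mulr_ge0.
  apply: ler_pM => //.
  by apply: le_expn; rewrite ?mulr_ge0 // ler_pM.
have SWn : S * W != 0 by rewrite gt_eqF.
have pw (x : R) (n : nat) : 0 < x -> x ^+ n = x `^ n%:R by move=> x0; rewrite powR_mulrn // ltW.
have aD (x a b : R) : 0 < x -> x `^ a * x `^ b = x `^ (a + b).
  by move=> x0; rewrite powRD // (gt_eqF x0) implybT.
rewrite -expr2 -exprM !pw ?mulr_gt0 ?powR_gt0 ?exprn_gt0 //.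
rewrite [leRHS]powRM ?powR_ge0 // -!powRrM.
rewrite !(powRM _ (ltW S0) (ltW W0)).
set a1 := (_ * _)%:R; set a2 := (3 * k + 8)%:R.
rewrite (_ : _ * _ = S `^ (a1 + e + e + k%:R) * W `^ (a1 + c1 + e + c1 + e + a2)); last first.
  by rewrite -!aD //; ring.
have a1E : a1 = 4 * w%:R ^+ 2 - 4 * w%:R.
  rewrite /a1 !natrM -[w in w.-1]prednK // /= -subn1 natrB //; ring.
rewrite mulrC; apply: ler_pM; rewrite ?powR_ge0 //.
  apply: ler_powR => //; rewrite a1E /a2 /n1 !natrM natrD natrM.
  have ww : 1 <= (w%:R : R) * w%:R by rewrite mulr_ege1.
  pose z : R := 2 * c1 + 2 * e + 3 * k%:R + 8.
  have z0 : 0 <= z by rewrite /z !addr_ge0 // mulr_ge0.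
  have -> : 4 * w%:R ^+ 2 + 2 * c1 + 2 * e + 3 * k%:R + 8 = 4 * w%:R ^+ 2 + z by rewrite /z; ring.
  have -> : 4 * w%:R ^+ 2 - 4 * w%:R + c1 + e + c1 + e + (3 * k%:R + 8) =
     4 * (w%:R * w%:R) - 4 * w%:R + z by rewrite /z; ring.
  have w1' := w1; apply: (@le_trans _ _ (4 * w%:R ^+ 2 + z)); first by rewrite expr2; lra.
  by rewrite ler_peMr ?addr_ge0 ?mulr_ge0 ?exprn_ge0 //; lra.
(* The exponents of S agree exactly: this is the identity [tauE]. *)
rewrite le_eqVlt; apply/orP; left; apply/eqP; congr (_ `^ _).
rewrite a1E !natrM.
have -> : 2 * ((1 - tau) * (2 * (w%:R * w%:R))) = 4 * w%:R ^+ 2 * (1 - tau) by ring.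
by rewrite tauE; ring.
Qed.

(** [smooth_weyl] is applied to v^k alpha with [Y1] the integer part of S: as z <= P / V = S^2, both
    factors of z stay below S W. *)
Lemma minor_pointwise (q a v : nat) (pi : nat_pred) (alpha : R) :
  (0 < q)%N -> q%:R <= Q' -> coprime a q -> coprime v q ->
  `|q%:R * alpha - a%:R| <= Q' / P ^+ k ->
  (q%:R <= Q -> Q / P ^+ k < `|q%:R * alpha - a%:R|) ->
  V <= v%:R <= V * W -> (forall p, p \in pi -> p%:R <= Rb) ->
  cabs (\sum_(z <- pnats pi (Num.truncn P %/ v)) expi ((v ^ k)%:R * alpha * (z ^ k)%:R)) <=
  W `^ (n1 + 4) * (S ^+ 2) `^ (1 - tau).
Proof.
basic.
move=> q0 qQ' aq vq qk qQ /andP[Vv vVW] piR.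
have V0 : 0 < V := lt_le_trans ltr01 V1.
have v0 : (0 < v)%N by rewrite -(ltr_nat R); lra.
have Pk0 : 0 < P ^+ k by exact: exprn_gt0.
have Q'0 : 0 <= Q' := le_trans (ltW Q0) QQ'.
have vk1 : V ^+ k <= (v ^ k)%:R by rewrite natrX; apply: le_expn (ltW V0) Vv.
have vk2 : (v ^ k)%:R <= (V * W) ^+ k by rewrite natrX; apply: le_expn vVW.
have Vk0 : 0 < V ^+ k by exact: exprn_gt0.
have wk0 : 0 < W ^+ k.+1 by exact: exprn_gt0.
have wk1 : 1 <= W ^+ k.+1 by exact: exprn_ege1.
have cvq : coprime (v ^ k) q by rewrite coprimeXl.
have sp := @minor_spacing R q a (v ^ k)%N L alpha (Q' / P ^+ k) (Q / P ^+ k) lambda Q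
  q0 aq cvq qk qQ.
have {}sp := sp _ _ _ _ _.
set Y1 := Num.truncn S.
have Y10 : (0 < Y1)%N by rewrite truncn_gt0.
have Y1S : (Y1%:R : R) <= S by rewrite truncn_le ltW.
have M0 : 0 <= W `^ n1 * (S ^+ 2) `^ (1 - tau) by rewrite mulr_ge0 ?powR_ge0.
have h := @smooth_weyl R k w (Num.truncn P %/ v)%N Y1 A (Num.truncn Rb) L J pi
  ((v ^ k)%:R * alpha) lambda (W `^ n1 * (S ^+ 2) `^ (1 - tau)) w0 Y10 L0 lambda0 Jl.
apply: le_trans (h _ _ _ _ M0 _) _.
- apply: sp => //.
  + apply: le_trans LQ _; rewrite ler_pdivrMr ?mulr_gt0 //.
    by rewrite ler_peMr ?(ltW Q0) //; lra.
  + apply: (@le_trans _ _ (Q / (2 * W ^+ k.+1) * ((V * W) ^+ k * (Q * W / P ^+ k)))).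
      rewrite ler_pM ?mulr_ge0 ?divr_ge0 ?(ltW Pk0) //; first by rewrite invr_ge0 ltW.
      by rewrite ler_pM ?divr_ge0 ?(ltW Pk0) ?ler_pM2r ?invr_gt0.
    rewrite expPk exprMn exprS le_eqVlt; apply/orP; left; apply/eqP.
    by field; rewrite !gt_eqF //= ?exprn_gt0.
  + rewrite /lambda ler_pdivrMr ?mulr_gt0 //.
    by apply: le_trans qQ' _; apply: le_trans Q'W _; lra.
  + by rewrite expn_gt0 v0.
  + apply: (@le_trans _ _ (V ^+ k * (Q / P ^+ k))); last first.
      by rewrite ler_wpM2r // divr_ge0 ?(ltW Q0) ?(ltW Pk0).
    rewrite expPk (_ : V ^+ k * _ = Q^-1); last first.
      by field; rewrite !gt_eqF.
    rewrite /lambda lef_pV2 ?posrE ?mulr_gt0 // -mulrA mulrC -mulrA ler_peMr ?(ltW Q0) //; lra.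
- by move=> p /piR; rewrite truncn_ge_nat //; lra.
- rewrite truncn_ge_nat ?(ltW SW0) // natrM ler_pM //.
  by apply: le_trans RbW; rewrite truncn_le; lra.
- rewrite truncn_ge_nat ?(ltW SW0) //.
  apply: (@le_trans _ _ S); last by rewrite ler_peMr ?(ltW S0).
  have SY : S < Y1.+1%:R by apply: truncnS_gt.
  have y0 : 0 < (Y1.+1%:R : R) by [].
  apply: (@le_trans _ _ ((Num.truncn P %/ v)%N%:R / Y1.+1%:R)).
    by rewrite ler_pdivlMr // -natrM ler_nat leq_trunc_div.
  rewrite ler_pdivrMr //; apply: (@le_trans _ _ (S * S)); last by rewrite ler_wpM2l ?(ltW S0) // ltW.
  have v0' : 0 < (v%:R : R) by lra.
  apply: (@le_trans _ _ (P / v%:R)).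
    rewrite ler_pdivlMr // -natrM; apply: le_trans (_ : (Num.truncn P)%:R <= _).
      by rewrite ler_nat leq_trunc_div.
    by rewrite truncn_le ltW.
  rewrite ler_pdivrMr // -expr2 mulrC -ler_pdivrMr ?exprn_gt0 //.
- exact: HM.
set M := W `^ n1 * _ in M0 *.
(* The trivially bounded z number at most S = X^(1/2), which is admissible because tau <= 1/2. *)
have X1 : S <= (S ^+ 2) `^ (1 - tau).
  rewrite -powR_mulrn ?(ltW S0) // -powRrM -[leLHS]powRr1 ?(ltW S0) //.
  by apply: ler_powR => //; lra.
have n10 : 0 <= n1.
  by rewrite /n1 !addr_ge0 // mulr_ge0 // exprn_ge0.
have MS : S <= M.
  apply: le_trans X1 _; rewrite ler_peMl ?powR_ge0 //.
  by rewrite -[leLHS](powRr0 W) ler_powR.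
have R2 : (Num.truncn Rb).+1%:R <= 2 * W.
  rewrite -natr1; have : (Num.truncn Rb)%:R <= Rb by rewrite truncn_le; lra.
  by lra.
have lnA0 : 0 <= 2 + ln (A.+1%:R : R) by rewrite addr_ge0 // ln_ge0 // ler1n.
have t1 : (Num.truncn Rb).+1%:R * (2 * (2 + ln A.+1%:R) * M) <= 2 * W * (2 * W * M).
  apply: ler_pM; rewrite ?(mulr_ge0 _ M0) ?mulr_ge0 //.
  by rewrite ler_wpM2r // ler_wpM2l.
apply: le_trans (lerD (le_trans Y1S MS) t1) _.
rewrite powRD ?(gt_eqF W0) ?implybT // -[W `^ 4]/(W `^ 4%:R) powR_mulrn ?(ltW W0) //.
have -> : W `^ n1 * W ^+ 4 * (S ^+ 2) `^ (1 - tau) = W * W * (W * W) * M by rewrite /M; ring.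
have -> : M + 2 * W * (2 * W * M) = (1 + 4 * (W * W)) * M by ring.
rewrite ler_wpM2r //.
have h16 : 16 <= W * W by nra.
nra.
Qed.

End MinorPointwise.

(** * Integral over a layer of arcs *)

Section Decomposition.
Variable R : realType.

Lemma le_sum_subset (I : eqType) (s s' : seq I) (F : I -> R) : uniq s ->
  {subset s <= s'} -> (forall i, 0 <= F i) ->
  \sum_(i <- s) F i <= \sum_(i <- s') F i.
Proof.
move=> us ss' F0.
apply: (@le_trans _ _ (\sum_(i <- undup s') F i)).
  have ps : perm_eq (undup s') (s ++ [seq i <- undup s' | i \notin s]).
    apply: uniq_perm; first exact: undup_uniq.
      rewrite cat_uniq us filter_uniq ?undup_uniq //= andbT.
      by apply/hasPn => j; rewrite mem_filter => /andP[].
    move=> i; rewrite mem_cat mem_filter mem_undup.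
    by case: (boolP (i \in s)) => //= /ss' ->.
  by rewrite (perm_big _ ps) big_cat /= lerDl sumr_ge0.
elim: s' {ss'} => [|i s' IH] //=; rewrite [leRHS]big_cons; case: ifP => _.
  by apply: le_trans IH _; rewrite lerDr.
by rewrite big_cons lerD2l.
Qed.

(** Such an x is determined by its part prime to q, at most V, and its part composed of primes of
    q. *)
Lemma size_small_part (N V q : nat) (pi : nat_pred) :
  (count (fun x => x`_(\pi(q)^') <= V)%N (pnats pi N) <= V * size (pnats \pi(q) N))%N.
Proof.
rewrite -size_filter -[X in (_ <= X * _)%N](size_iota 1) -(size_allpairs muln).
apply: uniq_leq_size; first by rewrite filter_uniq // pnats_uniq.
move=> x; rewrite mem_filter mem_pnats => /and3P[xV px xN].
have x0 : (0 < x)%N by case/andP: px.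
rewrite -[x](partnC \pi(q)^' x0); apply: allpairs_f.
  by rewrite mem_iota part_gt0 add1n ltnS.
rewrite mem_pnats; apply/andP; split.
  by rewrite -(eq_pnat _ (negnK _)) part_pnat.
by apply: leq_trans xN; apply: dvdn_leq => //; apply: dvdn_part.
Qed.

Lemma truncn_div (P : R) (v : nat) : 0 <= P -> (0 < v)%N ->
  (Num.truncn P %/ v)%N = Num.truncn (P / v%:R).
Proof.
move=> P0 v0; have v0' : 0 < (v%:R : R) by rewrite ltr0n.
apply/esym/truncn_def; rewrite ler_pdivlMr // ltr_pdivrMr //.
have /andP[h1 h2] := truncn_itv P0.
rewrite -!natrM; apply/andP; split.
  by apply: le_trans h1; rewrite ler_nat leq_trunc_div.
by apply: lt_le_trans h2 _; rewrite ler_nat ltn_ceil.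
Qed.

Lemma absf_smooth_pow (k : nat) (P b : R) (m : nat) (alpha : R) :
  cabs (\sum_(y <- smooth P b) expi (alpha * ((m * y) ^ k)%:R)) =
  absf k P b ((m ^ k)%:R * alpha).
Proof.
rewrite absfE; congr cabs; apply: eq_bigr => y _; congr expi.
by rewrite expnMn natrM natrX [_ * alpha]mulrC mulrA natrX.
Qed.

(** Primes of z above [pdiv v] must divide q. Collecting them in d leaves y running over all
    [pdiv v]-smooth numbers, hence a genuine smooth sum; at most W values of d occur, so Hölder over
    d costs at most W^u. *)
Lemma fiber_bound (k N v q : nat) (P Rb W u alpha : R) (Xn : nat) :
  N = Num.truncn P -> 0 <= P -> (1 < v)%N -> (pdiv v)%:R <= Rb ->
  1 <= u -> 1 <= W -> (size (pnats \pi(q) N))%:R <= W -> (N %/ v <= Xn)%N ->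
  cabs (\sum_(z <- pnats (below [pred p : nat | (p%:R : R) <= Rb] \pi(q)^' (pdiv v)) (N %/ v))
     expi (alpha * ((v * z) ^ k)%:R)) `^ u <=
  W `^ u * \sum_(d <- iota 1 Xn)
    absf k (P / (v * d)%:R) (pdiv v)%:R (((v * d) ^ k)%:R * alpha) `^ u.
Proof.
move=> NE P0 v1 pR u1 W1 HN NX.
have v0 : (0 < v)%N by rewrite ltnW.
set b := pdiv v in pR *; set pi' := below _ _ _.
pose sig : nat_pred := [pred p | (b < p)%N].
rewrite (big_parts _ pi' sig).
set D := pnats [predI pi' & sig] (N %/ v).
pose F (d : nat) := absf k (P / (v * d)%:R) b%:R (((v * d) ^ k)%:R * alpha).
have F0 d : 0 <= F d by apply: absf_ge0.
have u0 : 0 <= u by apply: le_trans u1.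
have DE : cabs (\sum_(d <- D) \sum_(y <- pnats [predI pi' & sig^'] (N %/ v %/ d))
    expi (alpha * ((v * (d * y)) ^ k)%:R)) <= \sum_(d <- D) F d.
  apply: le_trans (cabs_sum _ _ _) _; apply: le_sum_seq => d; rewrite mem_pnats => /andP[pd _] _.
  have d0 : (0 < d)%N by case/andP: pd.
  rewrite le_eqVlt; apply/orP; left; apply/eqP; rewrite /F -absf_smooth_pow.
  rewrite smoothE -truncn_div ?muln_gt0 ?v0 // -NE divnMA.
  under [in LHS]eq_bigr do rewrite mulnA.
  congr cabs; apply: congr_big => //; apply: eq_filter => y; apply: eq_pnat => p.
  rewrite !inE /= ler_nat -leqNgt.
  case: (leqP p b) => pb; rewrite ?orbT ?andbT ?andbF //.
  by apply: le_trans pR; rewrite ler_nat.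
apply: le_trans (le_powRl u0 (cabs_ge0 _) DE) _.
apply: le_trans (powR_mean1 _ u1 F0) _.
have sD : (size D)%:R <= W.
  apply: le_trans HN; rewrite ler_nat; apply: uniq_leq_size; first exact: pnats_uniq.
  apply: subset_pnats; last exact: leq_div.
  move=> p; rewrite !inE /= => /andP[/andP[_ h] bp].
  by move: h; rewrite leqNgt bp orbF negbK.
apply: ler_pM; rewrite ?powR_ge0 //.
- by apply: sumr_ge0 => d _; exact: powR_ge0.
- apply: (@le_trans _ _ (W `^ (u - 1))).
    by apply: le_powRl; rewrite ?ler0n // subr_ge0.
  by apply: ler_powR => //; rewrite gerBl.
- apply: (@le_sum_subset _ _ _ (fun d => F d `^ u)); first exact: pnats_uniq.
    move=> d; rewrite mem_pnats mem_iota add1n ltnS => /andP[/andP[d0 _] dN].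
    by rewrite d0 (leq_trans dN).
  by move=> d; exact: powR_ge0.
Qed.

(** After Hölder over v, each |G_v|^s is split as |G_v|^t |G_v|^u: the first factor is bounded
    pointwise by B^t, the second is kept for the mean value. *)
Lemma absf_decomp (k q : nat) (P Rb W V X u t s B alpha : R) :
  (0 < q)%N -> 1 <= V -> 1 <= X -> P = V * X -> Rb <= W -> 1 <= W ->
  1 <= u -> 0 <= t -> s = t + u -> 0 <= B ->
  (size (pnats \pi(q) (Num.truncn P)))%:R <= W ->
  (forall (v : nat) (pi : nat_pred), coprime v q -> V <= v%:R <= V * W ->
     (forall p, p \in pi -> p%:R <= Rb) ->
     cabs (\sum_(z <- pnats pi (Num.truncn P %/ v))
       expi ((v ^ k)%:R * alpha * (z ^ k)%:R)) <= B) ->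
  absf k P Rb alpha `^ s <=
  2 `^ s * ((V * W) `^ s + (V * W) `^ (s - 1) * (B `^ t * (W `^ u *
    \sum_(v <- iota 1 (Num.truncn (V * W)) | [&& coprime v q, V <= v%:R & (pdiv v)%:R <= Rb])
      \sum_(d <- iota 1 (Num.truncn X))
        absf k (P / (v * d)%:R) (pdiv v)%:R (((v * d) ^ k)%:R * alpha) `^ u))).
Proof.
move=> q0 V1 X1 PE RW W1 u1 t0 sE B0 HN HB.
have V0 : 0 < V by lra. have X0 : 0 < X by lra.
have P0 : 0 <= P by rewrite PE mulr_ge0 // ltW.
have u0 : 0 <= u by lra. have s1 : 1 <= s by lra. have s0 : 0 <= s by lra.
set N := Num.truncn P in HN HB *; set Vn := Num.truncn V.
have Vn0 : (0 < Vn)%N by rewrite truncn_gt0.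
have VnV : (Vn%:R : R) <= V by rewrite truncn_le ltW.
have VnV' : V < Vn.+1%:R by apply: truncnS_gt.
have VW0 : 0 <= V * W by rewrite mulr_ge0; lra.
rewrite absfE smoothE -/N; set pi : nat_pred := [pred p | _].
under eq_bigr do rewrite -natrX.
rewrite (bigID (fun x => (Vn < x`_(\pi(q)^'))%N)) /= addrC big_cores //.
set E := (X in cabs (X + _)).
set vs := cores _ _ _.
pose G v := \sum_(z <- pnats (below pi \pi(q)^' (pdiv v)) (N %/ v))
     expi (alpha * ((v * z) ^ k)%:R).
have E1 : cabs E <= V * W.
  apply: le_trans (cabs_sum _ _ _) _.
  under eq_bigr do rewrite cabs_expi.
  rewrite big_const_seq iter_addr addr0.
  under eq_count do rewrite -leqNgt.
  apply: (@le_trans _ _ ((Vn * size (pnats \pi(q) N))%:R)).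
    by rewrite ler_nat size_small_part.
  by rewrite natrM ler_pM.
have vsP v : v \in vs -> [/\ (1 < v)%N, coprime v q, V <= v%:R, v%:R <= V * W & (pdiv v)%:R <= Rb].
  rewrite mem_filter mem_pnats pnatI => /andP[/andP[Vv vV] /andP[/andP[pv cv] _]].
  have v1 : (1 < v)%N := leq_ltn_trans Vn0 Vv.
  have v0 : (0 < v)%N := ltnW v1.
  have pR : (pdiv v)%:R <= Rb := pnatP _ v0 pv _ (pdiv_prime v1) (pdiv_dvd v).
  split=> //.
  - rewrite coprime_sym; apply: (@pnat_coprime \pi(q)) => //.
    by rewrite pnat_pi.
  - by apply: ltW; apply: lt_le_trans VnV' _; rewrite ler_nat.
  - rewrite -(divnK (pdiv_dvd v)) natrM ler_pM //.
      by apply: le_trans VnV; rewrite ler_nat.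
    by apply: le_trans RW.
have f1 : cabs (E + \sum_(v <- vs) G v) <= V * W + \sum_(v <- vs) cabs (G v).
  by apply: le_trans (cabsD _ _) _; rewrite lerD // cabs_sum.
apply: le_trans (le_powRl s0 (cabs_ge0 _) f1) _.
have G0 : 0 <= \sum_(v <- vs) cabs (G v) by apply: sumr_ge0 => v _; exact: cabs_ge0.
apply: le_trans (powRD_le s0 VW0 G0) _.
rewrite ler_wpM2l ?powR_ge0 // lerD2l.
apply: le_trans (powR_mean1 _ s1 (fun v => cabs_ge0 (G v))) _.
have uvs : uniq vs by rewrite filter_uniq // pnats_uniq.
have vsI : {subset vs <= iota 1 (Num.truncn (V * W))}.
  move=> v /vsP [v1 _ _ vVW _]; rewrite mem_iota ltnW // add1n ltnS truncn_ge_nat //.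
have svs : (size vs)%:R <= V * W.
  apply: (@le_trans _ _ (Num.truncn (V * W))%:R); last by rewrite truncn_le.
  by rewrite ler_nat -[leqRHS](size_iota 1) uniq_leq_size.
apply: ler_pM; rewrite ?powR_ge0 //.
- by apply: sumr_ge0 => v _; exact: powR_ge0.
- by apply: le_powRl; rewrite ?ler0n // subr_ge0.
pose FF v := \sum_(d <- iota 1 (Num.truncn X))
        absf k (P / (v * d)%:R) (pdiv v)%:R (((v * d) ^ k)%:R * alpha) `^ u.
have FF0 v : 0 <= FF v by apply: sumr_ge0 => d _; exact: powR_ge0.
apply: (@le_trans _ _ (\sum_(v <- vs) B `^ t * (W `^ u * FF v))).
  apply: le_sum_seq => v vin _; have [v1 cvq Vv vVW pR] := vsP v vin.
  rewrite sE powRD ?ler_wpM2l //; last first.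
    by apply/implyP => /eqP tu0; lra.
  apply: ler_pM; rewrite ?powR_ge0 //.
    apply: le_powRl => //; first exact: cabs_ge0.
    apply: le_trans (HB v (below pi \pi(q)^' (pdiv v)) cvq _ _); last first.
    - by move=> p; rewrite inE /= => /andP[].
    - by rewrite Vv vVW.
    rewrite le_eqVlt; apply/orP; left; apply/eqP; congr cabs; apply: eq_bigr => z _.
    by congr expi; rewrite expnMn natrM mulrA [alpha * _]mulrC.
  apply: fiber_bound => //.
  rewrite truncn_div ?(ltnW v1) // le_truncn //.
  by rewrite PE ler_pdivrMr ?ltr0n ?(ltnW v1) // mulrC ler_wpM2l // ltW.
rewrite -!mulr_sumr ler_wpM2l ?powR_ge0 // ler_wpM2l ?powR_ge0 // -[leRHS]big_filter.
apply: le_sum_subset => // v vin; rewrite mem_filter vsI // andbT.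
by have [_ -> -> _ ->] := vsP v vin.
Qed.

End Decomposition.

(** * Bump functions on arcs and their overlaps *)

Section Arcs.
Variable R : realType.
Local Open Scope classical_set_scope.
Local Notation mu := (@lebesgue_measure R).

(** The positive part of 2 - |x| / kappa: a majorant of the indicator of |x| <= kappa which is
    continuous, so that the integral identities on [0, 1] apply. *)
Definition bump (kappa x : R) : R :=
  ((2 - `|x| / kappa) + `|2 - `|x| / kappa|) / 2.

Lemma bump_ge0 kappa x : 0 <= bump kappa x.
Proof. by rewrite /bump; have := ler_norm (- (2 - `|x| / kappa)); rewrite normrN; lra. Qed.

Lemma bump_ge1 kappa x : 0 < kappa -> `|x| <= kappa -> 1 <= bump kappa x.
Proof.
move=> k0 xk; have : `|x| / kappa <= 1 by rewrite ler_pdivrMr // mul1r.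
by rewrite /bump; have := ler_norm (2 - `|x| / kappa); lra.
Qed.

Lemma bump_le2 kappa x : 0 < kappa -> bump kappa x <= 2.
Proof.
move=> k0; have h : 0 <= `|x| / kappa by rewrite divr_ge0 // ltW.
rewrite /bump; have [h2|h2] := leP 0 (2 - `|x| / kappa); last by rewrite (ltr0_norm h2); lra.
by rewrite (ger0_norm h2); lra.
Qed.

Lemma bump_supp kappa x : 0 < kappa -> 2 * kappa < `|x| -> bump kappa x = 0.
Proof.
move=> k0 xk; have h : 2 < `|x| / kappa by rewrite ltr_pdivlMr.
have h2 : 2 - `|x| / kappa < 0 by lra.
by rewrite /bump (ltr0_norm h2); lra.
Qed.

Lemma continuous_bump kappa : continuous (bump kappa).
Proof.
have c1 : continuous (fun x : R => 2 - `|x| / kappa).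
  move=> x; apply: cvgB; first exact: cvg_cst.
  by apply: cvgM; [exact: norm_continuous | exact: cvg_cst].
move=> x; apply: cvgM; last exact: cvg_cst.
apply: cvgD; first exact: c1.
by apply: (@continuous_comp _ _ _ (fun x : R => 2 - `|x| / kappa) Num.norm);
  [exact: c1 | exact: norm_continuous].
Qed.

Lemma continuous_bump_affine kappa (q a : R) :
  continuous (fun x : R => bump kappa (q * x - a)).
Proof. exact: (@continuous_affine_comp R (bump kappa) q (- a) (@continuous_bump kappa)). Qed.

(** The height is at most 2 and the support has length 4 kappa / q. *)
Lemma I01_bump kappa (q a : nat) : 0 < kappa -> (0 < q)%N ->
  I01 (fun x => bump kappa (q%:R * x - a%:R)) <= 8 * kappa / q%:R.
Proof.
move=> k0 q0; have q0' : 0 < (q%:R : R) by rewrite ltr0n.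
set x1 := (a%:R - 2 * kappa) / q%:R; set x2 := (a%:R + 2 * kappa) / q%:R.
have x12 : x1 < x2 by rewrite ltr_pM2r ?invr_gt0 //; lra.
rewrite -lee_fin -I01E; last exact: continuous_bump_affine.
apply: (@le_trans _ _ (\int[mu]_(x in `[0%R, 1%R]) (2%:E * (\1_(`[x1, x2]) x)%:E))%E).
  apply: ge0_le_integral => //.
  - by move=> x _; rewrite lee_fin bump_ge0.
  - apply/measurable_EFinP; apply: measurable_funTS.
    by apply: continuous_measurable_fun; exact: continuous_bump_affine.
  - by apply: measurable_funTS; apply: measurable_funeM; apply/measurable_EFinP; exact: measurable_indic.
  move=> x _; rewrite -EFinM lee_fin indicE.
  case: (boolP (x \in _)) => [_|/negP xn]; first by rewrite mulr1 bump_le2.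
  rewrite mulr0 bump_supp //; rewrite ltNge; apply/negP => h; apply: xn.
  rewrite inE /= in_itv /= /x1 /x2 ler_pdivrMr // ler_pdivlMr //.
  by move: h; rewrite ler_norml => /andP[h1 h2]; apply/andP; split; lra.
rewrite ge0_integralZl //=; last first.
  by apply/measurable_EFinP; apply: measurable_funTS; exact: measurable_indic.
rewrite integral_indic //.
apply: (@le_trans _ _ (2%:E * mu `[x1, x2])%E).
  apply: lee_wpmul2l => //; apply: le_measure; rewrite ?inE //.
  exact: measurableI.
rewrite lebesgue_measure_itv /= lte_fin x12 -EFinB -EFinM lee_fin.
rewrite le_eqVlt; apply/orP; left; apply/eqP; rewrite /x1 /x2; field; exact: lt0r_neq0.
Qed.

(* For [m] coprime to [q], the numerators [a m - j q] with [j < m] and [a <= q] are distinct. *)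
Lemma bump_overlap (qs : seq nat) (m Qn : nat) (kappa beta : R) :
  uniq qs -> (0 < m)%N -> 0 < kappa ->
  (forall q, q \in qs -> [/\ (0 < q)%N, (q <= Qn)%N & coprime m q]) ->
  \sum_(j <- iota 0 m) \sum_(q <- qs) \sum_(a <- iota 0 q.+1 | coprime a q)
    bump kappa (q%:R * (m%:R^-1 * beta + j%:R / m%:R) - a%:R) <=
  2 * (4 * Qn%:R * (2 * kappa * m%:R) + 1).
Proof.
move=> uqs m0 k0 Hq.
have m0' : 0 < (m%:R : R) by rewrite ltr0n.
have mn := lt0r_neq0 m0'.
pose B (x : nat * nat * nat) := bump kappa (x.1.2%:R * (m%:R^-1 * beta + x.1.1%:R / m%:R) - x.2%:R).
pose T : seq (nat * nat * nat) := [seq (y, a) | y <- [seq (j, q) | j <- iota 0 m, q <- qs], a <- iota 0 y.2.+1].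
pose good (x : nat * nat * nat) := coprime x.2 x.1.2 && (`|x.1.2%:R * (m%:R^-1 * beta + x.1.1%:R / m%:R) - x.2%:R| <= 2 * kappa).
have uT : uniq T.
  apply: allpairs_uniq_dep; first by apply: allpairs_uniq => //; [exact: iota_uniq | move=> [? ?] [? ?]].
    by move=> y _; exact: iota_uniq.
  by move=> [? ?] [? ?] _ _ /= [-> ->].
have TP x : x \in T -> [/\ (x.1.1 < m)%N, x.1.2 \in qs & (x.2 <= x.1.2)%N].
  case/allpairsPdep => y [a [yT ya ->]]; rewrite mem_iota add0n ltnS in ya.
  case/allpairsP: yT ya => [[j q]] /= [jm qq ->] /= ya.
  by move: jm; rewrite mem_iota add0n.
have -> : \sum_(j <- iota 0 m) \sum_(q <- qs) \sum_(a <- iota 0 q.+1 | coprime a q)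
    bump kappa (q%:R * (m%:R^-1 * beta + j%:R / m%:R) - a%:R) = \sum_(x <- T | coprime x.2 x.1.2) B x.
  rewrite [RHS]big_mkcond big_allpairs_dep /= big_allpairs /=.
  by apply: eq_bigr => j _; apply: eq_bigr => q _; rewrite big_mkcond.
apply: (@le_trans _ _ (\sum_(x <- [seq x <- T | good x]) 2)).
  rewrite big_filter big_mkcond [leRHS]big_mkcond; apply: ler_sum => x _.
  rewrite /good; case: (coprime _ _) => //=; case: (leP `|_| (2 * kappa)) => h.
    exact: bump_le2.
  by rewrite /B bump_supp.
rewrite big_const_seq count_predT iter_addr addr0 -[2 *+ _]mulr_natr ler_wpM2l //.
(* Multiplication by m turns the approximations a / q of the shifted points into approximations of
   beta itself, of quality 2 kappa m, with numerators a m - q j still coprime to q; [size_approx]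
   counts them. *)
pose f (x : nat * nat * nat) : nat * int := (x.1.2, (x.2 * m)%:Z - (x.1.2 * x.1.1)%:Z).
have finj : {in [seq x <- T | good x] &, injective f}.
  move=> [[j q] a] [[j' q'] a']; rewrite !mem_filter => /andP[_ /TP /= [jm qq aq]] /andP[_ /TP /= [jm' _ aq']].
  rewrite /f /= => -[<- e].
  have [q0 _ cmq] := Hq q qq.
  have e1 : (a%:Z - a'%:Z) * m%:Z = q%:Z * (j%:Z - j'%:Z).
    rewrite mulrBl mulrBr -!PoszM; move: e.
    move: (a * m)%N (q * j)%N (a' * m)%N (q * j')%N => x1 x2 x3 x4; lia.
  have dv : (m%:Z %| (j%:Z - j'%:Z))%Z.
    have cz : coprimez m%:Z q%:Z by [].
    by rewrite -(Gauss_dvdzr _ cz) -e1 dvdz_mull.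
  have jj : j = j'.
    case/dvdzP: dv => c cE.
    have c0 : c = 0 by clear -jm jm' cE; nia.
    by rewrite c0 mul0r in cE; clear -cE; lia.
  rewrite -jj subrr mulr0 in e1; move/eqP: e1; rewrite mulf_eq0 => /orP[|/eqP]; last by clear -m0; lia.
  by rewrite subr_eq0 => /eqP [->]; rewrite jj.
rewrite -(size_map f).
apply: (@size_approx R beta (2 * kappa * m%:R) Qn); first by rewrite map_inj_in_uniq // filter_uniq.
  by rewrite !mulr_ge0 // ltW.
move=> y /mapP[[[j q] a] xin ->]; move: xin.
rewrite mem_filter => /andP[/andP[/= ca h] /TP /= [jm qq aq]].
have [q0 qQ cmq] := Hq q qq; split=> //.
  rewrite /coprimez /gcdz /=.
  have -> : ((a * m)%:Z - (q * j)%:Z) = (- (q%:Z * j%:Z) + (a * m)%:Z) by rewrite addrC PoszM.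
  change (coprimez q%:Z (- (q%:Z * j%:Z) + (a * m)%:Z)).
  have -> : - (q%:Z * j%:Z) + (a * m)%:Z = (- j%:Z) * q%:Z + (a * m)%:Z by ring.
  rewrite coprimez_sym /coprimez gcdzC gcdzMDl.
  by change (coprime q (a * m)); rewrite coprimeMr coprime_sym ca coprime_sym.
have -> : q%:R * beta - ((a * m)%:Z - (q * j)%:Z)%:~R =
   m%:R * (q%:R * (m%:R^-1 * beta + j%:R / m%:R) - a%:R) :> R.
  by rewrite intrB -!pmulrn !natrM; field.
rewrite normrM normr_nat mulrC ler_wpM2r //.
Qed.

(** At the points (x + j) / m the argument of g is d x modulo 1 whatever j is. So g factors out of
    the sum over j, and the bumps that remain are bounded pointwise by [bump_overlap]. *)
Lemma I01_arcs (qs : seq nat) (m d Qn : nat) (kappa : R) (g : R -> R) :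
  uniq qs -> (0 < m)%N -> (0 < d)%N -> 0 < kappa ->
  (forall q, q \in qs -> [/\ (0 < q)%N, (q <= Qn)%N & coprime m q]) ->
  continuous g -> (forall x, 0 <= g x) -> (forall x (n : nat), g (x + n%:R) = g x) ->
  I01 (fun x => (\sum_(q <- qs) \sum_(a <- iota 0 q.+1 | coprime a q)
      bump kappa (q%:R * x - a%:R)) * g ((m * d)%:R * x)) <=
  m%:R^-1 * (2 * (4 * Qn%:R * (2 * kappa * m%:R) + 1) * I01 g).
Proof.
move=> uqs m0 d0 k0 Hq cg g0 pg.
have m0' : 0 < (m%:R : R) by rewrite ltr0n.
have mn := lt0r_neq0 m0'.
have cmul (c : R) : continuous (fun x : R => g (c * x)).
  have := @continuous_affine_comp R g c 0 cg.
  by under eq_fun do rewrite addr0.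
have cn : continuous (fun x : R => \sum_(q <- qs) \sum_(a <- iota 0 q.+1 | coprime a q)
      bump kappa (q%:R * x - a%:R)).
  apply: continuous_sum_seq => q; apply: continuous_sum_seq => a.
  exact: continuous_bump_affine.
have cf : continuous (fun x : R => (\sum_(q <- qs) \sum_(a <- iota 0 q.+1 | coprime a q)
      bump kappa (q%:R * x - a%:R)) * g ((m * d)%:R * x)).
  by move=> x; apply: cvgM; [exact: cn | exact: cmul].
rewrite (I01_split cf m0) ler_wpM2l ?invr_ge0 //.
rewrite -I01_sum; last by move=> j; exact: (@continuous_affine_comp R _ _ _ cf).
rewrite -(I01_periodic cg d0 pg) -I01Z //.
apply: le_I01.
- by apply: continuous_sum_seq => j; exact: (@continuous_affine_comp R _ _ _ cf).
- by move=> x; apply: cvgM; [exact: cvg_cst | exact: cmul].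
move=> x; pose n (y : R) := \sum_(q <- qs) \sum_(a <- iota 0 q.+1 | coprime a q)
      bump kappa (q%:R * y - a%:R).
rewrite (eq_bigr (fun j => n (m%:R^-1 * x + j%:R / m%:R) * g (d%:R * x))); last first.
  move=> j _; congr (_ * _); rewrite -[RHS](pg _ (d * j)%N); congr g.
  by rewrite !natrM; field.
rewrite -mulr_suml ler_wpM2r //; exact: bump_overlap.
Qed.

End Arcs.

Lemma powRD_gt0 (R : realType) (x r s : R) : 0 < x -> x `^ (r + s) = x `^ r * x `^ s.
Proof. by move=> x0; rewrite powRD // (gt_eqF x0) implybT. Qed.

Lemma absf_periodic (R : realType) k (P Rb x : R) (n : nat) :
  absf k P Rb (x + n%:R) = absf k P Rb x.
Proof.
rewrite !absfE; congr cabs; apply: eq_bigr => y _.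
by rewrite mulrDl expiD -natrX -[n%:R * _]natrM expi_nat mulr1.
Qed.

Section Bumps.
Variable R : realType.

Definition bumps (kappa : R) (qs : seq nat) (x : R) : R :=
  \sum_(q <- qs) \sum_(a <- iota 0 q.+1 | coprime a q) bump kappa (q%:R * x - a%:R).

Lemma continuous_bumps kappa qs : continuous (bumps kappa qs).
Proof.
apply: continuous_sum_seq => q; apply: continuous_sum_seq => a.
exact: continuous_bump_affine.
Qed.

Lemma bumps_ge0 kappa qs x : 0 <= bumps kappa qs x.
Proof. by rewrite /bumps !sumr_ge0 // => q _; rewrite sumr_ge0 // => a _; exact: bump_ge0. Qed.

Lemma bumps_ge1 kappa qs x (q a : nat) : 0 < kappa -> q \in qs -> (a <= q)%N ->
  coprime a q -> `|q%:R * x - a%:R| <= kappa -> 1 <= bumps kappa qs x.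
Proof.
move=> k0 qqs aq caq h; rewrite /bumps (big_rem q) //=.
rewrite (big_rem (r := iota 0 q.+1) a); last by rewrite mem_iota add0n ltnS aq.
rewrite caq -addrA; apply: le_trans (bump_ge1 k0 h) _; rewrite lerDl addr_ge0 ?sumr_ge0 //.
  by move=> i _; exact: bump_ge0.
by move=> i _; rewrite sumr_ge0 // => j _; exact: bump_ge0.
Qed.

Lemma I01_bumps kappa (n : nat) : 0 < kappa ->
  I01 (bumps kappa (iota 1 n)) <= 16 * kappa * n%:R.
Proof.
move=> k0; rewrite /bumps I01_sum; last first.
  by move=> q; apply: continuous_sum_seq => a; exact: continuous_bump_affine.
apply: (@le_trans _ _ (\sum_(q <- iota 1 n) 16 * kappa)); last first.
  by rewrite big_const_seq count_predT size_iota iter_addr addr0 -[_ *+ n]mulr_natr.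
rewrite big_seq_cond [leRHS]big_seq_cond; apply: ler_sum => q; rewrite andbT mem_iota => /andP[q0 _].
have q0' : 0 < (q%:R : R) by rewrite ltr0n.
rewrite I01_sum; last by move=> a; exact: continuous_bump_affine.
apply: (@le_trans _ _ (\sum_(a <- iota 0 q.+1) 8 * kappa / q%:R)).
  rewrite big_mkcond; apply: ler_sum => a _; case: ifP => _; first exact: I01_bump.
  by rewrite divr_ge0 ?mulr_ge0 // ltW.
rewrite big_const_seq count_predT size_iota iter_addr addr0 -[_ *+ q.+1]mulr_natr.
rewrite mulrAC ler_pdivrMr // -natr1.
have q1 : 1 <= (q%:R : R) by rewrite ler1n.
by nra.
Qed.

End Bumps.

Section Piece.
Variable R : realType.
Local Notation mu := (@lebesgue_measure R).
Variables (k w : nat) (P Rb W S Q' c1 c2 e tau t u eu : R).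
Local Notation Q := (S ^+ k).
Local Notation V := (P / S ^+ 2).
Local Notation X := (S ^+ 2).
Local Notation s := (t + u).
Hypotheses (k0 : (0 < k)%N) (w0 : (0 < w)%N).
Hypotheses (P1 : 1 <= P) (W4 : 4 <= W) (wW : w%:R <= W) (S1 : 1 <= S) (SP : S ^+ 2 <= P).
Hypotheses (Rb1 : 1 <= Rb) (RbW : Rb <= W).
Hypotheses (QW : 2 * W ^+ k.+1 <= Q) (QQ' : Q <= Q') (Q'W : Q' <= Q * W).
Hypothesis HE : energy R k w (smooth (S * W) Rb) <= W `^ c1 * (S * W) `^ e.
Hypothesis Hln : forall n : nat, n%:R <= W ^+ 2 * P ^+ k.+1 -> 2 + ln n%:R <= W.
Hypotheses (c10 : 0 <= c1) (e0 : 0 <= e) (tau2 : tau <= 2^-1).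
Hypothesis tauE : 4 * w%:R ^+ 2 * (1 - tau) = 4 * w%:R ^+ 2 - 4 * w%:R + 2 * e + k%:R.
Hypothesis HU : forall Y b, 0 <= Y -> Y <= P -> 1 <= b -> b <= Rb ->
  I01 (fun x => absf k Y b x `^ u) <= W `^ c2 * Y `^ eu.
Hypothesis HN : forall q, (0 < q)%N -> q%:R <= Q' ->
  (size (pnats \pi(q) (Num.truncn P)))%:R <= W.
Hypotheses (u2 : 2 <= u) (t0 : 0 <= t) (eu1 : 1 <= eu) (c20 : 0 <= c2).

Let W0 : 0 < W. Proof. exact: lt_le_trans W4. Qed.
Let W1 : 1 <= W. Proof. by apply: le_trans W4; rewrite ler1n. Qed.
Let S0 : 0 < S. Proof. exact: lt_le_trans S1. Qed.
Let P0 : 0 < P. Proof. exact: lt_le_trans P1. Qed.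
Let X1 : 1 <= X. Proof. exact: exprn_ege1. Qed.
Let X0 : 0 < X. Proof. exact: exprn_gt0. Qed.
Let V1 : 1 <= V. Proof. by rewrite ler_pdivlMr ?exprn_gt0 // mul1r. Qed.
Let V0 : 0 < V. Proof. exact: lt_le_trans V1. Qed.
Let Q1 : 1 <= Q. Proof. exact: exprn_ege1. Qed.
Let Q'0 : 0 < Q'. Proof. by apply: lt_le_trans QQ'; exact: lt_le_trans Q1. Qed.
Let Pk0 : 0 < P ^+ k. Proof. exact: exprn_gt0. Qed.

Let kappa := Q' / P ^+ k.
Let kappa0 : 0 < kappa. Proof. exact: divr_gt0. Qed.
Let Qn := Num.truncn Q'.
Let n1 : R := 4 * w%:R ^+ 2 + 2 * c1 + 2 * e + 3 * k%:R + 8.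
Let B := W `^ (n1 + 4) * X `^ (1 - tau).
Let B0 : 0 <= B. Proof. by rewrite mulr_ge0 // powR_ge0. Qed.
Let u0 : 0 < u. Proof. exact: lt_le_trans u2. Qed.

(** The arcs are restricted to q coprime to v, the coprimality that [absf_decomp] provides near a /
    q and that [I01_arcs] requires. *)
Let F (v d : nat) (x : R) : R :=
  bumps kappa [seq q <- iota 1 Qn | coprime v q] x *
  absf k (P / (v * d)%:R) (pdiv v)%:R (((v * d) ^ k)%:R * x) `^ u.
Let good (v : nat) := (V <= v%:R) && ((pdiv v)%:R <= Rb).
Let majorant (x : R) : R :=
  2 `^ s * ((V * W) `^ s * bumps kappa (iota 1 Qn) x +
    (V * W) `^ (s - 1) * (B `^ t * (W `^ u *
      \sum_(v <- iota 1 (Num.truncn (V * W)) | good v)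
        \sum_(d <- iota 1 (Num.truncn X)) F v d x))).

Let continuous_F v d : continuous (F v d).
Proof.
have cg := @continuous_absf_powR R k (P / (v * d)%:R) (pdiv v)%:R _ u0.
have := @continuous_affine_comp R _ ((v * d) ^ k)%:R 0 cg.
under eq_fun do rewrite addr0; move=> c x.
by apply: cvgM; [exact: continuous_bumps | exact: c].
Qed.

Let continuous_main (s' : seq nat) (P' : pred nat) (n : nat) :
  continuous (fun x => \sum_(v <- s' | P' v) \sum_(d <- iota 1 n) F v d x).
Proof. by apply: continuous_sum_seq => v; apply: continuous_sum_seq => d; exact: continuous_F. Qed.

Let continuous_majorant : continuous majorant.
Proof.
move=> x; apply: cvgM; first exact: cvg_cst.
apply: cvgD; first by apply: cvgM; [exact: cvg_cst | exact: continuous_bumps].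
apply: cvgM; first exact: cvg_cst.
apply: cvgM; first exact: cvg_cst.
apply: cvgM; first exact: cvg_cst.
exact: continuous_main.
Qed.

Let F_ge0 v d x : 0 <= F v d x.
Proof. by rewrite mulr_ge0 ?bumps_ge0 ?powR_ge0. Qed.

Let majorant_ge (x : R) (q a : nat) :
  (0 < q)%N -> q%:R <= Q' -> (a <= q)%N -> coprime a q ->
  `|q%:R * x - a%:R| <= kappa -> (q%:R <= Q -> Q / P ^+ k < `|q%:R * x - a%:R|) ->
  absf k P Rb x `^ s <= majorant x.
Proof.
move=> q0 qQ aq caq h1 h2.
have qin : q \in iota 1 Qn by rewrite mem_iota q0 add1n ltnS truncn_ge_nat // ltW.
have VX : P = V * X by rewrite divfK // gt_eqF.
have u1 : 1 <= u by apply: le_trans u2; rewrite ler1n.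
have HB (v : nat) (pi : nat_pred) : coprime v q -> V <= v%:R <= V * W ->
     (forall p, p \in pi -> p%:R <= Rb) ->
     cabs (\sum_(z <- pnats pi (Num.truncn P %/ v))
       expi ((v ^ k)%:R * x * (z ^ k)%:R)) <= B.
  by move=> cvq vV hp; apply: (@minor_pointwise R k w P Rb W S Q' c1 e tau _ _ _ _ _ _ _ _ _ _ _ _ _ _ _ _ _ q a v pi x).
apply: le_trans (absf_decomp q0 V1 X1 VX RbW W1 u1 t0 (erefl _) B0 (HN q0 qQ) HB) _.
have VW : 0 <= V * W by rewrite mulr_ge0 // ltW.
rewrite /majorant ler_wpM2l ?powR_ge0 // lerD //.
  by rewrite ler_peMr ?powR_ge0 //; exact: (@bumps_ge1 _ _ _ _ q a).
rewrite !ler_wpM2l ?powR_ge0 // big_mkcond [leRHS]big_mkcond.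
apply: ler_sum => v _; rewrite /good; case: (boolP (coprime v q)) => cvq /=; last first.
  by case: ifP => // _; rewrite sumr_ge0.
case: ifP => // _; apply: ler_sum => d _; rewrite ler_peMl ?powR_ge0 //.
by apply: (@bumps_ge1 _ _ _ _ q a) => //; rewrite mem_filter cvq.
Qed.

(** Q'^2 / P^k is at most W^2 Q^2 / P^k, and P^k = V^k Q^2. Thus the overlap of the arcs costs no
    more than the factor V^-k of the averaging. *)
Let QQ'P : Qn%:R * kappa <= W ^+ 2 * V ^- k.
Proof.
have qq : Qn%:R <= Q' by rewrite truncn_le ltW.
apply: (@le_trans _ _ (Q' * kappa)); first by rewrite ler_pM2r.
rewrite /kappa (expPk k P S1) mulrA ler_pdivrMr ?mulr_gt0 ?exprn_gt0 //.
rewrite mulrA mulfVK ?expf_neq0 ?gt_eqF // -expr2 -exprMn; apply: le_expn; first exact: ltW.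
by rewrite mulrC.
Qed.

Let Vk (v : nat) : V <= v%:R -> (0 < v)%N /\ (v ^ k)%:R^-1 <= V ^- k.
Proof.
move=> Vv; have v0 : 0 < (v%:R : R) by apply: lt_le_trans Vv.
split; first by rewrite -(ltr0n R).
by rewrite natrX lef_pV2 ?posrE ?exprn_gt0 // le_expn // ltW.
Qed.

Let I01_F (v d : nat) : good v -> (0 < d)%N ->
  I01 (F v d) <= 18 * W ^+ 2 * V ^- k * W `^ c2 * X `^ eu * d%:R^-1.
Proof.
move=> /andP[Vv pv] d0; have [v0 Vkv] := Vk Vv.
have v0' : 0 < (v%:R : R) by rewrite ltr0n.
have d0' : 0 < (d%:R : R) by rewrite ltr0n.
have d1 : 1 <= (d%:R : R) by rewrite ler1n.
have cg := @continuous_absf_powR R k (P / (v * d)%:R) (pdiv v)%:R _ u0.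
have Hq (q : nat) : q \in [seq q <- iota 1 Qn | coprime v q] ->
    [/\ (0 < q)%N, (q <= Qn)%N & coprime (v ^ k) q].
  rewrite mem_filter mem_iota add1n ltnS => /and3P[c q0 qQ]; split=> //.
  by rewrite coprimeXl.
have vk0 : (0 < v ^ k)%N by rewrite expn_gt0 v0.
have dk0 : (0 < d ^ k)%N by rewrite expn_gt0 d0.
have g0 x : 0 <= absf k (P / (v * d)%:R) (pdiv v)%:R x `^ u by exact: powR_ge0.
have pg x (n : nat) : absf k (P / (v * d)%:R) (pdiv v)%:R (x + n%:R) `^ u =
   absf k (P / (v * d)%:R) (pdiv v)%:R x `^ u by rewrite absf_periodic.
have := I01_arcs (filter_uniq _ (iota_uniq _ _)) vk0 dk0 kappa0 Hq cg g0 pg.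
rewrite -expnMn => /le_trans; apply.
have p1 : 1 <= ((pdiv v)%:R : R) by rewrite ler1n pdiv_gt0.
have Yv : 0 <= P / (v * d)%:R by rewrite divr_ge0 // ltW.
have YP : P / (v * d)%:R <= P.
  have vd : (0 < v * d)%N by rewrite muln_gt0 v0.
  by rewrite ler_pdivrMr ?ltr0n // ler_peMr ?ler1n // ltW.
have YX : P / (v * d)%:R <= X / d%:R.
  rewrite natrM invfM mulrA ler_wpM2r ?invr_ge0 ?(ltW d0') //.
  by move: Vv; rewrite !ler_pdivrMr // [X * _]mulrC.
have hI : I01 (fun x => absf k (P / (v * d)%:R) (pdiv v)%:R x `^ u) <=
    W `^ c2 * (X `^ eu * d%:R^-1).
  apply: le_trans (HU Yv YP p1 pv) _; rewrite ler_wpM2l ?powR_ge0 //.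
  apply: (@le_trans _ _ ((X / d%:R) `^ eu)).
    by apply: le_powRl => //; apply: le_trans eu1.
  (* As [eu] >= 1, the factor d^(-eu) is at most 1 / d, and the sum over d will cost only a
     logarithm. *)
  rewrite powRM ?invr_ge0 ?(ltW d0') ?(ltW X0) // ler_wpM2l ?powR_ge0 //.
  by apply: ge1r_powR => //; rewrite invr_gt0 d0' invf_le1.
set I := I01 _ in hI *.
have I0 : 0 <= I by apply: I01_ge0 => x; exact: powR_ge0.
have mV : 0 < ((v ^ k)%:R : R) by rewrite ltr0n.
have m0 := lt0r_neq0 mV.
(* The constant is 18 = 2 (8 + 1): [Qn] kappa and v^-k are both at most W^2 V^-k. *)
have -> : (v ^ k)%:R^-1 * (2 * (4 * Qn%:R * (2 * kappa * (v ^ k)%:R) + 1) * I) =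
  2 * (8 * (Qn%:R * kappa) + (v ^ k)%:R^-1) * I by field.
have hq := QQ'P.
set y := (v ^ k)%:R^-1 in Vkv *; set x := Qn%:R * kappa in hq *; set z := V ^- k in Vkv hq *.
have z0 : 0 <= z by rewrite invr_ge0 exprn_ge0 // ltW.
have W2 : z <= W ^+ 2 * z by rewrite ler_peMl // exprn_ege1.
have -> : 18 * W ^+ 2 * z * W `^ c2 * X `^ eu * d%:R^-1 =
  (18 * (W ^+ 2 * z)) * (W `^ c2 * (X `^ eu * d%:R^-1)) by rewrite !mulrA.
have x0 : 0 <= x by rewrite mulr_ge0 // ltW.
have y0 : 0 <= y by rewrite invr_ge0.
apply: ler_pM => //; last lra.
by rewrite mulr_ge0 // addr_ge0 // mulr_ge0.
Qed.

Let lnX : \sum_(d <- iota 1 (Num.truncn X)) (d%:R : R)^-1 <= W.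
Proof.
have x0 : (0 < Num.truncn X)%N by rewrite truncn_gt0.
apply: le_trans (harmonic_le R x0) _.
have : 2 + ln ((Num.truncn X)%:R : R) <= W; last by lra.
apply: Hln; apply: (@le_trans _ _ X); first by rewrite truncn_le ltW.
apply: le_trans SP _; apply: (@le_trans _ _ (P ^+ k.+1)).
  by rewrite -[leLHS]expr1 ler_weXn2l.
by rewrite ler_peMl ?exprn_ege1 // exprn_ge0 // ltW.
Qed.

Let I01_sumF : \sum_(v <- iota 1 (Num.truncn (V * W)) | good v)
    \sum_(d <- iota 1 (Num.truncn X)) I01 (F v d) <=
  V * W * (18 * W ^+ 2 * V ^- k * W `^ c2 * X `^ eu * W).
Proof.
set c := 18 * W ^+ 2 * V ^- k * W `^ c2 * X `^ eu.
have c0 : 0 <= c by rewrite !mulr_ge0 ?powR_ge0 ?exprn_ge0 ?invr_ge0 ?exprn_ge0 // ltW.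
have VW : 0 <= V * W by rewrite mulr_ge0 // ltW.
apply: (@le_trans _ _ (\sum_(v <- iota 1 (Num.truncn (V * W))) c * W)).
  rewrite big_mkcond; apply: ler_sum => v _; case: ifP => gv; last by rewrite mulr_ge0 // ltW.
  apply: (@le_trans _ _ (c * \sum_(d <- iota 1 (Num.truncn X)) (d%:R : R)^-1)); last first.
    by rewrite ler_wpM2l.
  rewrite mulr_sumr big_seq_cond [leRHS]big_seq_cond; apply: ler_sum => d.
  by rewrite andbT mem_iota => /andP[d0 _]; exact: I01_F.
rewrite big_const_seq count_predT size_iota iter_addr addr0 -[_ *+ _]mulr_natl.
by rewrite ler_wpM2r ?truncn_le // mulr_ge0 // ltW.
Qed.

Let c3 := 2 * s + u + c2 + 6 + t * (n1 + 4).

Let VWs : (V * W) `^ s * V ^- k = W `^ s * (P `^ (s - k%:R) * X `^ (k%:R - s)).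
Proof.
have -> : V ^- k = V `^ (- k%:R) by rewrite powRN powR_mulrn // ltW.
rewrite powRM ?ltW // [V `^ s * _]mulrC -mulrA [W `^ s * _]mulrC mulrA -powRD; last first.
  by rewrite (gt_eqF V0) implybT.
rewrite mulrC -[RHS]mulrA [V `^ _]powRM ?invr_ge0 ?(ltW P0) ?(ltW X0) //; congr (_ * (_ * _)).
by rewrite -powR_inv1 ?ltW // -powRrM mulN1r opprB.
Qed.

(** By [VWs], V^s V^-k is P^(s - k) X^(k - s); the pointwise bound contributes X^(t(1 - tau)) and
    the mean values X^eu. The trivially bounded terms lack the last two factors, which are at least
    1. *)
Let I01_majorant : I01 majorant <=
  W `^ c3 * (P `^ (s - k%:R) * X `^ (k%:R - s + t * (1 - tau) + eu)).
Proof.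
have tau1 : 0 <= 1 - tau by have := tau2; lra.
have VW : 0 < V * W by exact: mulr_gt0.
have cm := @continuous_main (iota 1 (Num.truncn (V * W))) good (Num.truncn X).
have cb := @continuous_bumps R kappa (iota 1 Qn).
rewrite /majorant I01Z; last first.
  move=> x; apply: cvgD; first by apply: cvgM; [exact: cvg_cst | exact: cb].
  by do 3 (apply: cvgM; first exact: cvg_cst); exact: cm.
rewrite I01D; first last.
- by move=> x; do 3 (apply: cvgM; first exact: cvg_cst); exact: cm.
- by move=> x; apply: cvgM; [exact: cvg_cst | exact: cb].
rewrite I01Z // I01Z; last by move=> x; do 2 (apply: cvgM; first exact: cvg_cst); exact: cm.
rewrite I01Z; last by move=> x; (apply: cvgM; first exact: cvg_cst); exact: cm.
rewrite I01Z; last exact: cm.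
rewrite [Y in W `^ u * Y]I01_sum; last by move=> v; apply: continuous_sum_seq => d; exact: continuous_F.
under eq_bigr do rewrite I01_sum //.
set T := P `^ _ * X `^ (k%:R - s + t * (1 - tau) + eu).
have T0 : 0 <= T by rewrite mulr_ge0 // powR_ge0.
have hb : I01 (bumps kappa (iota 1 Qn)) <= 16 * (W ^+ 2 * V ^- k).
  apply: le_trans (I01_bumps _ kappa0) _; rewrite -mulrA [kappa * _]mulrC.
  by rewrite ler_wpM2l // QQ'P.
have eu0 : 0 <= eu by apply: le_trans eu1.
have first_le : (V * W) `^ s * I01 (bumps kappa (iota 1 Qn)) <= 16 * W ^+ 2 * W `^ s * T.
  apply: le_trans (ler_wpM2l (powR_ge0 _ _) hb) _.
  have -> : (V * W) `^ s * (16 * (W ^+ 2 * V ^- k)) = 16 * W ^+ 2 * ((V * W) `^ s * V ^- k) by ring.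
  rewrite VWs mulrA ler_wpM2l ?ler_wpM2l ?mulr_ge0 ?exprn_ge0 ?powR_ge0 ?(ltW W0) //.
  by rewrite ler_powR // -addrA lerDl addr_ge0 // mulr_ge0.
set E := t * (n1 + 4) + u + c2 + 3.
have second_le : (V * W) `^ (s - 1) * (B `^ t * (W `^ u *
    \sum_(v <- iota 1 (Num.truncn (V * W)) | good v)
      \sum_(d <- iota 1 (Num.truncn X)) I01 (F v d))) <= 18 * W `^ E * W `^ s * T.
  apply: (@le_trans _ _ ((V * W) `^ (s - 1) * (B `^ t * (W `^ u *
    (V * W * (18 * W ^+ 2 * V ^- k * W `^ c2 * X `^ eu * W)))))).
    by rewrite !ler_wpM2l ?powR_ge0.
  have VW1 : (V * W) `^ s = (V * W) `^ (s - 1) * (V * W).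
    transitivity ((V * W) `^ (s - 1) * (V * W) `^ 1); last by rewrite powRr1 // ltW.
    rewrite -powRD ?subrK //.
    by rewrite (gt_eqF VW) implybT.
  have BE : B `^ t = W `^ (t * (n1 + 4)) * X `^ (t * (1 - tau)).
    by rewrite /B powRM ?powR_ge0 // -!powRrM ![_ * t]mulrC.
  have WE : W `^ E = W `^ (t * (n1 + 4)) * W `^ u * W `^ c2 * W ^+ 3.
    by rewrite -powR_mulrn ?(ltW W0) // -!powRD_gt0 //.
  have TE : T = P `^ (s - k%:R) * X `^ (k%:R - s) * (X `^ (t * (1 - tau)) * X `^ eu).
    by rewrite /T -mulrA -!powRD_gt0 // !addrA.
  rewrite le_eqVlt; apply/orP; left; apply/eqP; rewrite BE.
  transitivity ((V * W) `^ s * V ^- k * (W `^ (t * (n1 + 4)) * X `^ (t * (1 - tau)) * W `^ u *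
     18 * W ^+ 3 * W `^ c2 * X `^ eu)).
    by rewrite VW1; ring.
  by rewrite VWs WE TE; ring.
have s0 : 0 <= s by rewrite addr_ge0 // ltW.
(* The factor 2^s is at most W^s, and 34 = 16 + 18 is absorbed by W^3 >= 64. *)
apply: (@le_trans _ _ (W `^ s * (34 * W `^ E * W `^ s * T))).
  apply: ler_pM; rewrite ?powR_ge0 //.
  - rewrite addr_ge0 // !mulr_ge0 ?powR_ge0 ?I01_ge0 // => [x|]; first exact: bumps_ge0.
    by rewrite sumr_ge0 // => v _; rewrite sumr_ge0 // => d _; rewrite I01_ge0.
  - by apply: le_powRl => //; apply: le_trans W4; rewrite ler_nat.
  apply: le_trans (lerD first_le second_le) _.
  have h2 : W ^+ 2 <= W `^ E.
    rewrite -powR_mulrn ?(ltW W0) // ler_powR // /E.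
    have : 0 <= t * (n1 + 4).
      by rewrite mulr_ge0 // /n1 !addr_ge0 // ?mulr_ge0 ?exprn_ge0.
    by have := u2; have := c20; lra.
  rewrite -2!mulrDl !ler_wpM2r ?powR_ge0 //; lra.
have -> : W `^ c3 = W `^ s * W `^ s * W `^ E * W ^+ 3.
  rewrite -powR_mulrn ?(ltW W0) // -!powRD_gt0 //.
  by congr (_ `^ _); rewrite /c3 /E; ring.
have h3 : 34 <= W ^+ 3.
  apply: (@le_trans _ _ (4 ^+ 3)); first by rewrite -natrX ler_nat.
  exact: le_expn.
have -> : W `^ s * (34 * W `^ E * W `^ s * T) = (W `^ s * W `^ s * W `^ E * T) * 34 by ring.
have -> : W `^ s * W `^ s * W `^ E * W ^+ 3 * T = (W `^ s * W `^ s * W `^ E * T) * W ^+ 3 by ring.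
by rewrite ler_wpM2l // !mulr_ge0 ?powR_ge0.
Qed.

Local Open Scope classical_set_scope.

Lemma piece_integral (D : set R) : measurable D -> D `<=` `[0, 1] ->
  (forall x, D x -> exists q a : nat, [/\ (0 < q)%N, q%:R <= Q', (a <= q)%N, coprime a q &
    `|q%:R * x - a%:R| <= Q' / P ^+ k]) ->
  (forall x, D x -> forall q a : nat, (0 < q)%N -> q%:R <= Q -> (a <= q)%N -> coprime a q ->
    Q / P ^+ k < `|q%:R * x - a%:R|) ->
  (intf k s P Rb D <=
    (W `^ (2 * s + u + c2 + 6 + t * (4 * w%:R ^+ 2 + 2 * c1 + 2 * e + 3 * k%:R + 8 + 4)) *
    (P `^ (s - k%:R) * X `^ (k%:R - s + t * (1 - tau) + eu)))%:E)%E.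
Proof.
move=> mD D01 HD1 HD2; have s0 : 0 < s by rewrite ltr_wpDl.
apply: (@le_trans _ _ (\int[mu]_(x in D) (majorant x)%:E)%E).
  apply: ge0_le_integral => //.
  - by move=> x _; rewrite lee_fin powR_ge0.
  - apply/measurable_EFinP; apply: measurable_funTS; apply: continuous_measurable_fun.
    exact: continuous_absf_powR.
  - apply/measurable_EFinP; apply: measurable_funTS; exact: continuous_measurable_fun.
  move=> x Dx; rewrite lee_fin.
  have [q [a [q0 qQ aq caq h]]] := HD1 x Dx.
  by apply: (@majorant_ge x q a) => // qQ2; exact: HD2.
apply: (@le_trans _ _ (\int[mu]_(x in `[0%R, 1%R]) (majorant x)%:E)%E).
  apply: ge0_subset_integral => //.
  - apply/measurable_EFinP; apply: measurable_funTS; exact: continuous_measurable_fun.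
  move=> x _; rewrite lee_fin /majorant mulr_ge0 ?addr_ge0 ?mulr_ge0 ?powR_ge0 ?bumps_ge0 //.
  by rewrite sumr_ge0 // => v _; rewrite sumr_ge0.
by rewrite I01E // lee_fin; exact: I01_majorant.
Qed.

End Piece.

(** * Uniform mean value bounds *)

Section Eventually.
Variable R : realType.
Implicit Types P W : R.

Lemma large_powR (a c : R) : 0 < a -> exists2 P0 : R, 1 <= P0 & forall P, P0 <= P -> c <= P `^ a.
Proof.
move=> a0; pose c' := Num.max 1 c; have c1 : 1 <= c' by rewrite le_max lexx.
exists (c' `^ a^-1); first by rewrite -(powRr0 c') ler_powR // invr_ge0 ltW.
move=> P h; apply: (@le_trans _ _ c'); first by rewrite le_max lexx orbT.
rewrite -[leLHS]powRr1 ?(le_trans _ c1) // -(mulVf (lt0r_neq0 a0)) powRrM.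
by apply: le_powRl => //; rewrite ?powR_ge0 // ltW.
Qed.

(** The coefficients are natural numbers, so each is at most its square: the diagonal solutions
    alone suffice. *)
Lemma size_le_energy k (s : seq nat) : (size s)%:R <= energy R k 1 s.
Proof.
rewrite /energy expr1; set p := powpoly R k s.
have -> : (size s)%:R = p.[1].
  rewrite /p /powpoly horner_sum (eq_bigr (fun=> 1)); last by move=> x _; rewrite hornerXn expr1n.
  by rewrite big_const_seq count_predT iter_addr addr0.
rewrite horner_coef; apply: ler_sum => i _; rewrite expr1n mulr1.
have [n ->] : exists n : nat, p`_i = n%:R.
  rewrite /p /powpoly coef_sum; elim: s {p i} (val i) => [|x s IH] j.
    by exists 0%N; rewrite big_nil.
  have [n nE] := IH j; exists ((j == x ^ k) + n)%N.
  by rewrite big_cons coefXn nE natrD.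
by case: n => [|n]; rewrite ?expr0n // expr2 ler_peMl // ler1n.
Qed.

(** Since |f|^2 <= |f|^u + 1, the u-th moment is at least the number of smooth integers minus 1, and
    [smooth_dense] makes that number exceed P^(1 - eps) for suitable large P. *)
Lemma admissible_ge k (u Delta : R) : 2 <= u -> admissible k u Delta ->
  k%:R + 1 - u <= Delta.
Proof.
move=> u2 adm; rewrite leNgt; apply/negP => lt.
(* The deficit of [Delta] is at least 4 eps, so the u-th moment is at most C P^(1 - 3 eps); eps <=
   1/4 keeps that exponent positive. *)
pose eps := Num.min (4^-1) ((k%:R + 1 - u - Delta) / 4).
have eps0 : 0 < eps by rewrite lt_min invr_gt0 ltr0n divr_gt0 //; lra.
have epsE : eps <= 4^-1 /\ eps <= (k%:R + 1 - u - Delta) / 4.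
  by split; rewrite ge_min lexx ?orbT.
have u0 : 0 < u by apply: lt_le_trans u2.
have [eta [eta0 [C [P0 adm']]]] := adm _ eps0.
(* Then P^(1 - eps) >= (|C| + 2) P^(1 - 3 eps), which contradicts the upper bound |C| P^(1 - 3 eps)
   + 1. *)
have [P1 _ large] := @large_powR (2 * eps) (`|C| + 2) (mulr_gt0 (ltr0Sn _ _) eps0).
have [P [Rb [PP P1' R1 RP dense]]] := smooth_dense (Num.max P0 P1) eta0 eps0.
move: PP; rewrite ge_max => /andP[PP0 PP1].
have := adm' P Rb PP0 R1 RP; rewrite UE // lee_fin => hU.
have hE : (size (smooth P Rb))%:R <= C * P `^ (u - k%:R + Delta + eps) + 1.
  apply: le_trans (size_le_energy k _) _; rewrite -parseval // muln1.
  apply: (@le_trans _ _ (I01 (fun a => absf k P Rb a `^ u + 1))); last first.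
    rewrite I01D ?I01_cst ?lerD2r //; first exact: continuous_absf_powR.
    by move=> x; exact: cvg_cst.
  apply: le_I01.
  - by move=> x; apply: cvgM; exact: continuous_absf.
  - by move=> x; apply: cvgD; [exact: continuous_absf_powR | exact: cvg_cst].
  move=> x; have f0 := absf_ge0 k P Rb x.
  have [f1|f1] := leP (absf k P Rb x) 1.
    apply: (@le_trans _ _ 1); first by rewrite expr2 mulr_ile1.
    by rewrite lerDr powR_ge0.
  rewrite -powR_mulrn //; apply: (@le_trans _ _ (absf k P Rb x `^ u)); last by rewrite lerDl.
  by rewrite ler_powR // ltW.
have P00 : 0 < P by apply: lt_le_trans P1'.
have h3 : P `^ (u - k%:R + Delta + eps) <= P `^ (1 - 3 * eps) by rewrite ler_powR //; lra.
have h4 : 1 <= P `^ (1 - 3 * eps) by rewrite -[leLHS](powRr0 P) ler_powR //; lra.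
have h5 : P `^ (1 - eps) = P `^ (2 * eps) * P `^ (1 - 3 * eps).
  by rewrite -powRD_gt0 //; congr (_ `^ _); ring.
have h6 := large P PP1.
have h7 : C * P `^ (u - k%:R + Delta + eps) <= `|C| * P `^ (1 - 3 * eps).
  apply: (@le_trans _ _ (`|C| * P `^ (u - k%:R + Delta + eps))).
    by rewrite ler_wpM2r ?powR_ge0 // ler_norm.
  by rewrite ler_wpM2l.
move: (le_trans dense hE); rewrite h5.
have h8 : (`|C| + 2) * P `^ (1 - 3 * eps) <= P `^ (2 * eps) * P `^ (1 - 3 * eps).
  by rewrite ler_wpM2r // powR_ge0.
rewrite mulrDl in h8; lra.
Qed.

Lemma absf_le k (P Rb x : R) : 0 <= P -> absf k P Rb x <= P.
Proof.
move=> P0; rewrite absfE; apply: le_trans (cabs_sum _ _ _) _.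
rewrite (eq_bigr (fun=> 1)); last by move=> y _; exact: cabs_expi.
rewrite big_const_seq count_predT iter_addr addr0.
apply: (@le_trans _ _ ((Num.truncn P)%:R)); last by rewrite truncn_le.
by rewrite ler_nat smoothE size_pnats.
Qed.

Lemma mean_value_uniform k (u Delta delta : R) : 2 <= u -> admissible k u Delta -> 0 < delta ->
  exists2 eta : R, 0 < eta & exists2 P0 : R, 1 <= P0 & forall P Rb Y : R, P0 <= P ->
    1 <= Rb -> Rb <= P `^ eta -> 0 <= Y -> Y <= P ^+ 2 ->
    I01 (fun x => absf k Y Rb x `^ u) <= (P `^ delta) `^ u * Y `^ (u - k%:R + Delta).
Proof.
move=> u2 adm delta0; have u0 : 0 < u by apply: lt_le_trans u2.
have e1 : 0 <= u - k%:R + Delta by have := admissible_ge u2 adm; lra.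
have d2 : 0 < delta / 2 by exact: divr_gt0.
have [eta [eta0 [C [P0 adm']]]] := adm _ d2.
have [P1 P11 large] := large_powR (Num.max P0 C) delta0.
exists (delta * eta); first exact: mulr_gt0.
exists P1 => // P Rb Y PP R1 RP Y0 YP.
have Pge1 : 1 <= P by apply: le_trans PP.
have Pgt0 : 0 < P by apply: lt_le_trans Pge1.
set W := P `^ delta; set E := _ + Delta.
have W1 : 1 <= W by rewrite -(powRr0 P) ler_powR // ltW.
have W0 : 0 < W by apply: lt_le_trans W1.
have [Ylt1|Yge1] := ltP Y 1.
  have -> : (fun x => absf k Y Rb x `^ u) = fun=> 0.
    apply/funext => x; rewrite absfE smoothE.
    have -> : Num.truncn Y = 0%N by apply/eqP; rewrite -leqn0 leqNgt truncn_gt0 -ltNge.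
    by rewrite /pnats big_nil cabs0 powR0 // gt_eqF.
  by rewrite I01_cst mulr_ge0 ?powR_ge0.
have YE : 1 <= Y `^ E by rewrite -(powRr0 Y) ler_powR.
have [YltW|WleY] := ltP Y W.
  apply: (@le_trans _ _ (W `^ u)); last by rewrite ler_peMr ?powR_ge0.
  rewrite -[leRHS]I01_cst; apply: le_I01.
  - exact: continuous_absf_powR.
  - by move=> x; exact: cvg_cst.
  move=> x; apply: le_powRl; [exact: ltW | exact: absf_ge0 | ].
  exact: le_trans (absf_le _ _ _ Y0) (ltW YltW).
have := large P PP; rewrite ge_max => /andP[P0W CW].
have RY : Rb <= Y `^ eta.
  by apply: le_trans RP _; rewrite powRrM; apply: le_powRl; rewrite ?powR_ge0 // ltW.
have := adm' Y Rb (le_trans P0W WleY) R1 RY; rewrite UE // lee_fin => /le_trans; apply.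
have Y00 : 0 < Y by apply: lt_le_trans Yge1.
rewrite powRD_gt0 // mulrA mulrAC ler_wpM2r ?powR_ge0 //.
apply: (@le_trans _ _ (W * W)).
  apply: (@le_trans _ _ (W * Y `^ (delta / 2))); first by rewrite ler_wpM2r ?powR_ge0.
  rewrite ler_wpM2l ?powR_ge0 //.
  apply: (@le_trans _ _ ((P ^+ 2) `^ (delta / 2))); first by apply: le_powRl => //; rewrite ltW.
  by rewrite -powR_mulrn ?(ltW Pgt0) // -powRrM mulrC divfK.
by rewrite -expr2 -powR_mulrn ?(ltW W0) // ler_powR.
Qed.

Lemma size_supported_uniform k (delta : R) : 0 < delta ->
  exists2 P0 : R, 1 <= P0 & forall P (q : nat), P0 <= P -> (0 < q)%N -> q%:R <= P ^+ k ->
    (size (pnats \pi(q) (Num.truncn P)))%:R <= P `^ delta.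
Proof.
move=> delta0; have d2 : 0 < delta / 2 by exact: divr_gt0.
have k0 : 0 < (k.+1%:R : R) by rewrite ltr0n.
have [C [C0 HC]] := @size_pnats_supported R (delta / 2 / k.+1%:R) (divr_gt0 d2 k0).
have [P1 P11 large] := large_powR C d2.
exists P1 => // P q PP q0 qP.
have Pgt0 : 0 < P by apply: lt_le_trans PP; apply: lt_le_trans P11.
apply: le_trans (HC q _ q0) _.
rewrite [leRHS](_ : _ = P `^ (delta / 2) * P `^ (delta / 2)); last first.
  by rewrite -powRD_gt0 // -splitr.
apply: ler_pM; rewrite ?powR_ge0 ?(ltW C0) //; first exact: large.
apply: (@le_trans _ _ ((P ^+ k.+1) `^ (delta / 2 / k.+1%:R))).
  apply: le_powRl; rewrite ?(ltW (divr_gt0 d2 k0)) // ?mulr_ge0 //.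
  by rewrite exprS ler_pM // truncn_le ltW.
by rewrite -powR_mulrn ?(ltW Pgt0) // -powRrM mulrC divfK ?lt0r_neq0.
Qed.

(** Here n <= P^(k+3) and ln P <= (2 / delta) P^(delta/2); a second factor P^(delta/2) absorbs the
    constant c. *)
Lemma ln_uniform k (delta : R) : 0 < delta -> delta <= 1 ->
  exists2 P0 : R, 1 <= P0 & forall P (n : nat), P0 <= P ->
    n%:R <= (P `^ delta) ^+ 2 * P ^+ k.+1 -> 2 + ln (n%:R : R) <= P `^ delta.
Proof.
move=> delta0 delta1; have d2 : 0 < delta / 2 by exact: divr_gt0.
pose c := 2 + k.+3%:R * (delta / 2)^-1.
have [P1 P11 large] := large_powR c d2.
exists P1 => // P n PP nP.
have Pge1 : 1 <= P by apply: le_trans PP.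
have Pgt0 : 0 < P by apply: lt_le_trans Pge1.
have c2 : 2 <= c by rewrite lerDl divr_ge0 // ltW.
have y1 : 1 <= P `^ (delta / 2) by apply: le_trans (large P PP); lra.
have lnP : ln P <= (delta / 2)^-1 * P `^ (delta / 2).
  rewrite mulrC ler_pdivlMr // mulrC -ln_powR.
  have yp : 0 < P `^ (delta / 2) by apply: lt_le_trans y1.
  by apply: le_trans (ltW (ln_sublinear yp)) _.
have WE : P `^ delta = P `^ (delta / 2) * P `^ (delta / 2) by rewrite -powRD_gt0 // -splitr.
have lnn : ln (n%:R : R) <= k.+3%:R * ln P.
  have [->|n0] := posnP n; first by rewrite ln0 // mulr_ge0 // ln_ge0.
  have -> : k.+3%:R * ln P = ln (P ^+ k.+3) by rewrite lnXn // mulr_natl.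
  rewrite ler_ln ?posrE ?ltr0n ?exprn_gt0 //.
  apply: le_trans nP _; rewrite -[k.+3](addn2 k.+1) exprD mulrC ler_wpM2l ?exprn_ge0 ?(ltW Pgt0) //.
  apply: le_expn; first exact: powR_ge0.
  by rewrite -[leRHS]powRr1 ?(ltW Pgt0) // ler_powR.
have h := large P PP; rewrite WE.
have h2 : c * P `^ (delta / 2) <= P `^ (delta / 2) * P `^ (delta / 2).
  by rewrite ler_wpM2r ?powR_ge0.
have h3 : k.+3%:R * ln P <= k.+3%:R * ((delta / 2)^-1 * P `^ (delta / 2)).
  by rewrite ler_wpM2l.
move: h2; rewrite /c mulrDl -mulrA; lra.
Qed.

End Eventually.

(** * Nested major arcs *)

Section MajorArcs.
Variable R : realType.
Local Open Scope classical_set_scope.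
Local Notation mu := (@lebesgue_measure R).
Implicit Types (P Q Rb : R).

Lemma le_major k P Q Q' : 0 <= P -> Q <= Q' -> major k Q P `<=` major k Q' P.
Proof.
move=> P0 QQ' x [x01 [q [a [q0 qQ aq caq h]]]]; split=> //; exists q, a; split=> //.
  exact: le_trans QQ'.
by apply: le_trans h _; rewrite ler_wpM2r ?powR_ge0.
Qed.

(** At Q = P^(k/2) Dirichlet's error 1 / Q equals Q P^-k. *)
Lemma major_full k P : 1 <= P -> major k (P `^ (k%:R / 2)) P = `[0, 1[.
Proof.
move=> P1; have P0 : 0 < P by apply: lt_le_trans P1.
apply/seteqP; split=> [x [x01 _] | x]; first by rewrite /= in_itv.
rewrite /= in_itv /= => x01; split=> //.
have Q1 : 1 <= P `^ (k%:R / 2) by rewrite -[leLHS](powRr0 P) ler_powR // divr_ge0.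
have [q [a [q0 qQ aq caq h]]] := dirichlet x01 Q1.
exists q, a; split=> //; apply: le_trans h _.
by rewrite -powR_inv1 ?powR_ge0 // -powRrM -powRD_gt0 // ler_powR //; lra.
Qed.

Lemma measurable_major k P Q : measurable (major k Q P).
Proof.
pose good (q a : nat) := [/\ (1 <= q)%N, q%:R <= Q, (a <= q)%N & coprime a q].
pose M (q a : nat) : set R := [set x | `|q%:R * x - a%:R| <= Q * P `^ (- k%:R)].
have -> : major k Q P = `[0, 1[ `&` \bigcup_q \bigcup_(a in [set a | good q a]) M q a.
  apply/seteqP; split=> x.
    move=> [x01 [q [a [q0 qQ aq caq h]]]]; split; first by rewrite /= in_itv.
    by exists q => //; exists a.
  move=> [x01 [q _ [a [q0 qQ aq caq] h]]]; split; first by move: x01; rewrite /= in_itv.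
  by exists q, a.
apply: measurableI; first exact: measurable_itv.
apply: bigcup_measurable => q _; apply: bigcup_measurable => a _.
have cf : continuous (fun x : R => `|q%:R * x - a%:R|).
  exact: (@continuous_affine_comp R _ q%:R (- a%:R) (@norm_continuous R R)).
have := continuous_measurable_fun cf measurableT (measurable_itv (Interval -oo%O (BRight (Q * P `^ (- k%:R))))).
rewrite setTI; congr measurable; apply/seteqP; split=> x; by rewrite /M /= in_itv.
Qed.

Lemma measurable_absf_powR k (s P Rb : R) (D : set R) : 0 < s ->
  measurable_fun D (fun x => (absf k P Rb x `^ s)%:E).
Proof.
move=> s0; apply/measurable_EFinP; apply: measurable_funTS.
by apply: continuous_measurable_fun; exact: continuous_absf_powR.
Qed.

(** The point 1 lies in every [minor] set and in no [major] set, but has measure zero. *)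
Lemma intf_minor k (s P Rb Q : R) : 0 < s -> 1 <= P ->
  intf k s P Rb (minor k Q P) = intf k s P Rb (major k (P `^ (k%:R / 2)) P `\` major k Q P).
Proof.
move=> s0 P1; rewrite major_full //.
have -> : minor k Q P = (`[0, 1[ `\` major k Q P) `|` [set 1].
  apply/seteqP; split=> x.
    move=> [/andP[x0]]; rewrite le_eqVlt => /orP[/eqP -> _|x1 h]; first by right.
    by left; split=> //; rewrite /= in_itv /= x0.
  case=> [[]|->] /=; first by rewrite in_itv /= => /andP[x0 x1] h; split=> //; rewrite x0 ltW.
  by split; [rewrite ler01 lexx | move=> [/andP[_]]; rewrite ltxx].
rewrite /intf ge0_integral_setU //.
- by rewrite integral_set1 adde0.
- by apply: measurableD; [exact: measurable_itv | exact: measurable_major].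
- exact: measurable_absf_powR.
- by move=> x _; rewrite lee_fin powR_ge0.
by apply/disj_setPS => x [[+ _] xE]; rewrite xE /= in_itv /= ltxx andbF.
Qed.

Lemma intf_chain k (s P Rb T : R) (Q : nat -> R) (J : nat) : 0 < s -> 0 <= P ->
  (forall j, Q j <= Q j.+1) ->
  (forall j, (intf k s P Rb (major k (Q j.+1) P `\` major k (Q j) P) <= T%:E)%E) ->
  (intf k s P Rb (major k (Q J) P `\` major k (Q 0%N) P) <= (J%:R * T)%:E)%E.
Proof.
move=> s0 P0 Qj HT; have Q0 j : Q 0%N <= Q j by elim: j => // j IH; apply: le_trans IH _.
elim: J => [|J IH]; first by rewrite setDv mul0r /intf integral_set0.
have -> : major k (Q J.+1) P `\` major k (Q 0%N) P =
   (major k (Q J) P `\` major k (Q 0%N) P) `|` (major k (Q J.+1) P `\` major k (Q J) P).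
  apply/seteqP; split=> x.
    move=> [h1 h2]; have [h|h] := pselect (major k (Q J) P x); first by left.
    by right.
  move=> [[h1 h2]|[h1 h2]]; split=> //; first by apply: le_major h1.
  by move=> h; apply: h2; apply: le_major h.
rewrite /intf ge0_integral_setU //.
- rewrite -natr1 mulrDl mul1r EFinD; apply: leeD; [exact: IH | exact: HT].
- by apply: measurableD; exact: measurable_major.
- by apply: measurableD; exact: measurable_major.
- exact: measurable_absf_powR.
- by move=> x _; rewrite lee_fin powR_ge0.
by apply/disj_setPS => x [[h _] [_ h2]].
Qed.

End MajorArcs.

(** * One layer in terms of the admissible exponents, and the sum over layers *)

Section Scale.
Variable R : realType.
Local Open Scope classical_set_scope.

Lemma scale_estimate (k w : nat) (t u tau Du Dw delta : R) :
  (0 < k)%N -> (0 < w)%N -> 0 <= t -> 2 <= u ->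
  admissible k (2 * w%:R) Dw -> admissible k u Du ->
  tau = (k%:R - 2 * Dw) / (4 * w%:R ^+ 2) -> 0 < delta -> delta <= 1 ->
  exists2 eta : R, 0 < eta & exists2 P0 : R, 1 <= P0 & forall P Rb Q Q' : R, P0 <= P ->
    1 <= Rb -> Rb <= P `^ eta -> 2 * (P `^ delta) ^+ k.+1 <= Q -> Q <= Q' ->
    Q' <= Q * P `^ delta -> Q' <= P `^ (k%:R / 2) ->
  (intf k (t + u) P Rb (major k Q' P `\` major k Q P) <=
    ((P `^ delta) `^ (2 * (t + u) + u + u + 6 +
       t * (4 * w%:R ^+ 2 + 2 * (2 * w%:R) + 2 * (2 * w%:R - k%:R + Dw) + 3 * k%:R + 8 + 4)) *
     (P `^ (t + u - k%:R) * Q `^ (2 / k%:R * (Du - t * tau))))%:E)%E.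
Proof.
move=> k0 w0 t0 u2 admw admu tauE delta0 delta1.
have w1 : 1 <= (w%:R : R) by rewrite ler1n.
have ww2 : 2 <= 2 * (w%:R : R) by lra.
have k0' : 0 < (k%:R : R) by rewrite ltr0n.
have kn := lt0r_neq0 k0'.
have Dw_ge := admissible_ge ww2 admw.
have Du_ge := admissible_ge u2 admu.
have [etaw etaw0 [Pw Pw1 HW]] := mean_value_uniform ww2 admw delta0.
have [etau etau0 [Pu Pu1 HU]] := mean_value_uniform u2 admu delta0.
have [Ps Ps1 HS] := @size_supported_uniform R k _ delta0.
have [Pl Pl1 HL] := @ln_uniform R k _ delta0 delta1.
have [Pc Pc1 HC] := large_powR (Num.max 4 w%:R) delta0.
(* The bound by [delta] gives Rb <= W; the other two serve the moments of order 2 w and u. *)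
pose eta := Num.min delta (Num.min etaw etau).
have eta_le : [/\ eta <= delta, eta <= etaw & eta <= etau].
  by split; rewrite /eta !ge_min lexx ?orbT.
exists eta; first by rewrite !lt_min delta0 etaw0 etau0.
exists (Num.max (Num.max Pw Pu) (Num.max Ps (Num.max Pl Pc))).
  by rewrite !le_max Pw1.
move=> P Rb Q Q'; rewrite !ge_max => /andP[/andP[PPw PPu] /and3P[PPs PPl PPc]].
move=> Rb1 RP QW QQ' Q'W Q'P.
have P1 : 1 <= P by apply: le_trans PPw.
have P0 : 0 < P by apply: lt_le_trans P1.
have etaP (x : R) : eta <= x -> Rb <= P `^ x by move=> h; apply: le_trans RP _; rewrite ler_powR.
have [/etaP RbW /etaP Rbw /etaP Rbu] := eta_le.
move: (HC P PPc); rewrite ge_max => /andP[W4 wW].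
set W := P `^ delta in W4 wW QW Q'W RbW *.
have W1 : 1 <= W by apply: le_trans W4; rewrite ler1n.
have W0 : 0 < W by apply: lt_le_trans W1.
have Q1 : 1 <= Q.
  apply: le_trans QW; have : 1 <= W ^+ k.+1 by exact: exprn_ege1.
  by lra.
have Q0 : 0 < Q by apply: lt_le_trans Q1.
pose S := Q `^ (k%:R^-1).
have SQ : S ^+ k = Q by rewrite -powR_mulrn ?powR_ge0 // -powRrM mulVf // powRr1 // ltW.
have S1 : 1 <= S by rewrite -[leLHS](powRr0 Q) ler_powR // invr_ge0 ltW.
have S0 : 0 < S by apply: lt_le_trans S1.
have XE : S ^+ 2 = Q `^ (2 / k%:R).
  by rewrite -powR_mulrn ?powR_ge0 // -powRrM mulrC.
have SP : S ^+ 2 <= P.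
  rewrite XE; apply: (@le_trans _ _ ((P `^ (k%:R / 2)) `^ (2 / k%:R))).
    by apply: le_powRl; [rewrite divr_ge0 // ltW | exact: ltW | exact: le_trans Q'P].
  rewrite -powRrM; have -> : k%:R / 2 * (2 / k%:R) = 1 :> R by field.
  by rewrite powRr1 // ltW.
have WP : W <= P by rewrite -[leRHS]powRr1 ?(ltW P0) // ler_powR.
have S_P : S <= P by apply: le_trans SP; rewrite expr2 ler_peMl // ltW.
have PP2 : P <= P ^+ 2 by rewrite expr2 ler_peMl // ltW.
have HE : energy R k w (smooth (S * W) Rb) <= W `^ (2 * w%:R) * (S * W) `^ (2 * w%:R - k%:R + Dw).
  rewrite -lee_fin -U_energy // UE ?mulr_gt0 ?ltr0n // lee_fin; apply: HW => //.
    by rewrite mulr_ge0 // ltW.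
  by rewrite expr2; apply: ler_pM => //; exact: ltW.
have Q'Pk : Q' <= P ^+ k.
  apply: le_trans Q'P _; rewrite -powR_mulrn ?(ltW P0) // ler_powR //; lra.
have HUP (Y b : R) : 0 <= Y -> Y <= P -> 1 <= b -> b <= Rb ->
  I01 (fun x => absf k Y b x `^ u) <= W `^ u * Y `^ (u - k%:R + Du).
  move=> Y0 YP b1 bR; apply: HU => //; first exact: le_trans Rbu.
  exact: le_trans PP2.
have Hln (n : nat) : n%:R <= W ^+ 2 * P ^+ k.+1 -> 2 + ln (n%:R : R) <= W by exact: HL.
have HN (q : nat) : (0 < q)%N -> q%:R <= Q' -> (size (pnats \pi(q) (Num.truncn P)))%:R <= W.
  by move=> q0 qQ; apply: HS => //; exact: le_trans Q'Pk.
have w20 : 0 < 4 * (w%:R : R) ^+ 2 by rewrite mulr_gt0 // exprn_gt0 // ltr0n.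
have e0 : 0 <= 2 * w%:R - k%:R + Dw by lra.
have k1 : 1 <= (k%:R : R) by rewrite ler1n.
(* By [admissible_ge], k - 2 Dw <= 4 w - 2 - k, which is less than 2 w^2. *)
have tau2 : tau <= 2^-1.
  by rewrite tauE ler_pdivrMr //; nra.
have tauE' : 4 * w%:R ^+ 2 * (1 - tau) =
   4 * w%:R ^+ 2 - 4 * w%:R + 2 * (2 * w%:R - k%:R + Dw) + k%:R.
  have -> : 4 * w%:R ^+ 2 * (1 - tau) = 4 * w%:R ^+ 2 - 4 * w%:R ^+ 2 * tau by ring.
  by rewrite tauE [_ * (_ / _)]mulrC divfK ?lt0r_neq0 //; ring.
have u0 : 0 <= u by apply: le_trans u2.
have eu1 : 1 <= u - k%:R + Du by lra.
have c10 : 0 <= 2 * (w%:R : R) by rewrite mulr_ge0.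
have kE : Q' * P `^ (- k%:R) = Q' / P ^+ k by rewrite powRN powR_mulrn // ltW.
have kE2 : Q * P `^ (- k%:R) = Q / P ^+ k by rewrite powRN powR_mulrn // ltW.
rewrite -[in 2 * W ^+ _ <= _]SQ in QW; rewrite -[in _ <= Q']SQ in QQ'.
rewrite -[in _ <= Q * W]SQ in Q'W.
have mD : measurable (major k Q' P `\` major k Q P) by apply: measurableD; exact: measurable_major.
have D01 : (major k Q' P `\` major k Q P) `<=` `[0, 1].
  by move=> x [[/andP[x0 x1] _] _]; rewrite /= in_itv /= x0 ltW.
have HD1 x : (major k Q' P `\` major k Q P) x -> exists q a : nat,
  [/\ (0 < q)%N, q%:R <= Q', (a <= q)%N, coprime a q & `|q%:R * x - a%:R| <= Q' / P ^+ k].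
  by rewrite -kE => -[[_ h] _].
have HD2 x : (major k Q' P `\` major k Q P) x -> forall q a : nat, (0 < q)%N -> q%:R <= S ^+ k ->
   (a <= q)%N -> coprime a q -> S ^+ k / P ^+ k < `|q%:R * x - a%:R|.
  move=> [[x01 _] h] q a q0 qQ aq caq; rewrite ltNge; apply/negP => h2; apply: h; split=> //.
  by exists q, a; rewrite kE2 -SQ.
have := @piece_integral R k w P Rb W S Q' (2 * w%:R) u (2 * w%:R - k%:R + Dw) tau t u
  (u - k%:R + Du) w0 P1 W4 wW S1 SP Rb1 RbW QW QQ' Q'W HE Hln c10 e0 tau2 tauE' HUP HN u2 t0 eu1 u0
  _ mD D01 HD1 HD2.
rewrite XE -powRrM.
by have -> : k%:R - (t + u) + t * (1 - tau) + (u - k%:R + Du) = Du - t * tau by ring.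
Qed.

End Scale.

Theorem theorem5p3 (R : realType) (k : nat) (s : R) (Delta : R -> R)
  (tau Dstar theta : R) :
  (1 <= k)%N -> 2 <= s ->
  (* the admissible exponents Delta_u fixed for each u under consideration *)
  (forall w : nat, (1 <= w)%N -> admissible k (2 * w%:R) (Delta (2 * w%:R))) ->
  (forall u : R, 2 <= u -> u <= s -> admissible k u (Delta u)) ->
  (* tau(k) = max_{w in N} (k - 2 Delta_{2w}) / (4 w^2), attained *)
  (exists w0 : nat, (1 <= w0)%N /\
     tau = (k%:R - 2 * Delta (2 * w0%:R)) / (4 * w0%:R ^+ 2)) ->
  (forall w : nat, (1 <= w)%N ->
     (k%:R - 2 * Delta (2 * w%:R)) / (4 * w%:R ^+ 2) <= tau) ->
  (* Dstar = min_{0 <= t <= s-2} (Delta_{s-t} - t tau(k)) *)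
  (exists t0 : R, 0 <= t0 /\ t0 <= s - 2 /\ Dstar = Delta (s - t0) - t0 * tau) ->
  (forall t : R, 0 <= t -> t <= s - 2 -> Dstar <= Delta (s - t) - t * tau) ->
  Dstar < 0 ->
  0 < theta -> theta <= k%:R / 2 ->
  forall eps : R, 0 < eps ->
  exists eta : R, 0 < eta /\
  exists C : R, exists P0 : R,
  forall P Rb Q : R, P0 <= P -> 2 <= Rb -> Rb <= P `^ eta ->
    P `^ theta <= Q -> Q <= P `^ (k%:R / 2) ->
    (intf k s P Rb (minor k Q P)
       <= (C * P `^ (s - k%:R) * Q `^ (eps - 2 * `|Dstar| / k%:R))%:E)%E.
Proof.
move=> k0 s2 admw admu [w [w0 tauE]] _ [t [t0 [ts DE]]] _ D0 theta0 thetak eps eps0.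
pose u := s - t.
have u2 : 2 <= u by rewrite /u; lra.
have us : u <= s by rewrite /u; lra.
have sE : s = t + u by rewrite /u; ring.
have s0 : 0 < s by lra.
have k0' : 0 < (k%:R : R) by rewrite ltr0n.
have kn := lt0r_neq0 k0'.
pose c := 2 * (t + u) + u + u + 6 + t * (4 * w%:R ^+ 2 + 2 * (2 * w%:R) +
  2 * (2 * w%:R - k%:R + Delta (2 * w%:R)) + 3 * k%:R + 8 + 4).
have w1 : 1 <= (w%:R : R) by rewrite ler1n.
have ww2 : 2 <= 2 * (w%:R : R) by lra.
have Dw_ge := admissible_ge ww2 (admw w w0).
have c0 : 0 < c.
  have : 0 <= t * (4 * w%:R ^+ 2 + 2 * (2 * w%:R) +
  2 * (2 * w%:R - k%:R + Delta (2 * w%:R)) + 3 * k%:R + 8 + 4).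
    rewrite mulr_ge0 // !addr_ge0 // ?mulr_ge0 ?exprn_ge0 //; lra.
  by rewrite /c; lra.
(* The second bound gives 2 W^(k+1) <= P^theta <= Q once P^(theta/2) >= 2, as every layer requires;
   the third gives W^c <= P^(eps theta) <= Q^eps at the end. *)
pose delta := Num.min 1 (Num.min (theta / 2 / k.+1%:R) (eps * theta / c)).
have kS0 : 0 < (k.+1%:R : R) by rewrite ltr0n.
have delta0 : 0 < delta.
  by rewrite !lt_min ltr01 /= divr_gt0 ?divr_gt0 ?mulr_gt0.
have [delta1 delta_k delta_c] : [/\ delta <= 1, delta * k.+1%:R <= theta / 2 & delta * c <= eps * theta].
  by split; rewrite -?ler_pdivlMr // /delta !ge_min lexx ?orbT.
have [eta eta0 [P1 P11 main]] :=
  scale_estimate k0 w0 t0 u2 (admw w w0) (admu u u2 us) tauE delta0 delta1.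
have [P2 P21 large] := @large_powR R (theta / 2) 2 (divr_gt0 theta0 (ltr0Sn _ _)).
(* After J factors W = P^delta the point P^(k/2) is passed; J does not depend on P, so it can enter
   the constant. *)
pose J := (Num.truncn (k%:R / 2 / delta)).+1.
exists eta; split=> //; exists J%:R, (Num.max P1 P2) => P Rb Q.
rewrite ge_max => /andP[PP1 PP2] Rb2 RP PQ QP.
have Pge1 : 1 <= P by apply: le_trans PP1.
have P0 : 0 < P by apply: lt_le_trans Pge1.
have Q1 : 1 <= Q by apply: le_trans PQ; rewrite -[leLHS](powRr0 P) ler_powR // ltW.
have Q0 : 0 < Q by apply: lt_le_trans Q1.
set W := P `^ delta in main.
have W1 : 1 <= W by rewrite -[leLHS](powRr0 P) ler_powR // ltW.
have W0 : 0 < W by apply: lt_le_trans W1.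
pose Qs (j : nat) := Num.min (Q * W ^+ j) (P `^ (k%:R / 2)).
have Qs0 : Qs 0%N = Q by rewrite /Qs expr0 mulr1 minEle QP.
have QsS j : Qs j <= Qs j.+1.
  rewrite /Qs le_min !ge_min lexx orbT andbT; apply/orP; left.
  by rewrite ler_wpM2l ?(ltW Q0) // exprS ler_peMl // exprn_ge0 // ltW.
have QsW j : Qs j.+1 <= Qs j * W.
  rewrite /Qs minr_pMl ?(ltW W0) // -mulrA -exprSr le_min !ge_min lexx /=.
  by apply/orP; right; rewrite ler_peMr // powR_ge0.
have QQs j : Q <= Qs j by rewrite -Qs0; elim: j => // j IH; apply: le_trans IH _.
have QsJ : Qs J = P `^ (k%:R / 2).
  rewrite /Qs minEge; suff -> : P `^ (k%:R / 2) <= Q * W ^+ J by [].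
  apply: (@le_trans _ _ (W ^+ J)); last by rewrite ler_peMl // exprn_ge0 // ltW.
  rewrite -powR_mulrn ?(ltW W0) // /W -powRrM ler_powR // [delta * _]mulrC -ler_pdivrMr //.
  by rewrite ltW // truncnS_gt.
pose T := W `^ c * (P `^ (t + u - k%:R) * Q `^ (2 / k%:R * (Delta u - t * tau))).
have piece j : (intf k s P Rb (major k (Qs j.+1) P `\` major k (Qs j) P) <= T%:E)%E.
  have W2 : 2 * W ^+ k.+1 <= Qs j.
    apply: le_trans (QQs j); apply: le_trans PQ.
    have -> : P `^ theta = P `^ (theta / 2) * P `^ (theta / 2).
      by rewrite -powRD_gt0 // -splitr.
    apply: ler_pM; rewrite ?exprn_ge0 ?(ltW W0) //; first exact: large.
    by rewrite -powR_mulrn ?(ltW W0) // -powRrM ler_powR.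
  have R1 : 1 <= Rb by apply: le_trans Rb2; rewrite ler1n.
  have QsP : Qs j.+1 <= P `^ (k%:R / 2) by rewrite ge_min lexx orbT.
  rewrite sE; apply: le_trans (main P Rb (Qs j) (Qs j.+1) PP1 R1 RP W2 (QsS j) (QsW j) QsP) _.
  rewrite lee_fin /T ler_wpM2l ?powR_ge0 // ler_wpM2l ?powR_ge0 //.
  (* Because [Dstar] is negative the power of Q decreases in Q, so each layer is bounded by the
     value at its lower end Q. *)
  rewrite -[Delta u - _]opprK mulrN !powRN lef_pV2 ?posrE ?powR_gt0 //; last first.
    exact: lt_le_trans (QQs j).
  apply: le_powRl => //; last exact: ltW.
  by rewrite mulr_ge0 ?divr_ge0 ?(ltW k0') // oppr_ge0 /u -DE ltW.
rewrite intf_minor // -QsJ -[Q in X in intf _ _ _ _ (_ `\` X)]Qs0.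
apply: le_trans (intf_chain J s0 (ltW P0) QsS piece) _.
rewrite lee_fin -mulrA ler_wpM2l //.
rewrite /T -sE mulrCA ler_wpM2l ?powR_ge0 //.
have -> : eps - 2 * `|Dstar| / k%:R = eps + 2 / k%:R * (Delta u - t * tau).
  by rewrite ltr0_norm // /u -DE; field.
rewrite powRD_gt0 // ler_wpM2r ?powR_ge0 //.
apply: (@le_trans _ _ ((P `^ theta) `^ eps)); last first.
  by apply: le_powRl; rewrite ?powR_ge0 // ltW.
by rewrite -!powRrM ler_powR // [theta * _]mulrC.
Qed.
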